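(* Let $\mathbb{X}=\{\mathbf{x}_1,\dots,\mathbf{x}_N\}\subset\mathbb{R}^d$ consist of distinct points, $P=\sum_kp_k\delta_{\mathbf{x}_k}$ with $p_k>0$, $\sum_kp_k=1$, and let $Q$ be a probability on $\mathbb{R}^d$ with $Q\ll\ell_d$ whose support is connected with Lebesgue negligible boundary. Let $c(\mathbf{x},\mathbf{y})=h(\mathbf{x}-\mathbf{y})$ with $h:\mathbb{R}^d\to[0,\infty)$ differentiable and satisfying (A1)–(A3), and assume $\int c(\mathbf{x}_i,\mathbf{y})\,dQ(\mathbf{y})<\infty$ for all $i$. Let $\mathbf{z}\in\operatorname{Opt}^0_c(P,Q)$. Let $P_n,Q_m$ be the empirical measures of independent i.i.d. samples of sizes $n$ from $P$ and $m$ from $Q$, and let $X\sim\mathcal{N}(0,\sigma^2(P,\mathbf{z}))$ and $Y\sim\mathcal{N}(0,\sigma^2_c(Q,\mathbf{z}))$ be independent. Then (i) $\sqrt{n}(\mathcal{T}_c(P_n,Q)-\mathcal{T}_c(P,Q))\xrightarrow{w}X$. If moreover $\int c(\mathbf{x}_i,\mathbf{y})^2dQ(\mathbf{y})<\infty$ for all $i$, then (ii) $\sqrt{m}(\mathcal{T}_c(P,Q_m)-\mathcal{T}_c(P,Q))\xrightarrow{w}Y$; (iii) if $n,m\to\infty$ with $\frac{m}{n+m}\to\lambda\in(0,1)$, $\sqrt{\tfrac{nm}{n+m}}(\mathcal{T}_c(P_n,Q_m)-\mathcal{T}_c(P,Q))\xrightarrow{w}\sqrt{\lambda}X+\sqr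t{1-\lambda}Y$.
   Context: $\ell_d$ is Lebesgue measure. (A1): $h$ strictly convex. (A2): given $r>0$, $\theta\in(0,\pi)$ there is $M>0$ such that for every $|\mathbf{p}|>M$ there is $\mathbf{w}\neq0$ such that on the cone $\{\mathbf{x}: |\mathbf{x}-\mathbf{p}||\mathbf{w}|\cos(\theta/2)\leq\langle\mathbf{w},\mathbf{x}-\mathbf{p}\rangle\leq r|\mathbf{w}|\}$ the function $h$ attains its maximum at $\mathbf{p}$. (A3): $\lim_{|\mathbf{x}|\to\infty}h(\mathbf{x})/|\mathbf{x}|=\infty$. $\mathcal{T}_c(\mu,\nu)=\inf_{\pi\in\Pi(\mu,\nu)}\int c\,d\pi$; $g_c(P,Q,\mathbf{z})=\sum_iz_ip_i+\int\min_i\{c(\mathbf{x}_i,\mathbf{y})-z_i\}dQ(\mathbf{y})$; $\operatorname{Opt}^0_c(P,Q)=\{\mathbf{z}:\mathcal{T}_c(P,Q)=g_c(P,Q,\mathbf{z}), z_1=0\}$. $\sigma^2(P,\mathbf{z})=\sum_iz_i^2p_i-(\sum_iz_ip_i)^2$ (the variance of $\sum_iz_iW_i$ with $\mathbf{W}\sim\mathcal{N}(0,\Sigma(\mathbf{p}))$, $\Sigma(\mathbf{p})_{ij}=p_i\delta_{ij}-p_ip_j$). $\sigma_c^2(Q,\mathbf{z})=\int f_{\mathbf{z}}^2dQ-\left(\int f_{\mathbf{z}}dQ\right)^2$ with $f_{\mathbf{z}}(\mathbf{y})=\inf_i\{c(\mathbf{x}_i,\mathbf{y})-z_i\}$. 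*)

(* Defs.v *)
From HB Require Import structures.
From mathcomp Require Import all_boot all_order all_algebra.
From mathcomp Require Import all_classical all_reals all_analysis.
Set Implicit Arguments. Unset Strict Implicit. Unset Printing Implicit Defensive.
Import Order.TTheory GRing.Theory Num.Theory.
Import numFieldNormedType.Exports.
Local Open Scope classical_set_scope.
Local Open Scope ring_scope.

Section Defs.
Variable R : realType.

Definition Rd (d : nat) := g_sigma_algebraType (@open 'rV[R]_d).

Definition edot d (u v : 'rV[R]_d) : R := \sum_(i < d) u 0 i * v 0 i.
Definition enorm d (u : 'rV[R]_d) : R := Num.sqrt (edot u u).

Definition box d (a b : 'rV[R]_d) : set 'rV[R]_d :=
  [set x | forall i, a 0 i <= x 0 i <= b 0 i].
Definition box_vol d (a b : 'rV[R]_d) : R :=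
  \prod_(i < d) Num.max (b 0 i - a 0 i) 0.
Definition lebesgue_null d (A : set 'rV[R]_d) : Prop :=
  forall eps : R, 0 < eps -> exists a b : nat -> 'rV[R]_d,
    A `<=` \bigcup_k box (a k) (b k) /\
    (\sum_(0 <= k <oo) (box_vol (a k) (b k))%:E < eps%:E)%E.

Definition abs_cont_leb d (Q : set (Rd d) -> \bar R) : Prop :=
  forall A : set (Rd d), measurable A -> lebesgue_null A -> Q A = 0%E.

Definition msupport d (Q : set (Rd d) -> \bar R) : set 'rV[R]_d :=
  [set x | forall U : set 'rV[R]_d, open U -> U x -> (0 < Q U)%E].

Definition boundary d (A : set 'rV[R]_d) : set 'rV[R]_d :=
  closure A `\` interior A.

Definition strictly_convex d (h : 'rV[R]_d -> R) : Prop :=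
  forall x y : 'rV[R]_d, x != y -> forall t : R, 0 < t < 1 ->
    h (t *: x + (1 - t) *: y) < t * h x + (1 - t) * h y.

Definition cone d (p w : 'rV[R]_d) (r theta : R) : set 'rV[R]_d :=
  [set x | enorm (x - p) * enorm w * cos (theta / 2) <= edot w (x - p)
           <= r * enorm w].

Definition assumption_A2 d (h : 'rV[R]_d -> R) : Prop :=
  forall r theta : R, 0 < r -> 0 < theta < pi ->
    exists M : R, 0 < M /\ forall p : 'rV[R]_d, M < enorm p ->
      exists w : 'rV[R]_d, w != 0 /\
        forall x, cone p w r theta x -> h x <= h p.

Definition superlinear d (h : 'rV[R]_d -> R) : Prop :=
  forall K : R, exists R0 : R, forall x : 'rV[R]_d, R0 < enorm x ->
    K * enorm x <= h x.

Definition coupling d (pi : probability (Rd d * Rd d)%type R)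
  (mu nu : set (Rd d) -> \bar R) : Prop :=
  (forall A : set (Rd d), measurable A -> pi (A `*` setT) = mu A) /\
  (forall B : set (Rd d), measurable B -> pi (setT `*` B) = nu B).

Definition Tc d (c : 'rV[R]_d -> 'rV[R]_d -> R)
  (mu nu : set (Rd d) -> \bar R) : \bar R :=
  ereal_inf [set (\int[pi]_z (c z.1 z.2)%:E)%E
            | pi in [set pi | coupling pi mu nu]].

Definition discrete_measure d N (x : 'I_N -> Rd d) (p : 'I_N -> R)
  : set (Rd d) -> \bar R :=
  fun A => (\sum_(k < N) (p k)%:E * \d_(x k) A)%E.

(* f_z(y) = min_i (c(x_i,y) - z_i), i0 is any index (seed of the min) *)
Definition fz d N (c : 'rV[R]_d -> 'rV[R]_d -> R) (x : 'I_N -> 'rV[R]_d)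
  (z : 'I_N -> R) (i0 : 'I_N) (y : 'rV[R]_d) : R :=
  \big[Num.min/c (x i0) y - z i0]_(i < N) (c (x i) y - z i).

Definition gc d N (c : 'rV[R]_d -> 'rV[R]_d -> R) (x : 'I_N -> 'rV[R]_d)
  (p : 'I_N -> R) (Q : probability (Rd d) R) (z : 'I_N -> R) (i0 : 'I_N)
  : \bar R :=
  ((\sum_(i < N) z i * p i)%:E + \int[Q]_y (fz c x z i0 y)%:E)%E.

Definition sigma2 N (p z : 'I_N -> R) : R :=
  \sum_(i < N) z i ^+ 2 * p i - (\sum_(i < N) z i * p i) ^+ 2.

Definition sigma2c d N (c : 'rV[R]_d -> 'rV[R]_d -> R) (x : 'I_N -> 'rV[R]_d)
  (Q : probability (Rd d) R) (z : 'I_N -> R) (i0 : 'I_N) : R :=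
  fine (\int[Q]_y ((fz c x z i0 y) ^+ 2)%:E)%E
  - (fine (\int[Q]_y (fz c x z i0 y)%:E)%E) ^+ 2.

Definition empirical d (S : nat -> Rd d) (n : nat) : set (Rd d) -> \bar R :=
  fun A => ((n%:R^-1)%:E * \sum_(k < n) \d_(S k) A)%E.

Definition mutually_independent {dO dT} {O : measurableType dO}
  {T : measurableType dT} {I : eqType} (Pr : probability O R)
  (Z : I -> O -> T) : Prop :=
  forall (s : seq I) (B : I -> set T), uniq s ->
    (forall i, measurable (B i)) ->
    Pr (\bigcap_(i in [set` s]) (Z i @^-1` B i)) =
      (\prod_(i <- s) Pr (Z i @^-1` B i))%E.

Definition gauss1 (f : R -> R) (s : R) : \bar R :=
  (\int[lebesgue_measure]_u (f (s * u) * normal_pdf 0 1 u)%:E)%E.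

Definition gauss2 (f : R -> R) (a b : R) : \bar R :=
  (\int[lebesgue_measure]_u \int[lebesgue_measure]_v
     (f (a * u + b * v) * normal_pdf 0 1 u * normal_pdf 0 1 v)%:E)%E.

(* weak convergence (convergence in law) of the real random variables T k
   to the law described by its expectation functional [law] *)
Definition cvg_in_law {dO} {O : measurableType dO} (Pr : probability O R)
  (T : nat -> O -> R) (law : (R -> R) -> \bar R) : Prop :=
  forall f : R -> R, continuous f -> (exists M : R, forall t, `|f t| <= M) ->
    (fun k => \int[Pr]_w (f (T k w))%:E)%E @ \oo --> law f.

Definition cost_of d (h : 'rV[R]_d -> R) : 'rV[R]_d -> 'rV[R]_d -> R :=
  fun u v => h (u - v).

End Defs.

(* Main.v *)
(* Kantorovich duality with a discrete first marginal turns the cost into the maximum over z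
   of a concave function D(z) = sum_i z_i p_i + int min_i (c(x_i, y) - z_i) dQ(y), and
   connectedness of the support of Q makes the maximizer with z_1 = 0 unique.  If (P', Q') is
   close to (P, Q), concavity confines the maximizers of the empirical dual D' to a small sphere
   around z, and almost optimal transport weights w_i for (P, Q) give an approximate
   supergradient of D' at z: the empirical cost exceeds D'(z) by at most the mean slack of w
   under Q' plus a small multiple of sum_i |p'_i - int w_i dQ'|.  The slack can be made
   arbitrarily small and the last sum is of the order of the sampling error, so after rescaling
   only D'(z) - D(z) survives, a sum of independent terms.

   The central limit theorem is proved by Lindeberg's method in Trotter's form on test functions
   smoothed by a Gaussian, for two samples at once: zero observations stand for the true law, so
   that (i) and (ii) are cases of the same statement as (iii).  The empirical cost is not known
   to be measurable, so convergence in law is transferred to it by sandwiching integrals. *)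

Require Import Defs.
From HB Require Import structures.
From mathcomp Require Import all_boot all_order all_algebra finmap.
From mathcomp Require Import all_classical all_reals all_analysis.
From mathcomp Require Import measurable_realfun giry ring lra.
Import Order.TTheory GRing.Theory Num.Theory.
Import numFieldNormedType.Exports.
Local Open Scope classical_set_scope.
Local Open Scope ring_scope.
Set Implicit Arguments. Unset Strict Implicit. Unset Printing Implicit Defensive.

(** * Maxima over boxes and the soft maximum *)

(** Two demands shape the proof: part (i) offers only a first moment of the cost, and duality has to
    supply measurable weights with exact marginals. All that is compared between a sample and its
    law is therefore bounded: indicators of the sites, weights with values in [0, 1], and
    differences of the minima at two points [v] and [z], bounded by the largest [|v i - z i|].
    Chebyshev's inequality then gives deviations of the order of the sampling error whatever the
    weights are, so the weights may be chosen anew for each sample size, so accurate that Markov's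
    inequality absorbs their slack after rescaling. The weights come from an entropic smoothing of
    the dual. With a soft minimum at temperature [eps] in place of the minimum, stationarity says
    that the softmax weights have integrals [p i], at a price of at most [eps * N] in the cost. They
    also define couplings, which gives strong duality for the true and for the sampled marginals.
    Confinement of the maximizers reduces to finitely many dual differences, by a finite net on the
    sphere and a Lipschitz bound common to all marginals. *)

Lemma mem_ListIn (T : eqType) (x : T) (s : seq T) : x \in s <-> List.In x s.
Proof.
elim: s => //= a s IH; rewrite in_cons; split.
  by move=> /orP[/eqP->|/IH]; [left|right].
by case=> [->|/IH ->]; rewrite ?eqxx ?orbT.
Qed.

Section lipschitz_box.
Variables (R : realType) (N : nat).
Implicit Types (z lo hi : 'I_N -> R).

Let box_rV lo hi : set 'rV[R]_N := [set v | forall i, lo i <= v 0 i <= hi i].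

Let compact_box_rV lo hi : compact (box_rV lo hi).
Proof.
rewrite (_ : box_rV lo hi = [set v | forall i, `[lo i, hi i]%classic (v ord0 i)]).
  by apply: (@rV_compact _ _ (fun i => `[lo i, hi i]%classic)) => i; exact: segment_compact.
by apply/seteqP; split => v /= + i => /(_ i); rewrite /= in_itv.
Qed.

(** The box is moved to row vectors, where it is a compact product of segments and where the sup
    norm turns the coordinatewise Lipschitz bound into continuity. *)
Lemma lipschitz_box_max (G : ('I_N -> R) -> R) (C : R) lo hi :
  (forall z z' e, 0 <= e -> (forall i, `|z i - z' i| <= e) -> `|G z - G z'| <= C * e) ->
  (forall i, lo i <= hi i) ->
  exists z, (forall i, lo i <= z i <= hi i) /\
    forall z', (forall i, lo i <= z' i <= hi i) -> G z' <= G z.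
Proof.
move=> GC lohi.
have rowE v : (fun i => (\row_j v j) 0 i) = v by apply/funext => i; rewrite mxE.
pose g (v : 'rV[R]_N) := G (fun i => v 0 i).
have cg : continuous g.
  move=> v; apply/(@cvgrPdist_le _ _ _ _ (nbhs_filter v)) => e e0.
  have C0 : 0 < `|C| + 1 by rewrite ltr_wpDl.
  have d0 : 0 < e / (`|C| + 1) by rewrite divr_gt0.
  near=> u.
  have : ball v (e / (`|C| + 1)) u by near: u; exact: nbhsx_ballx.
  rewrite mx_norm_ball /ball_ /= => vu.
  apply: (le_trans (GC _ _ (e / (`|C| + 1)) (ltW d0) _)); last first.
    rewrite mulrA ler_pdivrMr// mulrC; apply: ler_wpM2l; first exact: ltW.
    by rewrite (le_trans (ler_norm _))// lerDl.
  move=> i; rewrite ltW// (le_lt_trans _ vu)//.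
  have -> : v 0 i - u 0 i = (v - u) 0 i by rewrite !mxE.
  by rewrite [leRHS]/Num.norm /= mx_normrE; apply/bigmax_geP; right => /=; exists (0, i).
have ne : box_rV lo hi !=set0.
  by exists (\row_j lo j) => i; rewrite mxE lexx lohi.
have [v vA vmax] := @EVT_max_rV R N g _ ne (@compact_box_rV lo hi)
  (continuous_subspaceT cg).
rewrite inE in vA; exists (fun i => v 0 i); split=> // z' z'A.
have := vmax (\row_j z' j); rewrite inE /g rowE; apply => i.
by rewrite mxE.
Unshelve. all: by end_near. Qed.

(** Compactness extracts finitely many centres from the cover by balls. They are kept as a list
    queried by [List.In], so that nets can be concatenated and treated by induction. *)
Lemma box_net lo hi (r : R) : 0 < r ->
  exists V : seq ('I_N -> R),
    (forall v, List.In v V -> forall i, lo i <= v i <= hi i) /\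
    forall z, (forall i, lo i <= z i <= hi i) ->
      exists2 v, List.In v V & forall i, `|z i - v i| <= r.
Proof.
move=> r0.
have := @compact_box_rV lo hi; rewrite compact_cover.
move=> /(_ _ (box_rV lo hi) (fun u : 'rV[R]_N => (ball u r)^°)).
case.
- by move=> v _; exact: open_interior.
- move=> v vA; exists v => //.
  by apply: (@nbhs_singleton _ _ _); exact/nbhs_interior/nbhsx_ballx.
- move=> D DA cov.
  exists [seq (fun i => v 0 i) | v : 'rV[R]_N <- (finmap.enum_fset D)]; split.
    move=> v /List.in_map_iff [u [<- uD]] i.
    have /DA : u \in D by exact/mem_ListIn.
    by rewrite inE; exact.
  move=> z zA.
  have [|u uD] := cov (\row_j z j); first by move=> i; rewrite mxE.
  move=> /interior_subset; rewrite mx_norm_ball /ball_ /= => uz.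
  exists (fun i => u 0 i).
    apply/List.in_map_iff; exists u; split => //.
    exact/mem_ListIn.
  move=> i; rewrite distrC ltW// (le_lt_trans _ uz)//.
  have -> : u 0 i - z i = (u - \row_j z j) 0 i by rewrite !mxE.
  by rewrite [leRHS]/Num.norm /= mx_normrE; apply/bigmax_geP; right => /=; exists (0, i).
Qed.

End lipschitz_box.

Section softmin.
Variables (R : realType) (N : nat) (i0 : 'I_N).
Implicit Types (a : 'I_N -> R).

Definition sumexp a : R := \sum_j expR (a j).
Definition softmax a i : R := expR (a i) / sumexp a.

Lemma sumexp_ge a i : expR (a i) <= sumexp a.
Proof.
rewrite /sumexp (bigD1 i)//= lerDl; apply: sumr_ge0 => j _; exact: expR_ge0.
Qed.

Lemma sumexp_gt0 a : 0 < sumexp a.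
Proof. by rewrite (lt_le_trans _ (sumexp_ge a i0))// expR_gt0. Qed.

Lemma softmax_ge0 a i : 0 <= softmax a i.
Proof. by rewrite /softmax divr_ge0// ?expR_ge0// ltW// sumexp_gt0. Qed.

Lemma softmax_le1 a i : softmax a i <= 1.
Proof. by rewrite /softmax ler_pdivrMr ?sumexp_gt0// mul1r sumexp_ge. Qed.

Lemma sum_softmax a : \sum_i softmax a i = 1.
Proof. by rewrite /softmax -mulr_suml divff// gt_eqF// sumexp_gt0. Qed.

Lemma ln_sumexp_ge a i : a i <= ln (sumexp a).
Proof.
rewrite -[leLHS]expRK ler_ln ?posrE ?expR_gt0 ?sumexp_gt0//; exact: sumexp_ge.
Qed.

(* Each term [- w ln w] of the entropy is at most 1, since [ln x <= x]. *)
Lemma softmax_entropy a : \sum_i softmax a i * (- a i) <= - ln (sumexp a) + N%:R.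
Proof.
have S0 := sumexp_gt0 a.
have H i : softmax a i * (- a i) <= softmax a i * (- ln (sumexp a)) + 1.
  have w0 : 0 < softmax a i by rewrite /softmax divr_gt0// expR_gt0.
  have -> : a i = ln (sumexp a) + ln (softmax a i).
    by rewrite /softmax ln_div ?posrE ?expR_gt0// expRK; ring.
  rewrite opprD mulrDr lerD2l -lnV ?posrE//.
  apply: (@le_trans _ _ (softmax a i * (softmax a i)^-1)).
    apply: ler_wpM2l; first exact: softmax_ge0.
    by rewrite ltW// ln_sublinear// invr_gt0.
  by rewrite divff// gt_eqF.
apply: (le_trans (ler_sum _ (fun i _ => H i))).
by rewrite big_split/= -mulr_suml sum_softmax mul1r sumr_const card_ord.
Qed.

(** Raising one exponent by [s] multiplies the sum by [1 + softmax a i * (expR s - 1)], and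
    [ln (1 + x) <= x]. This identifies the softmax weight as the derivative of the log-sum-exp in a
    form that can be integrated directly. *)
Lemma ln_sumexp_perturb a i (s : R) :
  ln (sumexp (fun j => a j + (j == i)%:R * s)) <=
  ln (sumexp a) + softmax a i * (expR s - 1).
Proof.
have S0 := sumexp_gt0 a.
have E : sumexp (fun j => a j + (j == i)%:R * s) =
    sumexp a * (1 + softmax a i * (expR s - 1)).
  rewrite /softmax mulrDr mulr1 mulrA (mulrC (sumexp a)) divfK ?gt_eqF//.
  rewrite /sumexp (bigD1 i)//= [in RHS](bigD1 i)//= eqxx mul1r expRD.
  rewrite (eq_bigr (fun j => expR (a j))); last first.
    by move=> j /negbTE ->; rewrite mul0r addr0.
  by ring.
have E0 : 0 < 1 + softmax a i * (expR s - 1).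
  by rewrite -(pmulr_rgt0 _ S0) -E sumexp_gt0.
rewrite E lnM ?posrE// lerD2l; apply: le_ln1Dx.
by rewrite -subr_gt0 opprK addrC.
Qed.

Lemma ln_sumexp_lip a b (e : R) : (forall i, `|a i - b i| <= e) ->
  ln (sumexp a) <= ln (sumexp b) + e.
Proof.
move=> ab; rewrite -[e]expRK -lnM ?posrE ?sumexp_gt0 ?expR_gt0//.
rewrite ler_ln ?posrE ?mulr_gt0 ?sumexp_gt0 ?expR_gt0//.
rewrite /sumexp mulr_suml; apply: ler_sum => i _; rewrite -expRD ler_expR -lerBlDl.
exact: le_trans (ler_norm _) (ab i).
Qed.

End softmin.

(** Inverting [expR (- s) >= 1 - s] leaves the comparison of [1 / (1 - s)] with the quadratic, which
    holds exactly because [1 - 2 * s] is nonnegative. *)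
Lemma expR_le_quadratic (R : realType) (s : R) : s <= 2^-1 ->
  expR s <= 1 + s + 2 * s ^+ 2.
Proof.
move=> s2; have H := expR_ge1Dx (- s).
have P : 0 < 1 - s by lra.
rewrite -[expR s]invrK -expRN.
apply: (@le_trans _ _ (1 - s)^-1); first by rewrite lef_pV2 ?posrE ?expR_gt0.
rewrite -[leLHS]mul1r ler_pdivrMr//.
have -> : (1 + s + 2 * s ^+ 2) * (1 - s) = 1 + s ^+ 2 * (1 - 2 * s) by ring.
rewrite lerDl mulr_ge0// ?sqr_ge0//; lra.
Qed.

(** A line below the convex curve [(expR s - 1) * m] and meeting it at 0 is its tangent there. Small
    positive [s] give one inequality between the slopes, small negative [s] the other. *)
Lemma expR_minorant_unique (R : realType) (p m : R) : 0 <= m ->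
  (forall s, s * p <= (expR s - 1) * m) -> p = m.
Proof.
move=> m0 H; apply/eqP; rewrite eq_le; apply/andP; split.
  apply/ler_addgt0Pr => e e0.
  (* The quadratic bound holds up to 1/2, and its error [2 * s * m] must stay below [e]. *)
  pose s := Num.min 2^-1 (e / (2 * m + 1)).
  have d0 : 0 < 2 * m + 1 by lra.
  have s0 : 0 < s by rewrite /s lt_min invr_gt0 ltr0n divr_gt0.
  have s2 : s <= 2^-1 by rewrite /s ge_min lexx.
  have se : s * (2 * m + 1) <= e by rewrite -ler_pdivlMr// /s ge_min lexx orbT.
  have := H s; have := expR_le_quadratic s2 => H1 H2.
  rewrite -(ler_pM2l s0).
  have H3 := ler_wpM2r m0 H1.
  have H4 : s * (2 * s * m) <= s * e by rewrite ler_pM2l//; lra.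
  by lra.
apply/ler_addgt0Pr => e e0.
pose s := Num.min 2^-1 (e / (2 * m + 1)).
have d0 : 0 < 2 * m + 1 by lra.
have s0 : 0 < s by rewrite /s lt_min invr_gt0 ltr0n divr_gt0.
have se : s * (2 * m + 1) <= e by rewrite -ler_pdivlMr// /s ge_min lexx orbT.
have s2 : - s <= 2^-1 by rewrite (le_trans (ltW (_ : - s < 0))) ?oppr_lt0// invr_ge0.
have := H (- s); have := expR_le_quadratic s2 => H1 H2.
rewrite -(ler_pM2l s0).
have H3 := ler_wpM2r m0 H1.
have H4 : s * (2 * s * m) <= s * e by rewrite ler_pM2l//; lra.
by lra.
Qed.

(** * Integrable functions and the dual functional *)

Notation integrableR mu f := (integrable mu setT (EFin \o f)).

Section real_integral.
Context {d} {T : measurableType d} {R : realType}.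
Implicit Types (mu : {measure set T -> \bar R}) (f g : T -> R).

Lemma integrableR_meas mu f : integrableR mu f -> measurable_fun setT f.
Proof. by move=> /measurable_int/measurable_EFinP. Qed.

Lemma integrableR_le mu f g : measurable_fun setT f -> integrableR mu g ->
  (forall y, `|f y| <= g y) -> integrableR mu f.
Proof.
move=> mf ig fg; apply: le_integrable ig => //; first exact/measurable_EFinP.
by move=> y _; rewrite /= lee_fin (le_trans (fg y))// ler_norm.
Qed.

Lemma integrableRD mu f g : integrableR mu f -> integrableR mu g ->
  integrableR mu (fun y => f y + g y).
Proof. by move=> i j; exact: (integrableD measurableT i j). Qed.

Lemma integrableRB mu f g : integrableR mu f -> integrableR mu g ->
  integrableR mu (fun y => f y - g y).
Proof. by move=> i j; exact: (integrableB measurableT i j). Qed.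

Lemma integrableRZ mu k f : integrableR mu f -> integrableR mu (fun y => k * f y).
Proof. by move=> i; exact: (integrableZl measurableT k i). Qed.

Lemma integrableRsum mu (I : Type) (s : seq I) (f : I -> T -> R) :
  (forall i, integrableR mu (f i)) ->
  integrableR mu (fun y => \sum_(i <- s) f i y).
Proof.
move=> fi; have := @integrable_sum _ _ _ mu setT measurableT I s xpredT
  (fun i y => (f i y)%:E) (fun i _ => fi i).
by apply: eq_integrable => // y _ /=; rewrite sumEFin.
Qed.

Lemma integrableR_abs mu f : integrableR mu f -> integrableR mu (fun y => `|f y|).
Proof. by move=> i; exact: (integrable_norm i). Qed.

Lemma Rintegral_sum mu (I : Type) (s : seq I) (f : I -> T -> R) :
  (forall i, integrableR mu (f i)) ->
  \int[mu]_y (\sum_(i <- s) f i y) = \sum_(i <- s) \int[mu]_y f i y.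
Proof.
move=> fi; elim: s => [|a s IH].
  rewrite big_nil; under eq_Rintegral do rewrite big_nil.
  by rewrite /Rintegral integral0.
rewrite big_cons -IH -RintegralD//; last exact: integrableRsum.
by apply: eq_Rintegral => y _; rewrite big_cons.
Qed.

Lemma Rintegral_le mu f g : integrableR mu f -> integrableR mu g ->
  (forall y, f y <= g y) -> \int[mu]_y f y <= \int[mu]_y g y.
Proof. by move=> i j fg; apply: le_Rintegral. Qed.

Lemma Rintegral_EFin mu f : integrableR mu f ->
  (\int[mu]_y f y)%:E = (\int[mu]_y (f y)%:E)%E.
Proof. by move=> i; rewrite /Rintegral fineK//; exact: integrable_fin_num. Qed.

Lemma integrableR_ge0 mu f : measurable_fun setT f -> (forall y, 0 <= f y) ->
  (\int[mu]_y (f y)%:E < +oo)%E -> integrableR mu f.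
Proof.
move=> mf f0 foo; apply/integrableP; split; first exact/measurable_EFinP.
by under eq_integral do rewrite /= ger0_norm//.
Qed.

Lemma integrableR_bound (P : probability T R) f (M : R) : measurable_fun setT f ->
  (forall y, `|f y| <= M) -> integrableR P f.
Proof.
move=> mf fM; apply: (@integrableR_le _ _ (cst M)) => //.
exact: finite_measure_integrable_cst.
Qed.

Lemma integrableR_cst (P : probability T R) (k : R) : integrableR P (fun=> k).
Proof. exact: finite_measure_integrable_cst. Qed.

Lemma Rintegral_prob_cst (P : probability T R) (k : R) : \int[P]_y k = k.
Proof.
rewrite Rintegral_cst// (_ : fine _ = 1) ?mulr1//.
by rewrite -[1]/(fine 1%E); congr fine; exact: probability_setT.
Qed.

End real_integral.

Section finite_min.
Variables (R : realType) (N : nat) (i0 : 'I_N).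
Implicit Types (a b : 'I_N -> R).

(** The seed is one of the values, so it does not alter the minimum; it is also the seed of [fz],
    which makes [cmin] below convertible to [fz]. *)
Definition minf a : R := \big[Num.min/a i0]_(i < N) a i.

Lemma minf_le a i : minf a <= a i.
Proof. exact: bigmin_le. Qed.

Lemma minf_ex a : exists i, minf a = a i.
Proof.
rewrite /minf; elim/big_ind: _ => [|x y [i ->] [j ->]|i _]; [by exists i0| |by exists i].
by case: (leP (a i) (a j)) => _; [exists i|exists j].
Qed.

Lemma le_minf a (x : R) : (forall i, x <= a i) -> x <= minf a.
Proof. by move=> H; have [i ->] := minf_ex a. Qed.

Lemma minf_lip a b e : (forall i, `|a i - b i| <= e) -> `|minf a - minf b| <= e.
Proof.
move=> ab; rewrite ler_distlC; apply/andP; split.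
  apply: le_minf => i; rewrite lerBlDr (le_trans (minf_le a i))//.
  by have := ab i; rewrite ler_distlC => /andP[]; lra.
rewrite -lerBlDr; apply: le_minf => i; rewrite lerBlDr (le_trans (minf_le b i))//.
by have := ab i; rewrite ler_distlC => /andP[]; lra.
Qed.

Lemma abs_minf a : `|minf a| <= \sum_i `|a i|.
Proof.
have [i ->] := minf_ex a; rewrite (bigD1 i)//= lerDl.
by apply: sumr_ge0.
Qed.

End finite_min.

Section semidiscrete.
Context {d} {T : measurableType d} {R : realType}.
Variables (N : nat) (i0 : 'I_N).
Implicit Types (Q : probability T R) (c : 'I_N -> T -> R) (p z : 'I_N -> R).

Definition cmin c z y : R := minf i0 (fun i => c i y - z i).

Definition dual c p Q z : R := \sum_i z i * p i + \int[Q]_y cmin c z y.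

Lemma measurable_cmin c z : (forall i, measurable_fun setT (c i)) ->
  measurable_fun setT (cmin c z).
Proof.
move=> mc; rewrite /cmin /minf.
have H (s : seq 'I_N) : measurable_fun setT
    (fun y => \big[Num.min/c i0 y - z i0]_(i <- s) (c i y - z i)).
  elim: s => [|i s IH].
    by under eq_fun do rewrite big_nil; exact: measurable_funB.
  under eq_fun do rewrite big_cons.
  by apply: measurable_minr => //; exact: measurable_funB.
exact: H.
Qed.

Lemma integrable_cmin c Q z : (forall i, integrableR Q (c i)) ->
  integrableR Q (cmin c z).
Proof.
move=> ic; apply: (@integrableR_le _ _ _ _ _ (fun y => \sum_i `|c i y - z i|)).
- by apply: measurable_cmin => i; exact: integrableR_meas (ic i).
- apply: integrableRsum => i; apply: integrableR_abs; apply: integrableRB => //.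
  exact: integrableR_cst.
- by move=> y; exact: abs_minf.
Qed.

Lemma cmin_le c z y i : cmin c z y <= c i y - z i.
Proof. exact: minf_le. Qed.

(** The linear part and the minimum contribute one [e] each. The constant depends on neither [p] nor
    [Q], so that one net serves the true and the empirical dual alike. *)
Lemma dual_lip c p Q z z' e : (forall i, 0 <= p i) -> \sum_i p i = 1 ->
  (forall i, integrableR Q (c i)) -> (forall i, `|z i - z' i| <= e) ->
  `|dual c p Q z - dual c p Q z'| <= 2 * e.
Proof.
move=> p0 p1 ic zz.
have -> : dual c p Q z - dual c p Q z' = \sum_i (z i - z' i) * p i +
    \int[Q]_y (cmin c z y - cmin c z' y).
  rewrite RintegralB//; [|exact: integrable_cmin..].
  under [in RHS]eq_bigr do rewrite mulrBl.
  by rewrite sumrB /dual; ring.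
rewrite mulr_natl mulr2n (le_trans (ler_normD _ _))// lerD//.
  rewrite (le_trans (ler_norm_sum _ _ _))// -[leRHS]mulr1 -p1 mulr_sumr.
  apply: ler_sum => i _; rewrite normrM (ger0_norm (p0 i)).
  exact: ler_wpM2r.
have ib : integrableR Q (fun y => cmin c z y - cmin c z' y).
  by apply: integrableRB; exact: integrable_cmin.
rewrite (le_trans (le_normr_Rintegral _ ib))// -[leRHS](Rintegral_prob_cst Q).
apply: Rintegral_le; [exact: integrableR_abs|exact: integrableR_cst|].
move=> y; apply: minf_lip => i.
by rewrite (_ : _ - _ = z' i - z i); [rewrite distrC|ring].
Qed.

End semidiscrete.

(** * Entropic regularization of the dual *)

Section entropic_dual.
Context {d} {T : measurableType d} {R : realType}.
Variables (N : nat) (i0 : 'I_N) (Q : probability T R) (c : 'I_N -> T -> R).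
Variables (p : 'I_N -> R) (eps : R).
Hypothesis ic : forall i, integrableR Q (c i).
Hypothesis c_ge0 : forall i y, 0 <= c i y.
Hypothesis p_gt0 : forall i, 0 < p i.
Hypothesis p_sum : \sum_i p i = 1.
Hypothesis eps_gt0 : 0 < eps.
Implicit Types z : 'I_N -> R.

Let expo z y : 'I_N -> R := fun j => (z j - c j y) / eps.
Let lse z y : R := ln (sumexp (expo z y)).
(** [- eps * lse] is the soft minimum of the [c j y - z j], so this is the smoothed dual; it is
    smooth in [z], and its stationarity condition prescribes the integrals of the softmax
    weights. *)
Let reg z : R := \sum_i z i * p i - eps * \int[Q]_y lse z y.

Let measurable_expo z j : measurable_fun setT (fun y => expo z y j).
Proof.
apply: measurable_funM => //; apply: measurable_funB => //.
exact: integrableR_meas (ic j).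
Qed.

Let measurable_sumexp z : measurable_fun setT (fun y => sumexp (expo z y)).
Proof.
apply: measurable_sum => j.
exact: (measurableT_comp (@measurable_expR R) (measurable_expo z j)).
Qed.

Let measurable_weight z i : measurable_fun setT (fun y => softmax (expo z y) i).
Proof.
apply: (@eq_measurable_fun _ _ _ _ setT
    (fun y => expR (expo z y i - lse z y))).
  move=> y _; rewrite expRB /softmax lnK// posrE; exact: sumexp_gt0 i0 _.
apply: (measurableT_comp (@measurable_expR R)).
apply: measurable_funB => //.
exact: (measurableT_comp (@measurable_ln R) (measurable_sumexp z)).
Qed.

Let integrable_expo z j : integrableR Q (fun y => expo z y j).
Proof.
have : integrableR Q (fun y => eps^-1 * (z j - c j y)).
  by apply: integrableRZ; apply: integrableRB => //; exact: integrableR_cst.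
by apply: eq_integrable => // y _; rewrite /= /expo mulrC.
Qed.

(** One exponent bounds it from below. From above, the entropy inequality bounds it by [N] plus a
    convex combination of the exponents, all of them integrable. *)
Let integrable_lse z : integrableR Q (lse z).
Proof.
apply: (@integrableR_le _ _ _ _ _ (fun y => N%:R + \sum_j `|expo z y j|)).
- exact: (measurableT_comp (@measurable_ln R) (measurable_sumexp z)).
- apply: integrableRD; first exact: integrableR_cst.
  by apply: integrableRsum => j; exact: integrableR_abs.
- move=> y; rewrite ler_norml; apply/andP; split.
    rewrite lerNl (le_trans (_ : _ <= - expo z y i0))//.
      by rewrite lerN2; exact: ln_sumexp_ge.
    rewrite (bigD1 i0)//= (le_trans (ler_norm _))// normrN addrCA lerDl.
    by rewrite addr_ge0// sumr_ge0.
  have := softmax_entropy i0 (expo z y); rewrite -/(lse z y) => H.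
  have {}H : lse z y <= N%:R + \sum_i softmax (expo z y) i * expo z y i.
    by move: H; under eq_bigr do rewrite mulrN; rewrite sumrN; lra.
  rewrite (le_trans H)// lerD2l; apply: ler_sum => i _.
  rewrite (le_trans (ler_norm _))// normrM -[leRHS]mul1r.
  apply: ler_wpM2r => //; rewrite ger0_norm; first exact: softmax_le1 i0 _ _.
  exact: softmax_ge0 i0 _ _.
Qed.

Let reg_lip z z' (e : R) : 0 <= e -> (forall i, `|z i - z' i| <= e) ->
  `|reg z - reg z'| <= 2 * e.
Proof.
move=> e0 zz.
have -> : reg z - reg z' = \sum_i (z i - z' i) * p i -
    eps * \int[Q]_y (lse z y - lse z' y).
  rewrite RintegralB//.
  under [in RHS]eq_bigr do rewrite mulrBl.
  rewrite sumrB mulrBr /reg.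
  move: (eps * \int[Q]_y lse z y) (eps * \int[Q]_y lse z' y) => a b.
  by move: (\sum_i z i * p i) (\sum_i z' i * p i) => s t; ring.
rewrite mulr_natl mulr2n (le_trans (ler_normB _ _))// lerD//.
  rewrite (le_trans (ler_norm_sum _ _ _))// -[leRHS]mulr1 -p_sum mulr_sumr.
  apply: ler_sum => i _; rewrite normrM (ger0_norm (ltW (p_gt0 i))).
  by apply: ler_wpM2r => //; exact: ltW.
rewrite normrM gtr0_norm// -ler_pdivlMl// mulrC.
have ib : integrableR Q (fun y => lse z y - lse z' y) by exact: integrableRB.
rewrite (le_trans (le_normr_Rintegral _ ib))// -[leRHS](Rintegral_prob_cst Q).
apply: Rintegral_le; [exact: integrableR_abs|exact: integrableR_cst|].
have K z1 z2 y : (forall i, `|z1 i - z2 i| <= e) ->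
    forall i, `|expo z1 y i - expo z2 y i| <= e / eps.
  move=> H i; rewrite /expo -mulrBl (_ : _ - _ = z1 i - z2 i); last by ring.
  have ei : 0 <= eps^-1 by rewrite invr_ge0 ltW.
  by rewrite normrM (ger0_norm ei); exact: ler_wpM2r.
move=> y; rewrite ler_distl; apply/andP; split; last exact: ln_sumexp_lip (K _ _ _ zz).
rewrite lerBlDr; apply: ln_sumexp_lip => //; apply: K => i.
by rewrite distrC.
Qed.

Let reg_shift z t : reg (fun i => z i - t) = reg z.
Proof.
rewrite /reg; under eq_bigr do rewrite mulrBl.
rewrite sumrB -mulr_sumr p_sum mulr1.
have -> : \int[Q]_y lse (fun i => z i - t) y = \int[Q]_y (lse z y - t / eps).
  apply: eq_Rintegral => y _; rewrite /lse.
  have -> : sumexp (expo (fun i => z i - t) y) = sumexp (expo z y) * expR (- (t / eps)).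
    rewrite /sumexp mulr_suml; apply: eq_bigr => i _; rewrite -expRD.
    by congr expR; rewrite /expo; field; rewrite gt_eqF.
  by rewrite lnM ?posrE ?expR_gt0 ?(sumexp_gt0 i0)// expRK.
rewrite RintegralB//; last exact: integrableR_cst.
by rewrite Rintegral_prob_cst; field; rewrite gt_eqF.
Qed.

(** The log-sum-exp dominates its [i]-th exponent. When [z i] is the largest coordinate all terms of
    the sum are nonpositive, which makes [reg] coercive in the differences of coordinates. *)
Let reg_le z i : reg z <= \int[Q]_y c i y + \sum_j (z j - z i) * p j.
Proof.
have -> : \sum_j (z j - z i) * p j = \sum_j z j * p j - z i.
  by under eq_bigr do rewrite mulrBl; rewrite sumrB -mulr_sumr p_sum mulr1.
suff : (z i - \int[Q]_y c i y) / eps <= \int[Q]_y lse z y.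
  by rewrite ler_pdivrMr// mulrC /reg => H; lra.
have -> : (z i - \int[Q]_y c i y) / eps = \int[Q]_y expo z y i.
  rewrite mulrC -[in LHS](Rintegral_prob_cst Q (z i)) -RintegralB//; last exact: integrableR_cst.
  rewrite -RintegralZl//; first by apply: eq_Rintegral => y _; rewrite mulrC.
  by apply: integrableRB => //; exact: integrableR_cst.
by apply: Rintegral_le => // y; exact: ln_sumexp_ge.
Qed.

(** If [z' i0 = 0] and some coordinate leaves the box, then two coordinates, one of them the
    largest, differ by at least [B]. Coercivity then puts [reg z'] below [reg 0], so a maximizer
    over the box beats every normalized point. *)
Let reg_max : exists2 z, z i0 = 0 & forall z', reg z' <= reg z.
Proof.
pose C := \sum_i \int[Q]_y c i y.
have C_ge i : \int[Q]_y c i y <= C.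
  rewrite /C (bigD1 i)//= lerDl; apply: sumr_ge0 => j _.
  by apply: Rintegral_ge0.
pose pm := minf i0 p.
have pm0 : 0 < pm by have [i] := minf_ex i0 p; rewrite -/pm => ->.
have pmle i : pm <= p i by exact: minf_le.
(* The width at which losing [pm * B] outweighs the largest possible advantage over [reg 0]. *)
pose B : R := Num.max 0 ((C - reg (fun=> 0)) / pm).
have B0 : 0 <= B by rewrite /B le_max lexx.
have CB : C - pm * B <= reg (fun=> 0).
  have : (C - reg (fun=> 0)) / pm <= B by rewrite /B le_max lexx orbT.
  by rewrite ler_pdivrMr// => H; lra.
have BB : - B <= B by lra.
have [z [zB zmax]] := @lipschitz_box_max R N reg 2 (fun=> - B) (fun=> B)
  reg_lip (fun=> BB).
have H z' : z' i0 = 0 -> reg z' <= reg z.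
  move=> z'0; have [/forallP zb|] := boolP [forall i, - B <= z' i <= B].
    by apply: zmax => i; exact: zb.
  rewrite negb_forall => /existsP[k]; rewrite negb_and -!ltNge => zk.
  have z0z : reg (fun=> 0) <= reg z.
    by apply: zmax => i; rewrite oppr_le0 B0.
  apply: le_trans z0z; apply: le_trans CB.
  have [i Hi] := minf_ex i0 (fun i => - z' i).
  have imax j : z' j <= z' i.
    by rewrite -lerN2 -Hi; exact: (minf_le i0 (fun i => - z' i)).
  have gap j : B <= z' i - z' j -> reg z' <= C - pm * B.
    move=> Bj; apply: le_trans (reg_le z' i) _; apply: lerD => //.
    rewrite (bigD1 j)//= -[leRHS]addr0; apply: lerD.
      have := ler_pM (ltW pm0) B0 (pmle j) Bj; lra.
    apply: sumr_le0 => k' _; apply: mulr_le0_ge0; last exact: ltW.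
    by rewrite subr_le0.
  case/orP: zk => zk.
    by apply: (gap k); have := imax i0; rewrite z'0; lra.
  by apply: (gap i0); have := imax k; rewrite z'0; lra.
(* The box maximizer need not vanish at [i0]; subtracting a constant changes no value of [reg]. *)
exists (fun i => z i - z i0); first by rewrite subrr.
move=> z'; rewrite reg_shift -(reg_shift z' (z' i0)); apply: H.
by rewrite subrr.
Qed.

(** The weights are the softmax at a maximizer of [reg]: maximality gives their integrals, and the
    entropy inequality, integrated, bounds the cost they carry. Each of the [N] entropy terms costs
    at most [eps]. *)
Lemma entropic_weights : exists (w : 'I_N -> T -> R) z,
  [/\ forall i, measurable_fun setT (w i), forall i y, 0 <= w i y,
      forall y, \sum_i w i y = 1, forall i, \int[Q]_y w i y = p i &
      z i0 = 0 /\
      \int[Q]_y (\sum_i w i y * c i y) <= dual i0 c p Q z + eps * N%:R].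
Proof.
have [z z0 zmax] := reg_max.
pose w i y := softmax (expo z y) i.
have w0 i y : 0 <= w i y by exact: softmax_ge0 i0 _ _.
have w1 i y : w i y <= 1 by exact: softmax_le1 i0 _ _.
have mw i : measurable_fun setT (w i) by exact: measurable_weight.
have wint i : integrableR Q (w i).
  by apply: (@integrableR_bound _ _ _ _ _ 1) => // y; rewrite ger0_norm.
have wp i : \int[Q]_y w i y = p i.
  apply/esym/expR_minorant_unique; first by apply: Rintegral_ge0.
  move=> s.
  (* A move by [eps * s] in coordinate [i] shifts the [i]-th exponent by [s]; maximality becomes
     [s * p i <= (expR s - 1) * int w i] for all [s]. *)
  have := zmax (fun j => z j + (j == i)%:R * (eps * s)).
  have -> : reg (fun j => z j + (j == i)%:R * (eps * s)) =
      \sum_j z j * p j + eps * s * p i -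
      eps * \int[Q]_y lse (fun j => z j + (j == i)%:R * (eps * s)) y.
    rewrite /reg; congr (_ - _); under eq_bigr do rewrite mulrDl.
    rewrite big_split/=; congr (_ + _); rewrite (bigD1 i)//= eqxx mul1r.
    by rewrite big1 ?addr0// => j /negbTE ->; rewrite !mul0r.
  have : \int[Q]_y lse (fun j => z j + (j == i)%:R * (eps * s)) y <=
      \int[Q]_y lse z y + (expR s - 1) * \int[Q]_y w i y.
    rewrite -RintegralZl// -RintegralD//; last exact: integrableRZ.
    apply: Rintegral_le => //.
      by apply: integrableRD => //; exact: integrableRZ.
    move=> y; rewrite /lse [X in _ <= _ + X]mulrC.
    apply: le_trans (ln_sumexp_perturb i0 (expo z y) i s).
    rewrite (_ : expo _ y = fun j => expo z y j + (j == i)%:R * s)//.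
    by apply/funext => j; rewrite /expo; field; rewrite gt_eqF.
  rewrite /reg => H1 H2; rewrite -(ler_pM2l eps_gt0).
  have := ler_wpM2l (ltW eps_gt0) H1; move: H2.
  move: (\sum_j z j * p j) (\int[Q]_y lse z y) (\int[Q]_y w i y) => a b q.
  by move: (\int[Q]_y lse _ y) => v ? ?; lra.
exists w, z; split => //.
  by move=> y; exact: sum_softmax i0 _.
split=> //.
have icm : integrableR Q (cmin i0 c z) by exact: integrable_cmin.
have iw i : integrableR Q (fun y => w i y * c i y).
  apply: (@integrableR_le _ _ _ _ _ (c i)) => //.
    by apply: measurable_funM => //; exact: integrableR_meas (ic i).
  move=> y /=; rewrite (ger0_norm (mulr_ge0 (w0 i y) (c_ge0 i y))).
  exact: ler_piMl.
have iz i : integrableR Q (fun y => z i * w i y) by exact: integrableRZ.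
(* As the weights have integrals [p], the linear part of the dual is an integral too, and the claim
   reduces to a pointwise inequality. *)
have -> : dual i0 c p Q z + eps * N%:R =
    \int[Q]_y (\sum_i z i * w i y + (cmin i0 c z y + eps * N%:R)).
  rewrite RintegralD//; last 2 first.
  - exact: integrableRsum.
  - by apply: integrableRD => //; exact: integrableR_cst.
  rewrite RintegralD//; last exact: integrableR_cst.
  rewrite Rintegral_prob_cst addrA; congr (_ + _ + _).
  rewrite Rintegral_sum//; apply: eq_bigr => i _.
  by rewrite RintegralZl// wp.
apply: Rintegral_le.
- exact: integrableRsum.
- apply: integrableRD; first exact: integrableRsum.
  by apply: integrableRD => //; exact: integrableR_cst.
move=> y; rewrite -lerBlDl -sumrB.
have -> : \sum_i (w i y * c i y - z i * w i y) =
    eps * (\sum_i softmax (expo z y) i * - expo z y i).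
  rewrite mulr_sumr; apply: eq_bigr => i _; rewrite /w /expo.
  by field; rewrite gt_eqF.
apply: (@le_trans _ _ (eps * (- lse z y + N%:R))).
  by rewrite ler_pM2l//; exact: softmax_entropy.
rewrite mulrDr lerD2r; apply: le_minf => i.
have := ln_sumexp_ge i0 (expo z y) i; rewrite -/(lse z y) {1}/expo ler_pdivrMr//; lra.
Qed.

End entropic_dual.

(** The hard half of strong duality: weights with the right marginals define a coupling, so the
    transport cost exceeds some dual value by at most [e]. *)
Lemma dual_weights {d} {T : measurableType d} {R : realType} N (i0 : 'I_N)
    (Q : probability T R) (c : 'I_N -> T -> R) (p : 'I_N -> R) (e : R) :
  (forall i, integrableR Q (c i)) -> (forall i y, 0 <= c i y) ->
  (forall i, 0 < p i) -> \sum_i p i = 1 -> 0 < e ->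
  exists (w : 'I_N -> T -> R) z,
  [/\ forall i, measurable_fun setT (w i), forall i y, 0 <= w i y,
      forall y, \sum_i w i y = 1, forall i, \int[Q]_y w i y = p i &
      z i0 = 0 /\ \int[Q]_y (\sum_i w i y * c i y) <= dual i0 c p Q z + e].
Proof.
move=> ic c0 p0 p1 e0.
have N0 : 0 < N%:R :> R by rewrite ltr0n; case: (N) i0 => // -[].
have [w [z [? ? ? ? [? H]]]] := entropic_weights i0 ic c0 p0 p1 (divr_gt0 e0 N0).
by exists w, z; split => //; split => //; rewrite divfK ?gt_eqF in H.
Qed.

(** * Perturbation of the dual *)

Section dual_concavity.
Context {d} {T : measurableType d} {R : realType}.
Variables (N : nat) (i0 : 'I_N) (c : 'I_N -> T -> R) (p : 'I_N -> R).
Variable Q : probability T R.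
Hypothesis ic : forall i, integrableR Q (c i).
Implicit Types (z : 'I_N -> R) (w : 'I_N -> T -> R).

Lemma cmin_concave z z' (t : R) y : 0 <= t <= 1 ->
  (1 - t) * cmin i0 c z y + t * cmin i0 c z' y <=
  cmin i0 c (fun i => (1 - t) * z i + t * z' i) y.
Proof.
move=> /andP[t0 t1]; apply: le_minf => i.
have s0 : 0 <= 1 - t by rewrite subr_ge0.
have := ler_wpM2l t0 (cmin_le i0 c z' y i).
by have := ler_wpM2l s0 (cmin_le i0 c z y i); lra.
Qed.

Lemma dual_concave z z' (t : R) : 0 <= t <= 1 ->
  (1 - t) * dual i0 c p Q z + t * dual i0 c p Q z' <=
  dual i0 c p Q (fun i => (1 - t) * z i + t * z' i).
Proof.
move=> t01.
have -> : (1 - t) * dual i0 c p Q z + t * dual i0 c p Q z' =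
    \sum_i ((1 - t) * z i + t * z' i) * p i +
    \int[Q]_y ((1 - t) * cmin i0 c z y + t * cmin i0 c z' y).
  rewrite RintegralD//; [|by apply: integrableRZ; exact: integrable_cmin..].
  rewrite !RintegralZl//; [|exact: integrable_cmin..].
  under eq_bigr do rewrite mulrDl -!mulrA.
  by rewrite big_split/= -!mulr_sumr /dual; ring.
rewrite lerD2l; apply: Rintegral_le; last by move=> y; exact: cmin_concave.
  by apply: integrableRD; apply: integrableRZ; exact: integrable_cmin.
exact: integrable_cmin.
Qed.

(** The defect of complementary slackness: for probability weights it vanishes at [y] exactly when
    [w] charges only minimizing indices. *)
Definition slack c' z w y : R := \sum_i w i y * (c' i y - z i) - cmin i0 c' z y.

Lemma slack_ge0 z w y : (forall i, 0 <= w i y) -> \sum_i w i y = 1 ->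
  0 <= slack c z w y.
Proof.
move=> w0 w1; rewrite /slack subr_ge0 -[leLHS]mul1r -w1 mulr_suml.
by apply: ler_sum => i _; apply: ler_wpM2l => //; exact: cmin_le.
Qed.

Hypothesis c_ge0 : forall i y, 0 <= c i y.
Variable w : 'I_N -> T -> R.
Hypothesis mw : forall i, measurable_fun setT (w i).
Hypothesis w_ge0 : forall i y, 0 <= w i y.
Hypothesis w_sum : forall y, \sum_i w i y = 1.

Lemma weight_le1 i y : w i y <= 1.
Proof.
by rewrite -(w_sum y) (bigD1 i)//= lerDl; apply: sumr_ge0.
Qed.

Lemma integrable_weight i : integrableR Q (w i).
Proof.
apply: (@integrableR_bound _ _ _ _ _ 1) => // y.
by rewrite ger0_norm// weight_le1.
Qed.

Lemma integrable_weight_cost i : integrableR Q (fun y => w i y * c i y).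
Proof.
apply: (@integrableR_le _ _ _ _ _ (c i)) => //.
  by apply: measurable_funM => //; exact: integrableR_meas (ic i).
move=> y /=; rewrite (ger0_norm (mulr_ge0 (w_ge0 i y) (c_ge0 i y))).
by apply: ler_piMl => //; exact: weight_le1.
Qed.

Lemma integrable_slack z : integrableR Q (slack c z w).
Proof.
apply: integrableRB; last exact: integrable_cmin.
apply: integrableRsum => i.
have : integrableR Q (fun y => w i y * c i y - z i * w i y).
  by apply: integrableRB; [exact: integrable_weight_cost|apply: integrableRZ; exact: integrable_weight].
by apply: eq_integrable => // y _; rewrite /=; congr EFin; ring.
Qed.

Lemma Rintegral_slack z : \int[Q]_y slack c z w y =
  \int[Q]_y (\sum_i w i y * c i y) - \sum_i z i * \int[Q]_y w i y
  - \int[Q]_y cmin i0 c z y.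
Proof.
have iw := integrable_weight; have iwc := integrable_weight_cost.
rewrite (_ : \sum_i z i * _ = \int[Q]_y (\sum_i z i * w i y)); last first.
  rewrite Rintegral_sum; last by move=> i; exact: integrableRZ.
  by apply: eq_bigr => i _; rewrite RintegralZl.
rewrite -RintegralB//; last 2 first.
- exact: integrableRsum.
- by apply: integrableRsum => i; exact: integrableRZ.
rewrite -RintegralB//; last 2 first.
- apply: integrableRB; first exact: integrableRsum.
  by apply: integrableRsum => i; exact: integrableRZ.
- exact: integrable_cmin.
apply: eq_Rintegral => y _; rewrite /slack -sumrB; congr (_ - _).
by apply: eq_bigr => i _; ring.
Qed.

(* The pointwise bound [cmin z' <= sum w_i (c_i - z'_i)] makes
   [p - int w dQ] an approximate supergradient of the dual at [z]. *)
Lemma dual_supergradient z z' :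
  dual i0 c p Q z' <= dual i0 c p Q z + \int[Q]_y slack c z w y +
    \sum_i (z' i - z i) * (p i - \int[Q]_y w i y).
Proof.
have iw := integrable_weight; have iwc := integrable_weight_cost.
suff : \int[Q]_y cmin i0 c z' y <=
    \int[Q]_y (\sum_i w i y * c i y) - \sum_i z' i * \int[Q]_y w i y.
  rewrite /dual Rintegral_slack.
  under [\sum_(i < N) (z' i - z i) * _]eq_bigr do rewrite mulrBr !mulrBl.
  by rewrite !sumrB; lra.
have -> : \int[Q]_y (\sum_i w i y * c i y) - \sum_i z' i * \int[Q]_y w i y =
    \int[Q]_y slack c z' w y + \int[Q]_y cmin i0 c z' y.
  by rewrite Rintegral_slack; ring.
rewrite lerDr; apply: Rintegral_ge0 => y _; exact: slack_ge0.
Qed.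

(** Within distance [dl] the supergradient inequality applies. For a farther [z'], the segment from
    [z] to [z'] crosses the sphere, where the dual is at most its value at [z]; by concavity [z']
    cannot do better than [z]. *)
Lemma dual_local_bound z (dl : R) : 0 < dl ->
  (forall z', z' i0 = z i0 -> (forall i, `|z' i - z i| <= dl) ->
    (exists i, `|z' i - z i| = dl) -> dual i0 c p Q z' <= dual i0 c p Q z) ->
  forall z', z' i0 = z i0 ->
  dual i0 c p Q z' <= dual i0 c p Q z + \int[Q]_y slack c z w y +
    dl * \sum_i `|p i - \int[Q]_y w i y|.
Proof.
move=> dl0 sphere z' z'0.
have [/forallP near|] := boolP [forall i, `|z' i - z i| <= dl].
  apply: le_trans (dual_supergradient z z') _; rewrite lerD2l mulr_sumr.
  apply: ler_sum => i _; rewrite (le_trans (ler_norm _))// normrM.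
  by apply: ler_wpM2r => //; exact: near.
rewrite negb_forall => /existsP[k]; rewrite -ltNge => zk.
have slack0 : 0 <= \int[Q]_y slack c z w y.
  by apply: Rintegral_ge0 => y _; exact: slack_ge0.
apply: (@le_trans _ _ (dual i0 c p Q z)); last first.
  rewrite -addrA lerDl addr_ge0//.
  by apply: mulr_ge0; [exact: ltW|exact: sumr_ge0].
(* The coordinate of largest deviation, found as a minimum of negatives; scaling by [dl] over this
   deviation lands on the sphere. *)
have [m Hm] := minf_ex i0 (fun i => - `|z' i - z i|).
have mmax i : `|z' i - z i| <= `|z' m - z m|.
  by rewrite -lerN2 -Hm; exact: (minf_le i0 (fun i => - `|z' i - z i|)).
have M0 : 0 < `|z' m - z m| by rewrite (lt_le_trans _ (mmax k))// (lt_trans dl0).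
pose t := dl / `|z' m - z m|.
have t0 : 0 < t by rewrite divr_gt0.
have t1 : t <= 1 by rewrite ler_pdivrMr// mul1r (le_trans (ltW zk)).
have E i : (1 - t) * z i + t * z' i - z i = t * (z' i - z i) by ring.
have := @dual_concave z z' t; rewrite (ltW t0) t1 => /(_ isT) H1.
have H2 : dual i0 c p Q (fun i => (1 - t) * z i + t * z' i) <= dual i0 c p Q z.
  apply: sphere; first by rewrite z'0; ring.
    move=> i; rewrite E normrM (gtr0_norm t0) /t mulrAC ler_pdivrMr//.
    by rewrite ler_wpM2l// ltW.
  by exists m; rewrite E normrM (gtr0_norm t0) /t divfK// gt_eqF.
by rewrite -(ler_pM2l t0); lra.
Qed.

End dual_concavity.

(** * Stability of the dual gap on a small sphere *)

Section dual_gap.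
Context {d} {T : measurableType d} {R : realType}.
Variables (N : nat) (i0 : 'I_N) (c : 'I_N -> T -> R) (p : 'I_N -> R).
Variable Q : probability T R.
Hypothesis ic : forall i, integrableR Q (c i).
Hypothesis p_ge0 : forall i, 0 <= p i.
Hypothesis p_sum : \sum_i p i = 1.
Variables (z : 'I_N -> R) (dl : R).
Hypothesis z_unique : forall z', z' i0 = z i0 ->
  dual i0 c p Q z <= dual i0 c p Q z' -> z' = z.
Hypothesis dl_gt0 : 0 < dl.

(** The tolerance and the test points are fixed before the perturbed marginals: closeness of the
    dual differences at these points alone must keep [z] at least as good as all of [S]. *)
Let gap_on (S : set ('I_N -> R)) := exists eta : R, 0 < eta /\
  exists V : seq ('I_N -> R), forall (p' : 'I_N -> R) (Q' : probability T R),
    (forall i, 0 <= p' i) -> \sum_i p' i = 1 -> (forall i, integrableR Q' (c i)) ->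
    (forall v, List.In v V ->
      `|dual i0 c p' Q' v - dual i0 c p' Q' z -
        (dual i0 c p Q v - dual i0 c p Q z)| <= eta) ->
    forall z', S z' -> dual i0 c p' Q' z' <= dual i0 c p' Q' z.

(** The sup-norm sphere is a union of faces, indexed by a coordinate and a sign ([true] stands for
    minus). Each face is a box, to which maxima and nets over boxes apply. *)
Let face (F : 'I_N * bool) : set ('I_N -> R) := [set z' | z' i0 = z i0 /\
  F.1 != i0 /\ (forall i, `|z' i - z i| <= dl) /\ z' F.1 = z F.1 + (-1) ^+ F.2 * dl].

(** The face is compact and avoids [z], so by uniqueness the best value on it falls short of the
    value at [z] by some [g > 0]. A finite net transfers part of this gap to every perturbed
    dual. *)
Let gap_face F : gap_on (face F).
Proof.
have [Fi0|Fi0] := eqVneq F.1 i0.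
  exists 1; split => //; exists nil => p' Q' _ _ _ _ z' [_ [+ _]].
  by rewrite Fi0 eqxx.
pose s : R := (-1) ^+ F.2 * dl.
have abss : `|s| = dl by rewrite normrM normr_sign mul1r gtr0_norm.
(* The coordinates [i0] and [F.1] are frozen by degenerate intervals. *)
pose lo i := if i == i0 then z i0 else if i == F.1 then z i + s else z i - dl.
pose hi i := if i == i0 then z i0 else if i == F.1 then z i + s else z i + dl.
have lohi i : lo i <= hi i.
  rewrite /lo /hi; case: ifP => _; first exact: lexx.
  case: ifP => _; first exact: lexx.
  by rewrite lerD2l ge0_cp// ltW.
have inface z' : face F z' -> forall i, lo i <= z' i <= hi i.
  move=> [z0 [_ [zd zF]]] i; rewrite /lo /hi; case: eqP => [->|_].
    by rewrite z0 lexx.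
  case: eqP => [->|_]; first by rewrite zF lexx.
  by have := zd i; rewrite ler_distl.
have facein z' : (forall i, lo i <= z' i <= hi i) -> z' i0 = z i0 /\ z' <> z.
  move=> H; split.
    by have := H i0; rewrite /lo /hi eqxx => /andP[a b]; apply/eqP; rewrite eq_le a b.
  move=> E; have := H F.1; rewrite /lo /hi (negbTE Fi0) eqxx E => /andP[a b].
  have : s = 0 by lra.
  by move=> s0; move: abss dl_gt0; rewrite s0 normr0 => <-; rewrite ltxx.
have lip z1 z2 (e : R) : 0 <= e -> (forall i, `|z1 i - z2 i| <= e) ->
    `|dual i0 c p Q z1 - dual i0 c p Q z2| <= 2 * e.
  by move=> _; exact: dual_lip.
have [zm [zmin zmax]] := lipschitz_box_max lip lohi.
have [zm0 zmz] := facein _ zmin.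
have g0 : 0 < dual i0 c p Q z - dual i0 c p Q zm.
  by rewrite subr_gt0 ltNge; apply/negP => /(z_unique zm0).
set g := _ - _ in g0.
(* The Lipschitz constant 2 turns the mesh [g / 4] into a loss [g / 2]; the tolerance [g / 2] uses
   up the rest of the gap. *)
have g4 : 0 < g / 4 by lra.
have [V [VA Vnet]] := box_net lo hi g4.
exists (g / 2); split; first by lra.
exists V => p' Q' p'0 p'1 ic' HV z' zF.
have [v vV zv] := Vnet _ (inface _ zF).
have := dual_lip i0 p'0 p'1 ic' zv; have := HV _ vV; have := zmax _ (VA _ vV).
rewrite !ler_norml => H1 /andP[_ H2] /andP[_ H3].
by move: H1 H2 H3; rewrite /g; lra.
Qed.

Let gap_union (I : Type) (s : seq I) (S : I -> set ('I_N -> R)) :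
  (forall i, gap_on (S i)) -> gap_on [set v | exists2 i, List.In i s & S i v].
Proof.
move=> gS; elim: s => [|a s [e [e0 [V HV]]]].
  by exists 1; split => //; exists nil => p' Q' _ _ _ _ z' [i []].
have [e' [e'0 [V' HV']]] := gS a.
exists (Num.min e e'); split; first by rewrite lt_min e0.
exists (V ++ V') => p' Q' p'0 p'1 ic' H z' [i [<-|si] Sz].
  apply: HV' (Sz) => // v vV; apply: le_trans (H v _) _.
    by apply/List.in_app_iff; right.
  by rewrite ge_min lexx orbT.
apply: HV; [exact: p'0|exact: p'1|exact: ic'| |by exists i].
move=> v vV; apply: le_trans (H v _) _.
  by apply/List.in_app_iff; left.
by rewrite ge_min lexx.
Qed.

(** This makes confinement a finite matter: each tested difference is a sample mean of a bounded
    function plus a combination of frequencies. *)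
Lemma dual_sphere_gap : exists eta : R, 0 < eta /\
  exists V : seq ('I_N -> R), forall (p' : 'I_N -> R) (Q' : probability T R),
    (forall i, 0 <= p' i) -> \sum_i p' i = 1 -> (forall i, integrableR Q' (c i)) ->
    (forall v, List.In v V ->
      `|dual i0 c p' Q' v - dual i0 c p' Q' z -
        (dual i0 c p Q v - dual i0 c p Q z)| <= eta) ->
    forall z', z' i0 = z i0 -> (forall i, `|z' i - z i| <= dl) ->
      (exists i, `|z' i - z i| = dl) -> dual i0 c p' Q' z' <= dual i0 c p' Q' z.
Proof.
have [eta [eta0 [V HV]]] := gap_union (enum {: 'I_N * bool}) gap_face.
exists eta; split=> //; exists V => p' Q' p'0 p'1 ic' H z' z'0 z'd [i zi].
apply: HV; [exact: p'0|exact: p'1|exact: ic'|exact: H|].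
exists (i, z' i - z i < 0); first by apply/mem_ListIn; rewrite mem_enum.
split => //; split; last split => //=.
  apply/eqP => /= ii0; move: zi dl_gt0; rewrite ii0 z'0 subrr normr0 => <-.
  by rewrite ltxx.
by rewrite -zi -numEsign addrC subrK.
Qed.

End dual_gap.

(** * Discrete laws and optimal transport *)

Section measure_probability.
Context {d} {T : measurableType d} {R : realType}.
Variable (P : {measure set T -> \bar R}).
Hypothesis PT : P setT = 1%E.

Let P' := P : set T -> \bar R.
HB.instance Definition _ := Measure.on P'.
HB.instance Definition _ := Measure_isProbability.Build _ _ _ P' PT.
Definition measure_probability : probability T R := P'.

End measure_probability.

Section discrete_probability.
Context {d} {T : measurableType d} {R : realType}.
Variables (N : nat) (w : 'I_N -> R) (s : 'I_N -> T).
Hypothesis w_ge0 : forall i, 0 <= w i.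
Hypothesis w_sum : \sum_i w i = 1.

Definition weighted_diracs (A : set T) : \bar R :=
  (\sum_(i < N) (w i)%:E * \d_(s i) A)%E.

Let ord_of_sum : 'I_N.
Proof.
case: N w s w_ge0 w_sum => [? ? ? /eqP|n *]; last exact: ord0.
by rewrite big_ord0 eq_sym oner_eq0.
Qed.

(** [msum] is indexed by natural numbers. Indices from [N] on fall back on a default ordinal and are
    never summed; a default exists because an empty family cannot have weights of sum 1. *)
Let m_ (k : nat) : {measure set T -> \bar R} :=
  mscale (NngNum (w_ge0 (insubd ord_of_sum k))) (dirac (s (insubd ord_of_sum k))).

Let weighted_diracsE : weighted_diracs = msum m_ N.
Proof.
apply/funext => A; rewrite /weighted_diracs /msum; apply: eq_bigr => i _.
by rewrite /m_ /mscale/= valKd.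
Qed.

Let weighted_diracs_ge0 A : (0 <= weighted_diracs A)%E.
Proof. by rewrite weighted_diracsE; exact: measure_ge0. Qed.

Let weighted_diracs0 : weighted_diracs set0 = 0%E.
Proof. by rewrite weighted_diracsE; exact: measure0. Qed.

Let weighted_diracs_sigma_additive : semi_sigma_additive weighted_diracs.
Proof. by rewrite weighted_diracsE; exact: measure_semi_sigma_additive. Qed.

Let weighted_diracsT : weighted_diracs setT = 1%E.
Proof.
rewrite /weighted_diracs (eq_bigr (fun i => (w i)%:E)).
  by rewrite sumEFin w_sum.
by move=> i _; rewrite diracT mule1.
Qed.

Definition discrete_prob : probability T R :=
  let m := isMeasure.Build _ _ _ weighted_diracs
    weighted_diracs0 weighted_diracs_ge0 weighted_diracs_sigma_additive in
  let M : {measure set T -> \bar R} := HB.pack weighted_diracs m in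
  HB.pack weighted_diracs m (Measure_isProbability.Build _ _ _ M weighted_diracsT).

Lemma discrete_probE : (discrete_prob : set T -> \bar R) = weighted_diracs.
Proof. by []. Qed.

Lemma ge0_integral_discrete (f : T -> \bar R) : measurable_fun setT f ->
  (forall y, 0 <= f y)%E ->
  (\int[discrete_prob]_y f y = \sum_(i < N) (w i)%:E * f (s i))%E.
Proof.
move=> mf f0.
rewrite (_ : integral discrete_prob setT f = integral (msum m_ N) setT f); last first.
  by congr (integral _ setT f); rewrite -weighted_diracsE.
rewrite ge0_integral_measure_sum//; apply: eq_bigr => i _.
by rewrite /m_ ge0_integral_mscale//= integral_dirac// diracT mul1e valKd.
Qed.

Lemma integrable_discrete (f : T -> R) : measurable_fun setT f ->
  integrableR discrete_prob f.
Proof.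
move=> mf; apply/integrableP; split; first exact/measurable_EFinP.
rewrite ge0_integral_discrete//; last first.
  by apply: measurableT_comp => //; exact/measurable_EFinP.
under eq_bigr do rewrite /= -EFinM.
by rewrite sumEFin ltry.
Qed.

Lemma Rintegral_discrete (f : T -> R) : measurable_fun setT f ->
  \int[discrete_prob]_y f y = \sum_i w i * f (s i).
Proof.
move=> mf.
have pos (g : T -> R) : measurable_fun setT g -> (forall y, 0 <= g y) ->
    \int[discrete_prob]_y g y = \sum_i w i * g (s i).
  move=> mg g0; rewrite /Rintegral ge0_integral_discrete//.
  - by under eq_bigr do rewrite -EFinM; rewrite sumEFin.
  - exact/measurable_EFinP.
have fE y : f y = Num.max (f y) 0 - Num.max (- f y) 0.
  by rewrite !maxEle oppr_le0; case: (leP (f y) 0) => h; case: (leP 0 (f y)) => h'; lra.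
have m1 : measurable_fun setT (fun y => Num.max (f y) 0).
  exact: measurable_maxr.
have m2 : measurable_fun setT (fun y => Num.max (- f y) 0).
  by apply: measurable_maxr => //; exact: measurable_funN.
under eq_Rintegral do rewrite fE.
rewrite RintegralB//; [|exact: integrable_discrete..].
rewrite !pos//; [|by move=> y; rewrite le_max lexx orbT..].
by rewrite -sumrB; apply: eq_bigr => i _; rewrite -mulrBr -fE.
Qed.
End discrete_probability.

Section mixture.
Context {d1 d2} {T : measurableType d1} {Y : measurableType d2} {R : realType}.
Variables (Q : probability T R) (N : nat) (w : 'I_N -> T -> R) (s : 'I_N -> T -> Y).
Hypothesis w_ge0 : forall i y, 0 <= w i y.
Hypothesis w_sum : forall y, \sum_i w i y = 1.
Hypothesis mw : forall i, measurable_fun setT (w i).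
Hypothesis ms : forall i, measurable_fun setT (s i).

(** The law of [s i y] when [y] is drawn from [Q] and then [i] with probabilities [w i y]: the
    monadic bind of [Q] with a kernel of discrete laws. It produces couplings out of weights. *)
Lemma mixture_exists : exists P : probability Y R,
  forall f : Y -> \bar R, measurable_fun setT f -> (forall y, 0 <= f y)%E ->
    (\int[P]_y f y = \int[Q]_y \sum_(i < N) (w i y)%:E * f (s i y))%E.
Proof.
pose k y : giry Y R := discrete_prob (s^~ y) (w_ge0^~ y) (w_sum y).
have mk : measurable_fun setT k.
  apply: measurable_giry_codensity => // B mB.
  apply: emeasurable_sum => i; apply: emeasurable_funM.
    exact/measurable_EFinP.
  have mdirac := @measurable_fun_dirac _ Y R setT B mB.
  exact: (measurableT_comp mdirac (ms i)).
pose P0 : subprobability Y R := giry_bind (Q : giry T R) mk.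
have P0int f : measurable_fun setT f -> (forall y, 0 <= f y)%E ->
    (\int[P0]_y f y = \int[Q]_y \sum_(i < N) (w i y)%:E * f (s i y))%E.
  move=> mf f0; rewrite [LHS](giry_int_bind _ mk mf f0) /giry_int.
  by apply: eq_integral => y _; exact: ge0_integral_discrete.
(* The bind is typed as a subprobability; its mass is recovered by integrating the constant 1. *)
have P0T : P0 setT = 1%E.
  rewrite -[LHS]mul1e -integral_cst// P0int//.
  under eq_integral => y _.
    rewrite (eq_bigr (fun i => (w i y)%:E)); last by move=> i _; rewrite mule1.
    rewrite sumEFin w_sum.
    over.
  have QT : Q setT = 1%E := @probability_setT _ T R Q.
  rewrite integral_cst// probability_setT; [by rewrite mul1e|exact: QT].
by exists (measure_probability P0T); exact: P0int.
Qed.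

End mixture.

Section nomeas.
Import HBNNSimple.

(** The integral of a nonnegative function is a supremum over the simple functions below it, hence
    monotone for arbitrary functions. It is the tool for costs whose measurability is not
    established. *)
Lemma ge0_le_integral_nomeas {d} {T : measurableType d} {R : realType}
    (mu : {measure set T -> \bar R}) (f g : T -> \bar R) :
  (forall x, 0 <= f x)%E -> (forall x, f x <= g x)%E ->
  (\int[mu]_x f x <= \int[mu]_x g x)%E.
Proof.
move=> f0 fg; rewrite !ge0_integralTE//; last by move=> x; exact: le_trans (fg x).
apply: ereal_sup_le => _ [h hf <-].
by exists h => // x; exact: le_trans (hf x) (fg x).
Qed.

End nomeas.

Lemma open_measurable_Rd (R : realType) d (U : set 'rV[R]_d) :
  open U -> measurable (U : set (Rd R d)).
Proof. by move=> oU; apply: sub_sigma_algebra. Qed.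

Lemma closed_measurable_Rd (R : realType) d (U : set 'rV[R]_d) :
  closed U -> measurable (U : set (Rd R d)).
Proof.
move=> cU; rewrite -[U]setCK; apply: measurableC; apply: open_measurable_Rd.
exact: closed_openC.
Qed.

Lemma measurable_Rd_set1 (R : realType) d (a : 'rV[R]_d) :
  measurable ([set a] : set (Rd R d)).
Proof.
apply: closed_measurable_Rd; apply: (@accessible_closed_set1 'rV[R]_d).
exact: hausdorff_accessible (@norm_hausdorff _ _).
Qed.

Lemma continuous_measurable_Rd (R : realType) d (f : 'rV[R]_d -> R) :
  continuous f -> measurable_fun setT (f : Rd R d -> R).
Proof.
move=> cf; apply: (measurability _ (RGenOInfty.measurableE R)).
move=> /= _ [_ [a ->] <-]; apply: measurableI => //.
by apply: open_measurable_Rd; apply: open_comp => // y _; exact: cf.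
Qed.

(** * Transport from a discrete law: weak duality and couplings from weights *)

Section transport.
Variables (R : realType) (d N : nat) (i0 : 'I_N).
Variables (x : 'I_N -> 'rV[R]_d) (h : 'rV[R]_d -> R).
Hypothesis x_inj : injective x.
Hypothesis h_ge0 : forall u, 0 <= h u.
Hypothesis h_cont : continuous h.
Variables (p : 'I_N -> R) (Q : probability (Rd R d) R).
Hypothesis p_sum : \sum_i p i = 1.

Definition sitecost (i : 'I_N) (y : Rd R d) : R := cost_of h (x i) y.

Lemma continuous_sitecost i : continuous (fun y : 'rV[R]_d => sitecost i y).
Proof.
move=> y; rewrite /sitecost /cost_of.
apply: continuous_comp; last exact: h_cont.
by apply: continuousB; [exact: cst_continuous|exact: cvg_id].
Qed.

Lemma measurable_sitecost i : measurable_fun setT (sitecost i).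
Proof. by apply: continuous_measurable_Rd; exact: continuous_sitecost. Qed.

Lemma sitecost_ge0 i y : 0 <= sitecost i y.
Proof. exact: h_ge0. Qed.

Let Y := (Rd R d * Rd R d)%type.
Let site i (a : Rd R d) : R := \1_[set x i] a.

Let site_x i j : site i (x j) = (i == j)%:R.
Proof.
rewrite /site indicE; congr (_%:R); congr nat_of_bool.
apply/idP/eqP => [|->]; last by rewrite inE.
by rewrite inE => /x_inj.
Qed.

Let measurable_site i : measurable_fun setT (site i).
Proof. by apply: measurable_indic; exact: measurable_Rd_set1. Qed.

Let m1 i : measurable_fun setT (fun u : Y => site i u.1).
Proof. exact: (measurableT_comp (measurable_site i) measurable_fst). Qed.

(** As the sites are distinct, this is the indicator of their complement. *)
Let offsite (a : Rd R d) : R := 1 - \sum_i site i a.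

Let offsite_x j : offsite (x j) = 0.
Proof.
rewrite /offsite (bigD1 j)//= site_x eqxx big1 ?addr0 ?subrr// => i ij.
by rewrite site_x (negbTE ij).
Qed.

Let siteP a : (exists j, a = x j) \/ (forall i, site i a = 0).
Proof.
have [[j ->]|H] := pselect (exists j, a = x j); first by left; exists j.
right => i; rewrite /site indicE; case: (boolP (_ \in _)) => //.
by rewrite inE /= => ax; exfalso; apply: H; exists i.
Qed.

Let offsite_ge0 a : 0 <= offsite a.
Proof.
have [[j ->]|H] := siteP a; first by rewrite offsite_x.
by rewrite /offsite big1// subr0.
Qed.

Let measurable_offsite : measurable_fun setT (fun u : Y => offsite u.1).
Proof. by apply: measurable_funB => //; apply: measurable_sum. Qed.

(** A function measurable for the product structure that agrees with [f j] over the site [x j] and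
    vanishes off the sites; with [sitecost] it stands in for the cost where couplings live. *)
Let sitefun (f : 'I_N -> Rd R d -> R) (u : Y) : R := \sum_i site i u.1 * f i u.2.

Let sitefun_x f j y : sitefun f (x j, y) = f j y.
Proof.
rewrite /sitefun (bigD1 j)//= site_x eqxx mul1r big1 ?addr0// => i ij.
by rewrite site_x (negbTE ij) mul0r.
Qed.

Let measurable_sitefun f : (forall i, measurable_fun setT (f i)) ->
  measurable_fun setT (sitefun f).
Proof.
move=> mf; apply: measurable_sum => i; apply: measurable_funM => //.
exact: (measurableT_comp (mf i) measurable_snd).
Qed.

Hypothesis ic : forall i, integrableR Q (sitecost i).

(** Integrate [z i + cmin <= c i] against a coupling. Its first marginal charges only the sites, so
    the cost may be replaced by the measurable minorant [phi], which is zero elsewhere. *)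
Lemma dual_le_Tc z :
  ((dual i0 sitecost p Q z)%:E <= Tc (cost_of h) (discrete_measure x p) Q)%E.
Proof.
apply: le_ereal_inf_tmp => _ [pi [pi1 pi2] <-].
have site_int i : (\int[pi]_u (site i u.1)%:E)%E = (p i)%:E.
  rewrite (eq_integral (fun u : Y => (\1_([set x i] `*` setT) u)%:E)); last first.
    by move=> u _; rewrite /site !indicE in_setX /= in_setT andbT.
  rewrite integral_indic//; last by apply: measurableX => //; exact: measurable_Rd_set1.
  rewrite setIT pi1; last exact: measurable_Rd_set1.
  rewrite /discrete_measure (bigD1 i)//= diracE in_set1 eqxx mule1 big1 ?adde0// => j ji.
  by rewrite diracE in_set1 (inj_eq x_inj) (negbTE ji) mule0.
have isite i : integrableR pi (fun u => site i u.1).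
  apply: (@integrableR_bound _ _ _ _ _ 1) => // u.
  by rewrite /site indicE; case: (_ \in _); rewrite ?normr1 ?normr0.
have ioff : integrableR pi (fun u => offsite u.1).
  apply: (@integrableRB _ _ _ _ (fun=> 1) (fun u => \sum_i site i u.1)).
    exact: (integrableR_cst pi 1).
  exact: integrableRsum.
have off0 : \int[pi]_u offsite u.1 = 0.
  rewrite RintegralB//; [|exact: (integrableR_cst pi 1)|exact: integrableRsum].
  rewrite Rintegral_prob_cst Rintegral_sum//.
  rewrite (eq_bigr p) ?p_sum ?subrr// => i _.
  by rewrite /Rintegral site_int.
have snd_int (f : Rd R d -> R) : integrableR Q f ->
    integrableR pi (fun u => f u.2) /\ \int[pi]_u f u.2 = \int[Q]_y f y.
  move=> fi.
  have E (g : Rd R d -> \bar R) :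
      (\int[Q]_y g y = \int[pushforward pi (@snd (Rd R d) (Rd R d))]_y g y)%E.
    apply: eq_measure_integral => A mA _; rewrite /= /pushforward -pi2//.
    by congr (pi _); apply/seteqP; split => u /=; [case|].
  have fm := integrableR_meas fi.
  have fi2 : integrableR pi (fun u => f u.2).
    apply/integrableP; split.
      by apply/measurable_EFinP; exact: (measurableT_comp fm measurable_snd).
    move/integrableP : fi => [_]; rewrite E ge0_integral_pushforward//.
    by apply: measurableT_comp => //; exact/measurable_EFinP.
  split=> //; rewrite /Rintegral E integral_pushforward//.
  exact/measurable_EFinP.
have mz i : measurable_fun setT (fun y => z i + cmin i0 sitecost z y).
  apply: measurable_funD => //; apply: measurable_cmin; exact: measurable_sitecost.
have [icm Ecm] := snd_int _ (integrable_cmin i0 z ic).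
have mcm := integrableR_meas icm.
pose phi := sitefun sitecost.
have phi_ge0 u : 0 <= phi u.
  by apply: sumr_ge0 => i _; rewrite mulr_ge0// ?sitecost_ge0// /site indicE.
have mphi : measurable_fun setT phi by apply: measurable_sitefun; exact: measurable_sitecost.
have iphi : integrableR pi phi.
  apply: (@integrableR_le _ _ _ _ _ (fun u : Y => \sum_i sitecost i u.2)) => //.
    by apply: integrableRsum => i; exact: (snd_int _ (ic i)).1.
  move=> u; rewrite ger0_norm//; apply: ler_sum => i _.
  rewrite /site indicE; case: (_ \in _); rewrite ?mul1r// mul0r.
  exact: sitecost_ge0.
have isz i : integrableR pi (fun u => z i * site i u.1) by exact: integrableRZ.
apply: (@le_trans _ _ (\int[pi]_u (phi u)%:E)%E); last first.
  apply: ge0_le_integral_nomeas => [u|[a y]]; first by rewrite lee_fin.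
  rewrite lee_fin /=; have [[j ->]|H] := siteP a; first by rewrite /phi sitefun_x.
  by rewrite /phi /sitefun big1 => [|i _]; [exact: h_ge0|rewrite H mul0r].
rewrite -Rintegral_EFin// lee_fin.
have ioc : integrableR pi (fun u => offsite u.1 * cmin i0 sitecost z u.2).
  apply: (@integrableR_le _ _ _ _ _ (fun u : Y => `|cmin i0 sitecost z u.2|)).
  - exact: measurable_funM.
  - exact: integrableR_abs.
  - move=> u; rewrite normrM ler_piMl// ger0_norm//.
    rewrite /offsite lerBlDr lerDl sumr_ge0//.
have oc0 : \int[pi]_u (offsite u.1 * cmin i0 sitecost z u.2) = 0.
  have mo : measurable_fun setT (fun u : Y => (offsite u.1)%:E) by exact/measurable_EFinP.
  have [+ _] := ae_eq_integral_abs pi measurableT mo.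
  have -> : (\int[pi]_u `|(offsite u.1)%:E| = 0)%E.
    rewrite -[RHS]/(0%:E) -off0 Rintegral_EFin//.
    by apply: eq_integral => u _; rewrite gee0_abs// lee_fin.
  move=> /(_ erefl) off_ae.
  rewrite /Rintegral (ae_eq_integral (cst 0%E))//.
  - by rewrite integral_cst// mul0e.
  - by apply/measurable_EFinP; exact: measurable_funM.
  - move: off_ae; apply: filterS => u /= /(_ I) H _.
    by case: H => ->; rewrite mul0r.
(* Subtracting the null term makes the integrand vanish off the sites, so that the comparison with
   [phi] holds everywhere. *)
have -> : dual i0 sitecost p Q z = \int[pi]_u (\sum_i z i * site i u.1 +
    cmin i0 sitecost z u.2 - offsite u.1 * cmin i0 sitecost z u.2).
  rewrite RintegralB//; last by apply: integrableRD => //; exact: integrableRsum.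
  rewrite oc0 subr0 RintegralD//; last exact: integrableRsum.
  rewrite Ecm /dual; congr (_ + _); rewrite Rintegral_sum//.
  by apply: eq_bigr => i _; rewrite RintegralZl// /Rintegral site_int.
apply: Rintegral_le => //.
  apply: integrableRB => //; apply: integrableRD => //; exact: integrableRsum.
move=> [a y] /=; have [[j ->]|H] := siteP a.
  rewrite offsite_x mul0r subr0 /phi sitefun_x (bigD1 j)//= site_x eqxx mulr1.
  rewrite big1 ?addr0; last by move=> i ij; rewrite site_x (negbTE ij) mulr0.
  by have := cmin_le i0 sitecost z y j; lra.
rewrite /offsite /phi /sitefun !big1 /=; first by rewrite subr0 mul1r add0r subrr.
- by move=> i _; rewrite H mul0r.
- by move=> i _; rewrite H.
- by move=> i _; rewrite H mulr0.
Qed.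

(** The mixture of the points [(x i, y)] with weights [w i y] is a coupling of the two marginals,
    and its cost is the integral on the right. *)
Lemma Tc_le_weights (w : 'I_N -> Rd R d -> R) :
  (forall i, measurable_fun setT (w i)) -> (forall i y, 0 <= w i y) ->
  (forall y, \sum_i w i y = 1) -> (forall i, \int[Q]_y w i y = p i) ->
  (Tc (cost_of h) (discrete_measure x p) Q <=
   (\int[Q]_y (\sum_i w i y * sitecost i y))%:E)%E.
Proof.
move=> mw w0 w1 wp.
have wi i : integrableR Q (w i) by exact: (integrable_weight _ mw w0 w1).
have ms i : measurable_fun setT (fun y : Rd R d => (x i : Rd R d, y)).
  exact: measurable_fun_pair.
have [pi Hpi] := mixture_exists Q w0 w1 mw ms.
have piE A : measurable A -> pi A = (\int[Q]_y \sum_i (w i y)%:E * (\1_A (x i : Rd R d, y))%:E)%E.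
  move=> mA; rewrite -(Hpi (fun u => (\1_A u)%:E)).
  - by rewrite integral_indic// setIT.
  - exact/measurable_EFinP/measurable_indic.
  - by move=> u; rewrite lee_fin.
apply: (@le_trans _ _ (\int[pi]_u (cost_of h u.1 u.2)%:E)%E).
  apply: ereal_inf_lbound; exists pi => //; split=> [A mA|B mB].
    rewrite piE; last exact: measurableX.
    rewrite (eq_integral (fun y => (\sum_i \1_A (x i : Rd R d) * w i y)%:E)); last first.
      move=> y _; rewrite -sumEFin; apply: eq_bigr => i _.
      by rewrite -EFinM mulrC !indicE in_setX /= in_setT andbT.
    rewrite -Rintegral_EFin; last by apply: integrableRsum => i; exact: integrableRZ.
    rewrite Rintegral_sum; last by move=> i; exact: integrableRZ.
    rewrite -sumEFin; apply: eq_bigr => i _.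
    by rewrite RintegralZl// wp EFinM muleC.
  rewrite piE; last exact: measurableX.
  rewrite (eq_integral (fun y => (\1_B y)%:E)) ?integral_indic ?setIT// => y _.
  under eq_bigr => i _ do rewrite indicE in_setX /= in_setT /= -EFinM.
  by rewrite sumEFin -mulr_suml w1 mul1r indicE.
(* A measurable majorant of the cost: the same on the sites, where [0 * +oo = 0], and infinite
   elsewhere, where the coupling has no mass. *)
pose F (u : Y) : \bar R := ((sitefun sitecost u)%:E + (offsite u.1)%:E * +oo)%E.
have F_ge0 u : (0 <= F u)%E.
  apply: adde_ge0; last by apply: mule_ge0 => //; rewrite lee_fin.
  rewrite lee_fin; apply: sumr_ge0 => i _.
  by rewrite mulr_ge0// ?sitecost_ge0// /site indicE.
have Fx i y : F (x i, y) = (sitecost i y)%:E.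
  by rewrite /F sitefun_x offsite_x mul0e adde0.
apply: (@le_trans _ _ (\int[pi]_u F u)%E).
  apply: ge0_le_integral_nomeas => [u|[a y]]; first by rewrite lee_fin; exact: h_ge0.
  have [[j ->]|H] := siteP a; first by rewrite Fx.
  rewrite /F /offsite /sitefun !big1 /=; first by rewrite subr0 mul1e addey// leey.
  - by move=> i _; rewrite H.
  - by move=> i _; rewrite H mul0r.
rewrite Hpi//; last first.
  apply: emeasurable_funD.
    by apply/measurable_EFinP; apply: measurable_sitefun; exact: measurable_sitecost.
  by apply: emeasurable_funM => //; exact/measurable_EFinP.
rewrite Rintegral_EFin; last first.
  by apply: integrableRsum => i; exact: (integrable_weight_cost ic sitecost_ge0 mw w0 w1).
rewrite le_eqVlt; apply/orP; left; apply/eqP; apply: eq_integral => y _; rewrite -sumEFin.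
by apply: eq_bigr => i _; rewrite Fx EFinM.
Qed.

End transport.

(** * Uniqueness of the dual maximizer *)

Section support.
Variables (R : realType) (d : nat) (Q : probability (Rd R d) R).

(** Second countability: each point outside the support lies in a null ball with rational centre and
    radius [n.+1%:R^-1], and countably many such balls cover [A]. *)
Lemma msupport_full (A : set (Rd R d)) : measurable A ->
  (forall y, A y -> ~ msupport Q y) -> Q A = 0%E.
Proof.
move=> mA AS; apply: measure_negligible => //.
pose r (n : nat) : R := n.+1%:R^-1.
have r0 n : 0 < r n by rewrite invr_gt0.
pose B (u : 'rV[rat]_d * nat) : set 'rV[R]_d :=
  ball (map_mx ratr u.1 : 'rV[R]_d) (r u.2).
pose F k : set (Rd R d) :=
  if (choice.unpickle k : option ('rV[rat]_d * nat)%type) is Some u then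
    (if `[< Q (B u) = 0%E >] then B u else set0) else set0.
have oB u : open (B u).
  by apply: ball_open; exact: r0.
apply: (@negligibleS _ _ _ Q (\bigcup_k F k)); last first.
  apply: negligible_bigcup => k; rewrite /F.
  case: choice.unpickle => [u|]; last exact: negligible_set0.
  case: asboolP => [Q0|_]; last exact: negligible_set0.
  by apply/negligibleP => //; exact: open_measurable_Rd (oB u).
move=> y /AS /existsNP[U] /not_implyP[oU] /not_implyP[Uy] /negP; rewrite -leNgt => QU.
have QU0 : Q U = 0%E by apply/eqP; rewrite eq_le QU measure_ge0.
have [e /= e0 eU] := (@nbhs_ballP _ _ y U).1 (open_nbhs_nbhs (conj oU Uy)).
have [n ne] : exists n, 0 + r n < e / 2 by apply: ltr_add_invr; rewrite divr_gt0.
rewrite add0r in ne.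
have qex i : exists q : rat, y 0 i - r n < ratr q < y 0 i + r n.
  have /(@rat_in_itvoo R)[q] : y 0 i - r n < y 0 i + r n by have := r0 n; lra.
  by rewrite in_itv/= => H; exists q.
have [q Hq] := choice qex.
pose u : 'rV[rat]_d * nat := (\row_i q i, n).
have yB : B u y.
  split=> [|i j]; first exact: r0.
  rewrite !mxE ord1; have := Hq j => /andP[q1 q2].
  by rewrite /ball /= ltr_distlC; apply/andP; split; lra.
have BU : B u `<=` U.
  move=> v uv; apply: eU; apply: (@le_ball _ _ _ (r n + r n)); first lra.
  exact: (ball_triangle (ball_sym yB) uv).
have QB : Q (B u) = 0%E.
  apply/eqP; rewrite eq_le measure_ge0 andbT -QU0 le_measure ?inE//.
  - exact: open_measurable_Rd (oB u).
  - exact: open_measurable_Rd oU.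
by exists (choice.pickle u) => //; rewrite /F choice.pickleK; case: asboolP.
Qed.

End support.

Section uniqueness.
Variables (R : realType) (d N : nat) (i0 : 'I_N) (c : 'I_N -> 'rV[R]_d -> R).
Variables (p : 'I_N -> R) (Q : probability (Rd R d) R).
Hypothesis c_cont : forall i, continuous (c i).
Hypothesis ic : forall i, integrableR Q (c i : Rd R d -> R).
Hypothesis p_gt0 : forall i, 0 < p i.
Hypothesis Q_conn : connected (msupport Q).
Implicit Types z : 'I_N -> R.

Let cm z (y : 'rV[R]_d) : R := cmin i0 (c : 'I_N -> Rd R d -> R) z y.
Let D z : R := dual i0 (c : 'I_N -> Rd R d -> R) p Q z.

Let cm_cont z : continuous (cm z).
Proof.
move=> y; apply/(@cvgrPdist_le _ _ _ _ (nbhs_filter y)) => e e0.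
have : \forall u \near y, forall i, `|c i y - c i u| <= e.
  apply: (@filter_forall _ _ (fun i u => is_true (`|c i y - c i u| <= e)) (nbhs y) (nbhs_filter y)) => i.
  by have /(@cvgrPdist_le _ _ _ _ (nbhs_filter y)) /(_ e e0) := @c_cont i y.
apply: filterS => u H; apply: minf_lip => i.
by rewrite (_ : _ - _ = c i y - c i u)//; ring.
Qed.

Let open_null (g : 'rV[R]_d -> R) y : continuous g -> msupport Q y ->
  Q [set u | g u != 0] = 0%E -> g y = 0.
Proof.
move=> cg Sy Q0; apply/eqP/negP => /negP gy.
have oU : open [set u : 'rV[R]_d | g u != 0].
  by apply: (@open_comp _ _ g [set t | t != 0]); [move=> u _; exact: cg|exact: open_neq].
by have := Sy _ oU gy; rewrite Q0 ltxx.
Qed.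

Let icm z : integrableR Q (cm z : Rd R d -> R).
Proof. exact: integrable_cmin. Qed.

Variables (z z' : 'I_N -> R).
Hypothesis zmax : forall v, D v <= D z.
Hypothesis zz' : D z <= D z'.

(** The midpoint of two maximizers, itself a maximizer by concavity, written in the form that
    [dual_concave] produces at [t = 2^-1]. *)
Let zm i : R := (1 - 2^-1) * z i + 2^-1 * z' i.
Let half : (0 : R) <= 2^-1 <= (1 : R). Proof. by rewrite invr_ge0 ler0n invf_le1 ?ler1n ?ltr0n. Qed.

Let zm_max v : D v <= D zm.
Proof.
apply: le_trans (zmax v) _; apply: le_trans (dual_concave i0 p ic z z' half).
by have := zz'; rewrite -/(D z) -/(D z'); lra.
Qed.

(** The concavity gap of [cmin] is nonnegative and continuous, and its integral is zero because [z]
    and [z'] are both optimal; so it vanishes on the support. *)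
Let midpoint y : msupport Q y -> cm zm y = (1 - 2^-1) * cm z y + 2^-1 * cm z' y.
Proof.
move=> Sy.
pose g (u : 'rV[R]_d) := cm zm u - ((1 - 2^-1) * cm z u + 2^-1 * cm z' u).
have cmul k v : continuous (fun u => k * cm v u).
  move=> u; apply: (@continuous_comp _ _ _ (cm v) ( *%R k)); first exact: cm_cont.
  exact: mulrl_continuous.
have cg : continuous g.
  by move=> u; exact: (cvgB (@cm_cont zm u) (cvgD (cmul _ z u) (cmul _ z' u))).
have g_ge0 u : 0 <= g u by rewrite subr_ge0; exact: cmin_concave.
have ig : integrableR Q (g : Rd R d -> R).
  by apply: integrableRB => //; apply: integrableRD; apply: integrableRZ.
have g0 : \int[Q]_y g y = 0.
  apply/eqP; rewrite eq_le Rintegral_ge0 ?andbT//.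
  rewrite RintegralB//; last by apply: integrableRD; apply: integrableRZ.
  rewrite RintegralD//; [|exact: integrableRZ..].
  rewrite !RintegralZl//.
  have E v : \int[Q]_y cm v y = D v - \sum_i v i * p i by rewrite /D /dual; ring.
  rewrite !E.
  have -> : \sum_i zm i * p i = (1 - 2^-1) * (\sum_i z i * p i) + 2^-1 * \sum_i z' i * p i.
    rewrite !mulr_sumr -big_split/=; apply: eq_bigr => i _; rewrite /zm; ring.
  by have := zmax zm; have := zz'; lra.
suff : g y = 0 by rewrite /g; lra.
apply: open_null => //.
have mg : measurable_fun setT (fun u : Rd R d => (g u)%:E) by exact: measurable_int ig.
have [+ _] := ae_eq_integral_abs Q measurableT mg.
have -> : (\int[Q]_u `|(g u)%:E| = 0)%E.
  rewrite -[RHS]/(0%:E) -g0 Rintegral_EFin//.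
  by apply: eq_integral => u _; rewrite gee0_abs// lee_fin.
move=> /(_ erefl) [A [mA A0 HA]].
apply/eqP; rewrite eq_le measure_ge0 andbT -A0 le_measure ?inE//.
  apply: open_measurable_Rd.
  apply: (@open_comp _ _ g [set t | t != 0]); last exact: open_neq.
  by move=> u _; exact: cg.
move=> u /= gu; apply: HA => /= H.
by move: gu; case: (H I) => ->; rewrite eqxx.
Qed.

(** Equality at the midpoint forces an index that is minimizing for [zm] to be minimizing for [z]
    and for [z'], so [c i y] cancels in the difference. *)
Let argmin_diff y i : msupport Q y -> cm zm y = c i y - zm i ->
  cm z' y - cm z y = z i - z' i.
Proof.
move=> Sy yi; have := midpoint Sy; rewrite yi /zm.
have := cmin_le i0 (c : 'I_N -> Rd R d -> R) z y i.
have := cmin_le i0 (c : 'I_N -> Rd R d -> R) z' y i.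
rewrite -/(cm z y) -/(cm z' y); lra.
Qed.

Let support_nonempty : exists y, msupport Q y.
Proof.
apply: contrapT => H; have := @msupport_full R d Q setT measurableT.
have QT : Q setT = 1%E := @probability_setT _ _ R Q.
rewrite QT => H1; have /eqP := H1 (fun y _ Sy => H (ex_intro _ y Sy)).
by rewrite onee_eq0.
Qed.

(** On the support the continuous function [F] takes only the finitely many values [z i - z' i], so
    its level set is open and closed there, and the support is connected. *)
Let diff_const : exists v, forall y, msupport Q y -> cm z' y - cm z y = v.
Proof.
have [y0 Sy0] := support_nonempty.
pose F y := cm z' y - cm z y; pose v := F y0.
have cF : continuous F by move=> y; exact: (cvgB (@cm_cont z' y) (@cm_cont z y)).
(* [rho], the least entry, separates [v] from the other values; the entry 1 keeps indices with value
   [v] from making it zero. *)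
pose gap i : R := if z i - z' i == v then 1 else `|z i - z' i - v|.
have gap0 i : 0 < gap i.
  by rewrite /gap; case: ifPn => // H; rewrite normr_gt0 subr_eq0.
pose rho := minf i0 gap.
have rho0 : 0 < rho by have [i] := minf_ex i0 gap; rewrite -/rho => ->.
have near_eq y : msupport Q y -> `|F y - v| < rho -> F y = v.
  move=> Sy; have [i Hi] := minf_ex i0 (fun i => c i y - zm i).
  have Fy : F y = z i - z' i by apply: argmin_diff.
  have := minf_le i0 gap i; rewrite -/rho /gap -Fy.
  by case: eqP => // _ H1 H2; have := le_lt_trans H1 H2; rewrite ltxx.
have BS : msupport Q `&` [set y | F y = v] = msupport Q.
  apply: Q_conn.
  - by exists y0.
  - exists [set y | `|F y - v| < rho].
      apply: (@open_comp _ _ F [set t | `|t - v| < rho]); first by move=> y _; exact: cF.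
      have -> : [set t : R | `|t - v| < rho] = ball v rho.
        by apply/seteqP; split => t /=; rewrite /ball /= distrC.
      exact: ball_open.
    apply/seteqP; split => y /= [Sy H]; split => //.
      by rewrite H subrr normr0.
    exact: near_eq.
  - exists [set y | F y = v] => //.
    by apply: (@closed_comp _ _ F [set v]) => //; exact: closed_eq.
by exists v => y Sy; move: (Sy); rewrite -{1}BS => -[].
Qed.

(* If [i] were nowhere a minimizer of [c_j - zm_j] on the support, then raising
   [zm_i] slightly would increase the dual. *)
Let site_is_argmin i : exists2 y, msupport Q y & cm zm y = c i y - zm i.
Proof.
apply: contrapT => H.
pose s (y : 'rV[R]_d) : R := c i y - zm i - cm zm y.
have s_ge0 y : 0 <= s y by rewrite subr_ge0; exact: cmin_le.
have ms : measurable_fun setT (s : Rd R d -> R).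
  apply: measurable_funB; last exact: integrableR_meas (icm zm).
  by apply: measurable_funB => //; exact: integrableR_meas (ic i).
(* These sets decrease to the zero set of [s], which misses the support by assumption, so their mass
   eventually drops below [p i]. *)
pose A (n : nat) : set (Rd R d) := [set y | s y < n.+1%:R^-1].
have mA n : measurable (A n).
  have -> : A n = setT `&` (s : Rd R d -> R) @^-1` `]-oo, n.+1%:R^-1[%classic.
    by rewrite setTI; apply/seteqP; split => y /=; rewrite in_itv.
  exact: ms.
have capA : \bigcap_n A n `<=` [set y | s y <= 0].
  move=> y H1 /=; rewrite leNgt; apply/negP => sy.
  have [n] := ltr_add_invr sy; rewrite add0r => Hn.
  by have := H1 n I; rewrite /A /= ltNge (ltW Hn).
have QA : Q (\bigcap_n A n) = 0%E.
  apply: msupport_full; first exact: bigcapT_measurable.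
  move=> y /capA /= sy Sy; apply: H; exists y => //.
  by have := s_ge0 y; move: sy; rewrite /s; lra.
have : Q \o A @ \oo --> Q (\bigcap_n A n).
  apply: nonincreasing_cvg_mu => //.
  - have := @probability_le1 _ _ R Q (A 0%N) (mA 0%N) => H1; apply: le_lt_trans H1 _; exact: ltry.
  - exact: bigcapT_measurable.
  - move=> m n mn; apply/subsetPset => y; rewrite /A /= => /lt_le_trans; apply.
    by rewrite lef_pV2 ?posrE// ler_nat.
rewrite QA => /fine_cvgP[_] /cvgrPdist_lt /(_ _ (p_gt0 i)) [n _ Hn].
have {}Hn : fine (Q (A n)) < p i.
  by have := Hn n (leqnn n); rewrite /= sub0r normrN ger0_norm// fine_ge0.
(* Raising [zm i] by [t] gains [t * p i] in the linear part and lowers the minimum only on [A n], by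
   at most [t]. *)
pose t : R := n.+1%:R^-1.
have t0 : 0 < t by rewrite invr_gt0.
have := zm_max (fun j => zm j + (j == i)%:R * t).
apply/negP; rewrite -ltNge.
have iA : integrableR Q (fun y => t * \1_(A n) y).
  by apply: integrableRZ; exact: (integrable_indic Q (mA n)).
apply: (@lt_le_trans _ _ (\sum_j zm j * p j + t * p i +
    \int[Q]_y (cm zm y - t * \1_(A n) y))).
  rewrite RintegralB// RintegralZl//; last exact: (integrable_indic Q (mA n)).
  have -> : \int[Q]_y \1_(A n) y = fine (Q (A n)).
    by rewrite /Rintegral integral_indic// setIT.
  rewrite /D /dual -/(cm _); have := ltr_pM2l t0 (fine (Q (A n))) (p i).
  by rewrite Hn => H2; lra.
rewrite /D /dual; apply: lerD.
  under [leRHS]eq_bigr do rewrite mulrDl.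
  rewrite big_split/= lerD2l (bigD1 i)//= eqxx mul1r lerDl sumr_ge0// => j /negbTE ->.
  by rewrite !mul0r.
apply: Rintegral_le; [exact: integrableRB|exact: icm|].
move=> y; apply: le_minf => j; have := cmin_le i0 (c : 'I_N -> Rd R d -> R) zm y j.
rewrite -/(cm zm y) indicE; have [->|ji] := eqVneq j i.
  rewrite mul1r => H3; case: (boolP (_ \in _)); first by rewrite mulr1; lra.
  by rewrite notin_setE /A /= => /negP; rewrite -leNgt /s -/t mulr0; lra.
by rewrite mul0r; case: (_ \in _); rewrite ?mulr1 ?mulr0; lra.
Qed.

(** Every index is minimizing somewhere on the support, so each [z i - z' i] equals the one constant
    value of the difference of minima, which the normalization at [i0] makes zero. *)
Lemma dual_maximizer_unique : z' i0 = z i0 -> z' = z.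
Proof.
move=> z0; have [v Hv] := diff_const.
have zv i : z i - z' i = v.
  have [y Sy yi] := site_is_argmin i.
  by rewrite -(argmin_diff Sy yi); exact: Hv.
apply/funext => i; have := zv i; have := zv i0; rewrite z0; lra.
Qed.

End uniqueness.

(** * Sums of independent variables *)

Section independence.
Context {dO dT} {O : measurableType dO} {T : measurableType dT} {R : realType}.
Variables (I : eqType) (Pr : probability O R) (Z : I -> O -> T).
Hypothesis mZ : forall i, measurable_fun setT (Z i).
Hypothesis indep : mutually_independent Pr Z.

Let mpre i B : measurable B -> measurable (Z i @^-1` B).
Proof. by move=> mB; rewrite -[X in measurable X]setTI; exact: mZ. Qed.

Let cylinders (s : seq I) : set (set O) :=
  [set E | exists2 B : I -> set T, (forall i, measurable (B i)) &
    E = \bigcap_(i in [set` s]) (Z i @^-1` B i)].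

(** As functions of [U] both sides are finite measures, and they agree on the cylinders, a
    generating class stable under intersection. *)
Lemma independent_cylinder (s : seq I) j U C : uniq (j :: s) ->
  <<s cylinders s >> U -> measurable C ->
  Pr (U `&` Z j @^-1` C) = (Pr U * Pr (Z j @^-1` C))%E.
Proof.
move=> us sU mC; have mE := mpre j mC.
have cylm : cylinders s `<=` measurable.
  move=> _ [B mB ->]; apply: fin_bigcap_measurable; first exact: finite_seq.
  by move=> i _; exact: mpre.
have k0 : 0 <= fine (Pr (Z j @^-1` C)) by rewrite fine_ge0.
have PE : (fine (Pr (Z j @^-1` C)))%:E = Pr (Z j @^-1` C).
  by rewrite fineK// fin_num_measure.
have msE A : mscale (NngNum k0) Pr A = (Pr (Z j @^-1` C) * Pr A)%E.
  by rewrite /mscale -[in RHS]PE.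
transitivity (mscale (NngNum k0) Pr U); last by rewrite msE muleC.
change (mrestr Pr mE U = mscale (NngNum k0) Pr U).
apply: (g_sigma_algebra_measure_unique (cylinders s) cylm (fun=> setT)) => //.
- by move=> _; exists (fun=> setT) => //; apply/seteqP; split.
- by apply/seteqP; split => // y _; exists 0%N.
- move=> _ _ [B mB ->] [B' mB' ->]; exists (fun i => B i `&` B' i).
    by move=> i; exact: measurableI.
  by rewrite -bigcapI; apply: eq_bigcapr => i _; rewrite preimage_setI.
- move=> _ [B mB ->].
  pose B' i := if i == j then C else B i.
  have mB' i : measurable (B' i) by rewrite /B'; case: ifP.
  have E1 : \bigcap_(i in [set` s]) (Z i @^-1` B i) =
      \bigcap_(i in [set` s]) (Z i @^-1` B' i).
    apply: eq_bigcapr => i /= si; rewrite /B'; case: eqP => // ij.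
    by move: us; rewrite /= -ij si.
  have E2 : \bigcap_(i in [set` s]) (Z i @^-1` B' i) `&` Z j @^-1` C =
      \bigcap_(i in [set` j :: s]) (Z i @^-1` B' i).
    apply/seteqP; split => [y [H1 H2] i /=|y H].
      rewrite in_cons => /orP[/eqP ->|]; [by rewrite /B' eqxx|exact: H1].
    split => [i si|]; first by apply: H; rewrite /= in_cons; apply/orP; right.
    by have := H j; rewrite /= mem_head /B' eqxx; exact.
  rewrite [RHS]msE; change (Pr (\bigcap_(i in [set` s]) (Z i @^-1` B i) `&` Z j @^-1` C) = Pr (Z j @^-1` C) * Pr (\bigcap_(i in [set` s]) (Z i @^-1` B i)))%E.
  rewrite E1 E2 (indep us mB') big_cons {1}/B' eqxx.
  by rewrite (indep _ mB')//; move: us => /= /andP[].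
- move=> _; change (Pr (setT `&` Z j @^-1` C) < +oo)%E; rewrite setTI.
  by apply: (@le_lt_trans _ _ 1%E); [exact: probability_le1|exact: ltry].
Qed.

Variables (phi : I -> T -> R) (Q : I -> probability T R).
Hypothesis mphi : forall i, measurable_fun setT (phi i).
Hypothesis ZQ : forall i A, measurable A -> Pr (Z i @^-1` A) = Q i A.

(** Trotter's operator of the variable [g], with extended real values so that Tonelli applies to
    nonnegative test functions. *)
Definition shift_mean (P : probability T R) (g : T -> R) (psi : R -> \bar R) (x : R) :=
  (\int[P]_y psi (x + g y)%R)%E.

Let S (s : seq I) w : R := \sum_(i <- s) phi i (Z i w).

Let measurable_S s : measurable_fun setT (S s).
Proof. by apply: measurable_sum => i; exact: (measurableT_comp (mphi i) (mZ i)). Qed.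

Let S_cylinder s A : measurable A -> <<s cylinders s >> (S s @^-1` A).
Proof.
move=> mA.
suff : measurable_fun setT (S s : g_sigma_algebraType (cylinders s) -> R).
  by move=> /(_ measurableT A mA); rewrite setTI.
have H (s' : seq I) : {subset s' <= s} ->
    measurable_fun setT (fun w : g_sigma_algebraType (cylinders s) =>
      \sum_(i <- s') phi i (Z i w)).
  elim: s' => [|i s' IH] ss.
    by under eq_fun do rewrite big_nil; exact: measurable_cst.
  under eq_fun do rewrite big_cons; apply: measurable_funD.
    apply: (measurableT_comp (mphi i)) => _ B mB; rewrite setTI.
    apply: sub_sigma_algebra; exists (fun k => if k == i then B else setT).
      by move=> k; case: ifP.
    apply/seteqP; split => [w Bw k /= _|w H]; first by case: eqP => // ->.
    by have := H i; rewrite /= eqxx; apply; apply: ss; exact: mem_head.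
  by apply: IH => k ks; apply: ss; rewrite in_cons ks orbT.
exact: H.
Qed.

Lemma shift_mean_ge0 P g psi x : (forall t, 0 <= psi t)%E ->
  (0 <= shift_mean P g psi x)%E.
Proof. by move=> psi0; apply: integral_ge0 => y _; exact: psi0. Qed.

Lemma measurable_shift_mean P g psi : measurable_fun setT g ->
  measurable_fun setT psi -> (forall t, 0 <= psi t)%E ->
  measurable_fun setT (shift_mean P g psi).
Proof.
move=> mg mpsi psi0.
pose F (u : R * T) : \bar R := psi (u.1 + g u.2).
have mF : measurable_fun setT F.
  apply: (measurableT_comp mpsi); apply: measurable_funD => //.
  exact: (measurableT_comp mg).
have F0 u : (0 <= F u)%E by exact: psi0.
rewrite (_ : shift_mean P g psi = fubini_F P F)//.
exact: measurable_fun_fubini_tonelli_F.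
Qed.

(** The partial sum over [s] is measurable for the cylinders over [s], so its joint law with [Z j]
    is a product, and Tonelli integrates [Z j] out. *)
Lemma independent_sum_peel s j psi x : uniq (j :: s) ->
  measurable_fun setT psi -> (forall t, 0 <= psi t)%E ->
  (\int[Pr]_w psi (x + \sum_(i <- j :: s) phi i (Z i w))%R =
   \int[Pr]_w shift_mean (Q j) (phi j) psi (x + \sum_(i <- s) phi i (Z i w))%R)%E.
Proof.
move=> us mpsi psi0.
have mS : measurable_fun setT (S s) by exact: measurable_S.
pose SS : {mfun O >-> R} := HB.pack (S s) (isMeasurableFun.Build _ _ _ _ _ mS).
have mW : measurable_fun setT (fun w => (S s w, Z j w)) by exact: measurable_fun_pair.
pose WW : {mfun O >-> (R * T)%type} := HB.pack (fun w => (S s w, Z j w))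
  (isMeasurableFun.Build _ _ _ _ _ mW).
pose F (u : R * T) : \bar R := psi (x + u.1 + phi j u.2).
have mF : measurable_fun setT F.
  apply: (measurableT_comp mpsi); apply: measurable_funD => //.
    exact: measurable_funD.
  exact: (measurableT_comp (mphi j)).
have F0 u : (0 <= F u)%E by exact: psi0.
have joint A : measurable A -> (distribution Pr SS \x Q j)%E A = distribution Pr WW A.
  apply: product_measure_unique => B C mB mC.
  rewrite /distribution /pushforward /=.
  rewrite -ZQ// -(independent_cylinder us (@S_cylinder s B mB) mC).
  by congr (Pr _); apply/seteqP; split.
transitivity (\int[distribution Pr WW]_u F u)%E.
  rewrite ge0_integral_distribution//; apply: eq_integral => w _ /=.
  by rewrite /F /= big_cons addrAC -addrA [_ + S s w]addrC addrCA.
transitivity (\int[(distribution Pr SS \x Q j)%E]_u F u)%E.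
  by apply/esym/eq_measure_integral => A mA _; exact: joint.
rewrite fubini_tonelli1// ge0_integral_distribution//.
  exact: measurable_fun_fubini_tonelli_F.
by move=> y; exact: integral_ge0.
Qed.

Lemma independent_sum_mean s psi x : uniq s ->
  measurable_fun setT psi -> (forall t, 0 <= psi t)%E ->
  (\int[Pr]_w psi (x + \sum_(i <- s) phi i (Z i w))%R =
   foldl (fun g i => shift_mean (Q i) (phi i) g) psi s x)%E.
Proof.
elim: s psi => [|j s IH] psi us mpsi psi0.
  under eq_integral do rewrite big_nil addr0.
  rewrite integral_cst//= -[RHS]mule1; congr *%E; exact: probability_setT.
rewrite independent_sum_peel// IH//.
- by case/andP: us.
- exact: measurable_shift_mean.
- by move=> t; exact: shift_mean_ge0.
Qed.

End independence.

(** * The standard normal law *)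

Section density.
Context {d} {T : measurableType d} {R : realType}.
Variables (mu nu : {measure set T -> \bar R}) (w : T -> R).
Hypothesis mw : measurable_fun setT w.
Hypothesis w_ge0 : forall y, 0 <= w y.
Hypothesis nuE : forall A, measurable A -> nu A = (\int[mu]_(y in A) (w y)%:E)%E.

Import HBNNSimple.

Let density_nnsfun (g : {nnsfun T >-> R}) :
  (\int[nu]_y (g y)%:E = \int[mu]_y (g y * w y)%:E)%E.
Proof.
under eq_integral do rewrite fimfunE -fsumEFin//.
rewrite ge0_integral_fsum//; last 2 first.
- by move=> r; exact/measurable_EFinP/measurableT_comp.
- by move=> n x _; rewrite EFinM nnfun_muleindic_ge0.
transitivity (\int[mu]_y (\sum_(r \in range g) (r * \1_(g @^-1` [set r]) y)%:E * (w y)%:E))%E; last first.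
  apply: eq_integral => y _.
  rewrite -ge0_mule_fsuml => [|r]; last exact: nnfun_muleindic_ge0.
  by rewrite fsumEFin// -fimfunE EFinM.
rewrite ge0_integral_fsum//; last 2 first.
- move=> r; apply: emeasurable_funM; last exact/measurable_EFinP.
  exact/measurable_EFinP/measurableT_comp.
- by move=> r y _; apply: mule_ge0; [exact: nnfun_muleindic_ge0|rewrite lee_fin].
apply: eq_fsbigr => r rg.
have r0 : 0 <= r by move: rg; rewrite inE => -[t _ <-].
under eq_integral do rewrite EFinM.
rewrite integralZl_indic_nnsfun//.
under [RHS]eq_integral do rewrite EFinM -muleA.
rewrite ge0_integralZl//.
- congr (_ * _)%E; rewrite integral_indic// setIT nuE//.
  rewrite integral_mkcond; apply: eq_integral => y _.
  by rewrite patchE indicE; case: ifPn => _; rewrite ?mul1e ?mul0e.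
- apply: emeasurable_funM; last exact/measurable_EFinP.
  exact/measurable_EFinP/measurable_indic.
- by move=> y _; rewrite mule_ge0// lee_fin.
Qed.

Lemma ge0_integral_density (f : T -> \bar R) : measurable_fun setT f ->
  (forall y, 0 <= f y)%E ->
  (\int[nu]_y f y = \int[mu]_y (f y * (w y)%:E))%E.
Proof.
move=> mf f0; pose h := nnsfun_approx measurableT mf.
have mhw n : measurable_fun setT (fun y => (h n y * w y)%:E).
  by apply/measurable_EFinP; exact: measurable_funM.
have fE y : f y = limn (fun n => (h n y)%:E).
  by apply/esym/cvg_lim => //; exact: cvg_nnsfun_approx.
transitivity (limn (fun n => \int[nu]_y (h n y)%:E))%E.
  under eq_integral do rewrite fE.
  apply: monotone_convergence => //.
  - by move=> n; exact/measurable_EFinP.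
  - by move=> n y _; rewrite lee_fin.
  - by move=> y _ a b ab; rewrite lee_fin; exact/lefP/nd_nnsfun_approx.
under eq_fun do rewrite density_nnsfun.
rewrite -monotone_convergence//.
- apply: eq_integral => y _; apply/cvg_lim => //.
  under eq_fun do rewrite EFinM.
  by apply: cvgeZr => //; exact: cvg_nnsfun_approx.
- by move=> n y _; rewrite lee_fin mulr_ge0.
- move=> y _ a b ab; rewrite lee_fin ler_wpM2r//.
  exact/lefP/nd_nnsfun_approx.
Qed.

End density.

Section gaussian.
Variable R : realType.
Local Notation mu := (@lebesgue_measure R).
Local Notation phi := (normal_pdf (0 : R) 1).
Definition std_normal : probability (measurableTypeR R) R := normal_prob (0 : R) 1.

Lemma normal_pdf01E (u : R) : phi u = normal_peak 1 * expR (- (u ^+ 2 / 2)).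
Proof.
rewrite normal_pdfE ?oner_neq0// /normal_fun subr0 expr1n mulNr.
by rewrite -mulr_natr mul1r.
Qed.

Lemma normal_pdf_rotation (u v s t : R) : u ^+ 2 + v ^+ 2 = s ^+ 2 + t ^+ 2 ->
  phi u * phi v = phi s * phi t.
Proof.
move=> E; rewrite !normal_pdf01E mulrACA [RHS]mulrACA -!expRD; congr (_ * expR _).
by rewrite -!opprD -!mulrDl E.
Qed.

Lemma ge0_integral_std_normal (f : R -> \bar R) : measurable_fun setT f ->
  (forall u, 0 <= f u)%E ->
  (\int[std_normal]_u f u = \int[mu]_u (f u * (phi u)%:E))%E.
Proof.
move=> mf f0; apply: ge0_integral_density => //.
- exact: measurable_normal_pdf.
- by move=> u; exact: normal_pdf_ge0.
Qed.

Lemma Rintegral_std_normal (f : R -> R) : integrableR std_normal f ->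
  (\int[std_normal]_u (f u)%:E = \int[mu]_u (f u * phi u)%:E)%E.
Proof.
move=> fi; have mf := integrableR_meas fi.
have mphi := @measurable_normal_pdf R 0 1.
have phi0 u : 0 <= phi u by exact: normal_pdf_ge0.
rewrite integralE [RHS]integralE; congr (_ - _)%E.
  rewrite ge0_integral_std_normal//; last first.
    by apply: measurable_funepos; exact/measurable_EFinP.
  apply: eq_integral => u _; rewrite !funeposE -!EFin_max -EFinM.
  by rewrite maxr_pMl// mul0r.
rewrite ge0_integral_std_normal//; last first.
  by apply: measurable_funeneg; exact/measurable_EFinP.
apply: eq_integral => u _; rewrite !funenegE -!EFinN -!EFin_max -EFinM.
by rewrite maxr_pMl// mul0r mulNr.
Qed.

Lemma ge0_integral_affine (G : R -> R) (r q : R) : 0 < r -> continuous G ->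
  (forall t, 0 <= G t) ->
  (\int[mu]_t (G t)%:E = \int[mu]_t (G (r * t + q) * r)%:E)%E.
Proof.
move=> r0 cG G0; pose F (t : R^o) : R := (t + q / r) * r.
have F'E : F^`()%classic = cst r.
  apply/funext => t; rewrite /F derive1E deriveM// deriveD// derive_id !derive_cst.
  by rewrite addr0 scaler0 add0r [LHS]mulr1.
have FE t : F t = r * t + q by rewrite /F mulrDl divfK ?gt_eqF// mulrC.
rewrite (@increasing_ge0_integration_by_substitutionT _ F G)//.
- by apply: eq_integral => t _; rewrite F'E /= -FE.
- by move=> s t st; rewrite /F ltr_pM2r// ltrD2r.
- by rewrite F'E => t; exact: cvg_cst.
- by rewrite F'E; exact: is_cvg_cst.
- by rewrite F'E; exact: is_cvg_cst.
- by apply/gt0_cvgMlNy => //; exact: cvg_addrr_Ny.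
- by apply/gt0_cvgMly => //; exact: cvg_addrr.
Qed.

Lemma continuous_std_pdf : continuous phi.
Proof. by apply: continuous_normal_pdf; exact: oner_neq0. Qed.

Lemma integral_std_pdf : (\int[mu]_u (phi u)%:E = 1)%E.
Proof. exact: integral_normal_pdf. Qed.

(* Rotation of the plane carrying [a u + b v] to [c w]: substitute
   [v = (c w - a u) / b], exchange the integrals, and complete the square. *)
Lemma std_normal_convolution (psi : R -> R) (a b c x : R) :
  0 <= a -> 0 <= b -> 0 <= c -> c ^+ 2 = a ^+ 2 + b ^+ 2 ->
  continuous psi -> (forall t, 0 <= psi t) ->
  (\int[std_normal]_u \int[std_normal]_v (psi (x + a * u + b * v))%:E =
   \int[std_normal]_w (psi (x + c * w))%:E)%E.
Proof.
move=> a0 b0 c0 cE cpsi psi0.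
have stdT : std_normal setT = 1%E := @probability_setT _ _ R std_normal.
have [b00|bn0] := eqVneq b 0.
  have -> : c = a.
    have : c ^+ 2 == a ^+ 2 by rewrite cE b00 expr0n addr0.
    by rewrite eqrXn2// => /eqP.
  apply: eq_integral => u _.
  rewrite (eq_integral (cst (psi (x + a * u))%:E)); last first.
    by move=> v _; rewrite b00 mul0r addr0.
  by rewrite integral_cst//= stdT mule1.
have bp : 0 < b by rewrite lt_neqAle eq_sym bn0.
have cp : 0 < c.
  rewrite lt_neqAle c0 andbT eq_sym; apply/eqP => c00.
  have : 0 < c ^+ 2 by rewrite cE ltr_wpDl ?sqr_ge0// exprn_gt0.
  by rewrite c00 expr0n ltxx.
have cst_affine (k l : R) : continuous (fun t : R => k + l * t).
  move=> t; apply: (@cvgD _ _ _ _ _ (fun=> k) (fun t => l * t)); first exact: cvg_cst.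
  exact: mulrl_continuous.
have cpsi_affine (k l : R) : continuous (fun t : R => psi (k + l * t)).
  by move=> t; apply: continuous_comp; [exact: cst_affine|exact: cpsi].
have phi_ge0 u : 0 <= phi u by exact: normal_pdf_ge0.
have inner u : (\int[std_normal]_v (psi (x + a * u + b * v))%:E =
    \int[mu]_w (psi (x + c * w) * phi ((c * w - a * u) / b) * (c / b))%:E)%E.
  rewrite ge0_integral_std_normal//; last 2 first.
  - by apply/measurable_EFinP; apply: continuous_measurable_fun; exact: cpsi_affine.
  - by move=> v; rewrite lee_fin.
  under eq_integral do rewrite -EFinM.
  have cG : continuous (fun v => psi (x + a * u + b * v) * phi v).
    by move=> v; apply: cvgM; [exact: cpsi_affine|exact: continuous_std_pdf].
  rewrite (ge0_integral_affine (r := c / b) (- (a * u / b)) _ cG); last 2 first.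
  - by rewrite divr_gt0.
  - by move=> v; rewrite mulr_ge0.
  apply: eq_integral => w _; congr (_ * _ * _)%:E.
    by congr psi; field.
  by congr (normal_pdf _ _ _); field.
under eq_integral do rewrite inner.
pose K0 (z : R * R) : R := psi (x + c * z.2) * phi ((c * z.2 - a * z.1) / b) * (c / b).
pose K (z : R * R) : R := K0 z * phi z.1.
have mfst : measurable_fun setT (fun z : R * R => z.1) by exact: measurable_fst.
have msnd : measurable_fun setT (fun z : R * R => z.2) by exact: measurable_snd.
have mphi := @measurable_normal_pdf R 0 1.
have mK0 : measurable_fun setT K0.
  apply: measurable_funM => //; apply: measurable_funM.
    apply: (measurableT_comp (continuous_measurable_fun cpsi)).
    by apply: measurable_funD => //; exact: measurable_funM.
  apply: (measurableT_comp mphi); apply: measurable_funM => //.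
  by apply: measurable_funB; exact: measurable_funM.
have K0_ge0 z : 0 <= K0 z by rewrite !mulr_ge0// ?invr_ge0 ltW.
have mK : measurable_fun setT K.
  by apply: measurable_funM => //; exact: (measurableT_comp mphi mfst).
have mEK : measurable_fun setT (fun z => (K z)%:E) by exact/measurable_EFinP.
have mEK0 : measurable_fun setT (fun z => (K0 z)%:E) by exact/measurable_EFinP.
have K_ge0 z : (0 <= (K z)%:E)%E by rewrite lee_fin mulr_ge0.
have EK0_ge0 z : (0 <= (K0 z)%:E)%E by rewrite lee_fin.
have mK1 u : measurable_fun setT (fun w => (K0 (u, w))%:E).
  exact: (measurableT_comp mEK0 (measurable_pair1 u)).
rewrite [LHS]ge0_integral_std_normal; last 2 first.
- rewrite (_ : (fun u : R => _) = fubini_F mu (fun z => (K0 z)%:E))//.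
  exact: measurable_fun_fubini_tonelli_F.
- by move=> u; apply: integral_ge0 => w _; exact: (EK0_ge0 (u, w)).
transitivity (\int[mu]_u \int[mu]_w (K (u, w))%:E)%E.
  apply: eq_integral => u _.
  rewrite -ge0_integralZr; [|exact: measurableT|exact: mK1|by move=> w _; exact: (EK0_ge0 (u, w))|by rewrite lee_fin].
  by apply: eq_integral => w _; rewrite -EFinM.
transitivity (\int[mu]_w \int[mu]_u (K (u, w))%:E)%E.
  have swap := @fubini_tonelli _ _ _ _ R mu mu _ mEK K_ge0; exact: swap.
rewrite [RHS]ge0_integral_std_normal//; last 2 first.
- by apply/measurable_EFinP; apply: continuous_measurable_fun; exact: cpsi_affine.
- by move=> w; rewrite lee_fin.
apply: eq_integral => w _.
transitivity (\int[mu]_u ((psi (x + c * w) * phi w)%:E * (phi (c / b * u + - (a * w / b)) * (c / b))%:E))%E.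
  apply: eq_integral => u _; rewrite -EFinM /K /K0 /=; congr EFin.
  (* The product density depends only on the radius, and the two pairs of arguments are related by a
     rotation since [c ^+ 2 = a ^+ 2 + b ^+ 2]. *)
  have : phi ((c * w - a * u) / b) * phi u = phi w * phi (c / b * u + - (a * w / b)).
    apply: normal_pdf_rotation.
    have b2 : b ^+ 2 != 0 by rewrite expf_neq0.
    apply: (mulfI b2).
    transitivity (c ^+ 2 * w ^+ 2 - 2 * a * c * w * u + (a ^+ 2 + b ^+ 2) * u ^+ 2).
      by field.
    rewrite -cE; transitivity (b ^+ 2 * w ^+ 2 + (c * u - a * w) ^+ 2); last by field.
    have -> : b ^+ 2 = c ^+ 2 - a ^+ 2 by rewrite cE; ring.
    by ring.
  move=> E; transitivity (psi (x + c * w) * (c / b) * (phi ((c * w - a * u) / b) * phi u)).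
    by ring.
  by rewrite E; ring.
have mphi2 : measurable_fun setT (fun u : R => (phi (c / b * u + - (a * w / b)) * (c / b))%:E).
  apply/measurable_EFinP; apply: measurable_funM => //; apply: (measurableT_comp mphi).
  by apply: measurable_funD => //; exact: measurable_funM.
rewrite ge0_integralZl//; last 2 first.
- by move=> u _; rewrite lee_fin mulr_ge0// ltW// divr_gt0.
- by rewrite lee_fin mulr_ge0.
rewrite -(ge0_integral_affine (r := c / b) _ _ continuous_std_pdf); [|by rewrite divr_gt0|exact: phi_ge0].
by rewrite integral_std_pdf mule1 EFinM.
Qed.

End gaussian.

Section exp_taylor.
Variable R : realType.

(** Mean value theorem from 0: each primitive gains one power of [|x|]. Three applications starting
    from [expR] give the Taylor bound, without tracking factorials. *)
Lemma primitive_expR_bound (F G : R -> R) n :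
  (forall x : R, is_derive x 1 (F : R^o -> R^o) (G x)) -> F 0 = 0 ->
  (forall x, `|G x| <= `|x| ^+ n * expR `|x|) ->
  forall x, `|F x| <= `|x| ^+ n.+1 * expR `|x|.
Proof.
move=> dF F0 Gb x.
have cF : continuous (F : R^o -> R^o).
  by move=> y; apply: differentiable_continuous; apply/derivable1_diffP; have [] := dF y.
have [c cx Fx] : exists2 c, `|c| <= `|x| & F x = G c * x.
  have [x0|x0] := leP 0 x.
    have [c] := MVT_segment x0 (fun y _ => dF y) (continuous_subspaceT cF).
    rewrite in_itv /= F0 !subr0 => /andP[c0 cx] ->.
    by exists c => //; rewrite !ger0_norm.
  have [c] := MVT_segment (ltW x0) (fun y _ => dF y) (continuous_subspaceT cF).
  rewrite in_itv /= F0 !sub0r => /andP[xc c0] Fx.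
  exists c; first by rewrite !ler0_norm ?lerN2// ltW.
  by lra.
rewrite Fx normrM exprSr mulrAC ler_wpM2r// (le_trans (Gb c))//.
by apply: ler_pM; rewrite ?exprn_ge0 ?expR_ge0// ?ler_expR// lerXn2r ?nnegrE.
Qed.

Lemma expR_taylor2 (x : R) :
  `|expR x - 1 - x - x ^+ 2 / 2| <= `|x| ^+ 3 * expR `|x|.
Proof.
have dE (y : R) : is_derive y 1 (expR : R^o -> R^o) (expR y) by exact: is_derive_expR.
apply: (@primitive_expR_bound (fun x => expR x - 1 - x - x ^+ 2 / 2)
  (fun x => expR x - 1 - x)) => [y||].
- apply: is_derive_eq; rewrite /GRing.scale /=; by field.
- by rewrite expR0 expr0n /=; lra.
apply: (@primitive_expR_bound (fun x => expR x - 1 - x) (fun x => expR x - 1)) => [y||].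
- by apply: is_derive_eq; rewrite subr0.
- by rewrite expR0; lra.
apply: (@primitive_expR_bound (fun x => expR x - 1) expR) => [y||y].
- by apply: is_derive_eq; rewrite subr0.
- by rewrite expR0; lra.
by rewrite expr0 mul1r ger0_norm ?expR_ge0// ler_expR ler_norm.
Qed.

End exp_taylor.

(** * Translations of the standard normal law and its moments *)

Section gaussian_translation.
Variable R : realType.
Local Notation gamma := (std_normal R).

(* Density of the translate of the standard normal law by [t]. *)
Definition translation_density (t u : R) : R := expR (u * t - t ^+ 2 / 2).

Local Notation E := translation_density.

Let E_ge0 t u : 0 <= E t u. Proof. exact: expR_ge0. Qed.

Let cE t : continuous (E t).
Proof.
move=> u; apply: (continuous_comp (f := fun u : R => u * t - t ^+ 2 / 2)); last exact: continuous_expR.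
by apply: cvgB; [apply: cvgM; [exact: cvg_id|exact: cvg_cst]|exact: cvg_cst].
Qed.

Let mE t : measurable_fun setT (E t).
Proof. exact: continuous_measurable_fun. Qed.

(** The Cameron-Martin formula in dimension one, by completing the square. *)
Lemma ge0_std_normal_translation (f : R -> R) t : continuous f -> (forall u, 0 <= f u) ->
  (\int[gamma]_u (f (u + t)%R)%:E = \int[gamma]_u (f u * E t u)%:E)%E.
Proof.
move=> cf f0.
have cft : continuous (fun u => f (u + t)).
  move=> u; apply: (continuous_comp (f := fun u : R => u + t)); last exact: cf.
  by apply: cvgD; [exact: cvg_id|exact: cvg_cst].
have cfE : continuous (fun u => f u * E t u) by move=> u; apply: cvgM; [exact: cf|exact: cE].
rewrite !ge0_integral_std_normal; last 4 first.
- by apply/measurable_EFinP; exact: continuous_measurable_fun.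
- by move=> u; rewrite lee_fin mulr_ge0.
- by apply/measurable_EFinP; exact: continuous_measurable_fun.
- by move=> u; rewrite lee_fin.
have EE u : f u * E t u * normal_pdf 0 1 u = f u * normal_pdf 0 1 (u - t).
  rewrite !normal_pdf01E /translation_density -!mulrA; congr (_ * _); rewrite mulrCA -expRD.
  by congr (_ * expR _); field.
under [RHS]eq_integral do rewrite -EFinM EE.
have shift0 (u : R) : 0 < 1 :> R by [].
rewrite [RHS](@ge0_integral_affine R (fun u => f u * normal_pdf 0 1 (u - t)) 1 t)//.
- by apply: eq_integral => u _; rewrite mul1r mulr1 addrK -EFinM.
- move=> u; apply: cvgM; first exact: cf.
  apply: (continuous_comp (f := fun u : R => u - t)); last exact: continuous_std_pdf.
  by apply: cvgB; [exact: cvg_id|exact: cvg_cst].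
- by move=> u; rewrite mulr_ge0// normal_pdf_ge0.
Qed.

Let E_mass t : (\int[gamma]_u (E t u)%:E = 1)%E.
Proof.
have := @ge0_std_normal_translation (fun=> 1) t (fun=> cvg_cst _) (fun=> ler01).
under [RHS]eq_integral do rewrite mul1r.
move=> <-; rewrite integral_cst// mul1e; exact: (@probability_setT _ _ R gamma).
Qed.

Let iE t : integrableR gamma (E t).
Proof.
have fin : (\int[gamma]_u (E t u)%:E < +oo)%E by rewrite E_mass ltry.
apply: (@integrableR_ge0 _ (measurableTypeR R) R gamma (E t)) => //.
exact: mE.
Qed.

Let E_mean t : \int[gamma]_u E t u = 1.
Proof. by rewrite -[RHS]/(fine 1%E); congr fine; exact: E_mass. Qed.

Let W (u : R) : R := (`|u| + 1) ^+ 3 * expR (`|u| + 1).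

Let mW : measurable_fun setT (W : measurableTypeR R -> R).
Proof.
have mD : measurable_fun setT (fun u : R => `|u| + 1).
  by apply: measurable_funD => //; exact: measurableT_comp.
apply: measurable_funM; first exact: measurable_funX.
exact: measurableT_comp.
Qed.

Let W_ge u : (`|u| + 1) ^+ 3 <= W u.
Proof.
have u1 : 0 <= `|u| + 1 by rewrite addr_ge0.
rewrite /W ler_peMr ?exprn_ge0//.
by rewrite (le_trans _ (expR_ge1Dx _))// lerDl.
Qed.

Let W_ge0 u : 0 <= W u.
Proof. by apply: le_trans (W_ge u); rewrite exprn_ge0// addr_ge0. Qed.

Let iW : integrableR gamma W.
Proof.
(* From [x ^+ 3 <= 6 * expR x] with [x = |u| + 1]; the factor [expR 4] makes up for the exponents
   [2 * u - 2] and [- 2 * u - 2] of the two densities. *)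
pose k : R := 6 * expR 4.
apply: (@integrableR_le _ (measurableTypeR R) R gamma W (fun u => k * (E 2 u + E (- 2) u))) => //.
  by apply: integrableRZ; exact: integrableRD.
move=> u; rewrite ger0_norm//.
have u1 : 0 <= `|u| + 1 by rewrite addr_ge0.
have W6 : W u <= 6 * expR (2 * `|u| + 2).
  have := expR_ge1Dxn 2 u1; rewrite (_ : 3`!%:R = 6 :> R)// => H.
  have H6 : (`|u| + 1) ^+ 3 <= 6 * expR (`|u| + 1).
    rewrite -ler_pdivrMl// mulrC; apply: le_trans H; by rewrite lerDr.
  apply: le_trans (ler_wpM2r (expR_ge0 _) H6) _.
  by rewrite -mulrA -expRD (_ : `|u| + 1 + (`|u| + 1) = 2 * `|u| + 2)//; ring.
apply: le_trans W6 _; rewrite /k -mulrA ler_wpM2l// mulrDr /translation_density -!expRD.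
have [u0|u0] := leP 0 u.
  apply: le_trans (_ : _ <= expR (4 + (u * 2 - 2 ^+ 2 / 2))) _; last by rewrite lerDl expR_ge0.
  by rewrite ler_expR ger0_norm//; lra.
apply: le_trans (_ : _ <= expR (4 + (u * (- 2) - (- 2) ^+ 2 / 2))) _; last by rewrite lerDr expR_ge0.
by rewrite ler_expR ltr0_norm//; lra.
Qed.

(** The expansion of the density in [t] to second order, whose coefficients are the Hermite
    polynomials [u] and [u ^+ 2 - 1]. *)
Definition translation_remainder (t u : R) : R := E t u - 1 - t * u - t ^+ 2 / 2 * (u ^+ 2 - 1).

Local Notation rem := translation_remainder.

Let rem_small t u : `|t| <= 1 -> `|rem t u| <= `|t| ^+ 3 * (2 * W u).
Proof.
move=> t1; set s := u * t - t ^+ 2 / 2.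
(* The polynomial correction is the part of [s ^+ 2 / 2] of order above two in [t]. *)
have -> : rem t u = (expR s - 1 - s - s ^+ 2 / 2) + (t ^+ 4 / 8 - u * t ^+ 3 / 2).
  by rewrite /translation_remainder /translation_density -/s {3 4}/s; field.
have sb : `|s| <= `|t| * (`|u| + 1).
  rewrite /s (le_trans (ler_normB _ _))// normrM mulrDr mulr1 mulrC lerD2l.
  rewrite ger0_norm ?divr_ge0 ?sqr_ge0// -(real_normK (num_real t)).
  have := normr_ge0 t; nra.
have s3 : `|s| ^+ 3 * expR `|s| <= `|t| ^+ 3 * W u.
  rewrite /W mulrA -exprMn; apply: ler_pM => //; rewrite ?expR_ge0 ?exprn_ge0//.
    by rewrite lerXn2r ?nnegrE// mulr_ge0// addr_ge0.
  by rewrite ler_expR (le_trans sb)// ler_piMl// addr_ge0.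
have r4 : `|t ^+ 4 / 8 - u * t ^+ 3 / 2| <= `|t| ^+ 3 * W u.
  apply: le_trans (_ : _ <= `|t| ^+ 3 * (`|u| + 1) ^+ 3) _; last by rewrite ler_wpM2l// exprn_ge0.
  have n4 : `|t ^+ 4 / 8| = `|t| ^+ 4 / 8.
    by rewrite normrM [ `|8^-1| ]gtr0_norm// normrX.
  have n3 : `|u * t ^+ 3 / 2| = `|u| * `|t| ^+ 3 / 2.
    by rewrite normrM [ `|2^-1| ]gtr0_norm// normrM normrX.
  rewrite (le_trans (ler_normB _ _))// n4 n3.
  have T0 : 0 <= `|t| ^+ 3 by rewrite exprn_ge0.
  have T4 : `|t| ^+ 4 <= `|t| ^+ 3 by rewrite exprS ler_piMl.
  have u1 : `|u| + 1 <= (`|u| + 1) ^+ 3.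
    by have := normr_ge0 u; rewrite exprS ler_peMr ?addr_ge0// expr_ge1// lerDr.
  apply: le_trans (_ : _ <= `|t| ^+ 3 * (`|u| + 1)) _; last exact: ler_wpM2l.
  have := normr_ge0 u; nra.
rewrite (le_trans (ler_normD _ _))// (le_trans (lerD (le_trans (expR_taylor2 _) s3) r4))//.
by lra.
Qed.

(** For large [t] each term is bounded by itself through [t ^+ 2]; the density is left as it stands,
    since its integral is 1 for every [t]. *)
Let rem_large t u : 1 <= `|t| -> `|rem t u| <= t ^+ 2 * (E t u + 2 * W u).
Proof.
move=> t1; have Wg := W_ge u; have u0 := normr_ge0 u; have e0 := E_ge0 t u.
have tt : t ^+ 2 = `|t| ^+ 2 by rewrite real_normK ?num_real.
have uu : u ^+ 2 = `|u| ^+ 2 by rewrite real_normK ?num_real.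
have W1 : 1 + `|u| + (u ^+ 2 + 1) / 2 <= 2 * W u.
  apply: le_trans (_ : _ <= 2 * (`|u| + 1) ^+ 3) _; last by rewrite ler_wpM2l.
  by rewrite uu; nra.
have t2 : 1 <= t ^+ 2 by rewrite tt expr_ge1.
have tt1 : `|t| <= t ^+ 2 by rewrite tt; nra.
have b : `|rem t u| <= E t u + 1 + `|t| * `|u| + t ^+ 2 / 2 * (u ^+ 2 + 1).
  rewrite /translation_remainder (le_trans (ler_normB _ _))// lerD//; last first.
    rewrite normrM ger0_norm ?divr_ge0 ?sqr_ge0// ler_wpM2l ?divr_ge0 ?sqr_ge0//.
    by rewrite (le_trans (ler_normB _ _))// normr1 ger0_norm ?sqr_ge0.
  rewrite (le_trans (ler_normB _ _))// normrM lerD2r.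
  by rewrite (le_trans (ler_normB _ _))// normr1 ger0_norm.
apply: (le_trans b).
apply: le_trans (_ : _ <= t ^+ 2 * (E t u + (1 + `|u| + (u ^+ 2 + 1) / 2))) _; last first.
  by rewrite ler_wpM2l ?sqr_ge0// lerD2l.
have := sqr_ge0 u; nra.
Qed.

Let mrem t : measurable_fun setT (rem t : measurableTypeR R -> R).
Proof.
apply: measurable_funB; last by apply: measurable_funM => //; apply: measurable_funB => //; exact: exprn_measurable.
apply: measurable_funB; last exact: measurable_funM.
by apply: measurable_funB => //; exact: mE.
Qed.

(** The integral of [E t u + 2 * W u], the larger of the two dominating functions. *)
Let kappa : R := 1 + 2 * \int[gamma]_u W u.

Let kappa_ge1 : 1 <= kappa.
Proof. by rewrite lerDl mulr_ge0// Rintegral_ge0. Qed.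

Let rem_bound t (f : R -> R) M : measurable_fun setT f -> (forall u, `|f u| <= M) ->
  `|\int[gamma]_u (f u * rem t u)| <= M * kappa * Num.min (`|t| ^+ 3) (t ^+ 2).
Proof.
move=> mf fM; have M0 : 0 <= M by exact: le_trans (fM 0).
have irem_of (g : R -> R) : integrableR gamma g -> (forall u, `|rem t u| <= g u) ->
    `|\int[gamma]_u (f u * rem t u)| <= M * \int[gamma]_u g u.
  move=> ig remg.
  have b u : `|f u * rem t u| <= M * g u by rewrite normrM ler_pM.
  have ifr : integrableR gamma (fun u : measurableTypeR R => f u * rem t u).
    apply: (@integrableR_le _ (measurableTypeR R) R gamma _ (fun u => M * g u)) => //.
      exact: measurable_funM.
    exact: integrableRZ.
  rewrite (le_trans (le_normr_Rintegral measurableT ifr))// -RintegralZl//.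
  apply: Rintegral_le => //; [exact: integrableR_abs|exact: integrableRZ].
have i2W := integrableRZ 2 iW.
have t0 := normr_ge0 t.
have tt : t ^+ 2 = `|t| ^+ 2 by rewrite real_normK ?num_real.
rewrite -mulrA; have [t1|t1] := leP `|t| 1.
  apply: le_trans (irem_of _ (integrableRZ _ i2W) (fun u => rem_small u t1)) _.
  rewrite ler_wpM2l// !RintegralZl// (min_idPl _); last by rewrite tt exprS ler_piMl ?exprn_ge0.
  by rewrite mulrC ler_wpM2r ?exprn_ge0// lerDr.
apply: le_trans (irem_of _ (integrableRZ _ (integrableRD (iE t) i2W)) (fun u => rem_large u (ltW t1))) _.
rewrite ler_wpM2l// RintegralZl ?RintegralD ?RintegralZl//; last exact: integrableRD.
rewrite E_mean (min_idPr _); last by rewrite tt; apply: ler_weXn2l => //; exact: ltW.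
by rewrite mulrC.
Qed.

Lemma std_normal_translation (g : R -> R) M t : continuous g -> (forall u, `|g u| <= M) ->
  \int[gamma]_u g (u + t) = \int[gamma]_u (g u * E t u).
Proof.
move=> cg gM; have M0 : 0 <= M by exact: le_trans (gM 0).
have g0 u : 0 <= g u + M by have := gM u; rewrite ler_norml => /andP[]; lra.
have cgM : continuous (fun u => g u + M) by move=> u; apply: cvgD; [exact: cg|exact: cvg_cst].
have cgt : continuous (fun u => g (u + t)).
  move=> u; apply: (continuous_comp (f := fun u : R => u + t)); last exact: cg.
  by apply: cvgD; [exact: cvg_id|exact: cvg_cst].
have mgt := continuous_measurable_fun cgt; have mg := continuous_measurable_fun cg.
have i1 : integrableR gamma (fun u => g (u + t)).
  by apply: (@integrableR_bound _ (measurableTypeR R) R gamma _ M) => //.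
have i2 : integrableR gamma (fun u => g u * E t u).
  apply: (@integrableR_le _ (measurableTypeR R) R gamma _ (fun u => M * E t u)).
  - by apply: measurable_funM => //; exact: mE.
  - exact: integrableRZ.
  - by move=> u; rewrite normrM (ger0_norm (E_ge0 t u)) ler_wpM2r.
have iM := integrableRZ M (iE t).
have H := ge0_std_normal_translation t cgM g0.
have : \int[gamma]_u (g (u + t) + M) = \int[gamma]_u ((g u + M) * E t u).
  by rewrite /Rintegral; congr fine; exact: H.
rewrite RintegralD//; last exact: (integrableR_cst gamma M).
under [RHS]eq_Rintegral do rewrite mulrDl.
by rewrite RintegralD// RintegralZl// E_mean Rintegral_prob_cst mulr1 => /addIr.
Qed.

Lemma integrable_translation_density t : integrableR gamma (E t).
Proof. exact: iE. Qed.

Lemma integrable_std_normal_sqr : integrableR gamma (fun u : R => u ^+ 2).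
Proof.
apply: (@integrableR_le _ (measurableTypeR R) R gamma (fun u => u ^+ 2) W) => //.
move=> u; apply: le_trans (W_ge u); rewrite normrX.
by have := normr_ge0 u; nra.
Qed.

Lemma integrable_std_normal_id : integrableR gamma (fun u : R => u).
Proof.
apply: (@integrableR_le _ (measurableTypeR R) R gamma (fun u => u) W) => //.
by move=> u; apply: le_trans (W_ge u); have := normr_ge0 u; nra.
Qed.

Lemma translation_remainder_bound : exists2 k : R, 0 <= k &
  forall t (f : R -> R) M, measurable_fun setT f -> (forall u, `|f u| <= M) ->
  `|\int[gamma]_u (f u * rem t u)| <= M * k * Num.min (`|t| ^+ 3) (t ^+ 2).
Proof.
by exists kappa; [exact: le_trans ler01 kappa_ge1|move=> t f M; exact: rem_bound].
Qed.

(* Integrating the expansion of the density, whose mass is 1 for every [t]. *)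
Let moment_expansion t :
  `|t * \int[gamma]_u u + t ^+ 2 / 2 * (\int[gamma]_u u ^+ 2 - 1)| <= kappa * `|t| ^+ 3.
Proof.
have i1 := integrable_std_normal_id; have i2 := integrable_std_normal_sqr.
have ic := integrableR_cst gamma 1.
have j1 := integrableRZ t i1; have j2 := integrableRZ (t ^+ 2 / 2) (integrableRB i2 ic).
have j0 := integrableRB (integrable_translation_density t) ic; have j3 := integrableRB j0 j1.
have one (u : R) : `|1| <= 1 :> R by rewrite normr1.
have := rem_bound t (measurable_cst (1 : R)) one.
have -> : \int[gamma]_u (1 * rem t u) = \int[gamma]_u rem t u.
  by apply: eq_Rintegral => u _; rewrite mul1r.
rewrite mul1r => H; apply: le_trans (le_trans H _); last first.
  by rewrite ler_wpM2l ?ge_min ?lexx// (le_trans ler01 kappa_ge1).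
rewrite -normrN le_eqVlt; apply/orP; left; apply/eqP; congr (`| _ |).
rewrite /translation_remainder RintegralB// RintegralB// RintegralB// !RintegralZl//; last exact: integrableRB.
by rewrite RintegralB// E_mean Rintegral_prob_cst; ring.
Qed.

Let kappa_ge0 : 0 <= kappa. Proof. exact: le_trans ler01 kappa_ge1. Qed.

(** The moments are read off the translation density: adding the expansions at [t] and [- t] cancels
    the mean and leaves [|m2 - 1| <= 2 * kappa * t] for every [t > 0]. *)
Let second_moment : \int[gamma]_u u ^+ 2 = 1.
Proof.
apply/eqP; rewrite -subr_eq0 -normr_eq0 eq_le normr_ge0 andbT.
apply/ler_addgt0Pr => e e0; rewrite add0r.
have k0 : 0 < 2 * kappa + 1 by have := kappa_ge0; lra.
pose t := e / (2 * kappa + 1); have t0 : 0 < t by rewrite divr_gt0.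
have te : t * (2 * kappa + 1) = e by rewrite /t divfK// gt_eqF.
have := moment_expansion t; have := moment_expansion (- t).
rewrite normrN sqrrN (gtr0_norm t0).
set m2 := \int[gamma]_u u ^+ 2; set m1 := \int[gamma]_u u => h1 h2.
have h : t ^+ 2 * `|m2 - 1| <= t ^+ 2 * (2 * kappa * t).
  rewrite -{1}(ger0_norm (sqr_ge0 t)) -normrM.
  have -> : t ^+ 2 * (m2 - 1) = (- t * m1 + t ^+ 2 / 2 * (m2 - 1)) + (t * m1 + t ^+ 2 / 2 * (m2 - 1)).
    by field.
  rewrite (le_trans (ler_normD _ _))// (le_trans (lerD h1 h2))//.
  by rewrite le_eqVlt; apply/orP; left; apply/eqP; ring.
rewrite ler_pM2l ?exprn_gt0// in h; lra.
Qed.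

Lemma std_normal_second_moment : (\int[gamma]_u (u ^+ 2)%:E = 1)%E.
Proof.
by have := Rintegral_EFin integrable_std_normal_sqr; rewrite second_moment => <-.
Qed.

Lemma std_normal_mean : \int[gamma]_u u = 0.
Proof.
apply/eqP; rewrite -normr_eq0 eq_le normr_ge0 andbT.
apply/ler_addgt0Pr => e e0; rewrite add0r.
have k0 : 0 < kappa + 1 by have := kappa_ge0; lra.
pose t := Num.min 1 (e / (kappa + 1)); have t0 : 0 < t by rewrite lt_min ltr01 divr_gt0.
have t1 : t <= 1 by rewrite ge_min lexx.
have te : t * (kappa + 1) <= e by rewrite -ler_pdivlMr// ge_min lexx orbT.
have := moment_expansion t; rewrite second_moment subrr mulr0 addr0 normrM (gtr0_norm t0).
rewrite exprS mulrCA ler_pM2l// => h; apply: (le_trans h).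
have := kappa_ge0; nra.
Qed.

End gaussian_translation.

(** * The central limit theorem *)

Lemma Rintegral_dominated_cvg {d} {T : measurableType d} {R : realType}
    (mu : {measure set T -> \bar R}) (f_ : nat -> T -> R) (f g : T -> R) :
  (forall n, measurable_fun setT (f_ n)) -> integrableR mu g ->
  (forall y, f_ ^~ y @ \oo --> f y) -> (forall n y, `|f_ n y| <= g y) ->
  (fun n => \int[mu]_y f_ n y) @ \oo --> \int[mu]_y f y.
Proof.
move=> mf ig ff fg.
have mfE n : measurable_fun setT (fun y => (f_ n y)%:E) by exact/measurable_EFinP.
have mfl : measurable_fun setT (fun y => (f y)%:E).
  apply/measurable_EFinP; apply: (measurable_fun_cvg mf) => y _; exact: ff.
have [] := @dominated_convergence _ _ _ mu setT measurableT
  (fun n y => (f_ n y)%:E) (fun y => (f y)%:E) (EFin \o g) mfE mfl _ ig _.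
- by apply: aeW => y _; apply: cvg_EFin; [exact: nearW|exact: ff].
- by apply: aeW => y n _ /=; rewrite lee_fin; exact: fg.
- by move=> fi _; rewrite -Rintegral_EFin// => /fine_cvg.
Qed.

(** * Trotter operators on smooth test functions *)

Section averaging.
Context {d} {T : measurableType d} {R : realType}.
Variables (P : probability T R) (g : T -> R).
Hypothesis mg : measurable_fun setT g.
Implicit Types (a x : R) (psi : R -> R).

(** Real counterpart of [shift_mean] for bounded test functions, with the scale [a] set apart so
    that it can tend to zero. *)
Definition average a psi x : R := \int[P]_y psi (x + a * g y).

Lemma integrable_average a psi x (M : R) : measurable_fun setT psi ->
  (forall t, `|psi t| <= M) -> integrableR P (fun y => psi (x + a * g y)).
Proof.
move=> mpsi psiM; apply: (@integrableR_bound _ _ _ P _ M) => //.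
apply: (measurableT_comp mpsi); apply: measurable_funD => //.
exact: measurable_funM.
Qed.

Lemma shift_mean_average a psi x (M : R) : measurable_fun setT psi ->
  (forall t, `|psi t| <= M) ->
  shift_mean P (fun y => a * g y) (fun t => (psi t)%:E) x = (average a psi x)%:E.
Proof.
by move=> mpsi psiM; rewrite /average Rintegral_EFin//; exact: integrable_average psiM.
Qed.

Lemma average_bound a psi x (M : R) : measurable_fun setT psi ->
  (forall t, `|psi t| <= M) -> `|average a psi x| <= M.
Proof.
move=> mpsi psiM; have ip := integrable_average a x mpsi psiM.
rewrite (le_trans (le_normr_Rintegral _ ip))// -[leRHS](Rintegral_prob_cst P).
apply: Rintegral_le; [exact: integrableR_abs ip|exact: (integrableR_cst P)|].
by move=> y; exact: psiM.
Qed.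

Lemma measurable_average a psi (M : R) : measurable_fun setT psi ->
  (forall t, `|psi t| <= M) -> measurable_fun setT (average a psi).
Proof.
move=> mpsi psiM.
have mpM : measurable_fun setT (fun t => psi t + M) by exact: measurable_funD.
have pM0 t : 0 <= psi t + M by have := psiM t; rewrite ler_norml => /andP[]; lra.
have E : (fun x => (average a psi x)%:E) =
    (fun x => shift_mean P (fun y => (a * g y)%R) (fun t => (psi t + M)%:E) x - M%:E)%E.
  apply/funext => x.
  rewrite (@shift_mean_average _ (fun t => psi t + M) _ (M + M)) ?mpM//; last first.
    by move=> t; rewrite (le_trans (ler_normD _ _))// lerD// ger0_norm// (le_trans _ (psiM t)).
  rewrite -EFinB; congr EFin; rewrite /average RintegralD//.
  - by rewrite Rintegral_prob_cst; ring.
  - exact: integrable_average psiM.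
  - exact: (integrableR_cst P).
apply/measurable_EFinP; rewrite -/(EFin \o _) in E *; rewrite [X in measurable_fun _ X]E.
apply: emeasurable_funB => //; apply: measurable_shift_mean.
- exact: measurable_funM.
- exact/measurable_EFinP.
- by move=> t; rewrite lee_fin.
Qed.

Lemma average_sub a psi1 psi2 x (M1 M2 : R) :
  measurable_fun setT psi1 -> (forall t, `|psi1 t| <= M1) ->
  measurable_fun setT psi2 -> (forall t, `|psi2 t| <= M2) ->
  average a psi1 x - average a psi2 x = average a (fun t => psi1 t - psi2 t) x.
Proof.
by move=> m1 b1 m2 b2; rewrite /average RintegralB//; exact: integrable_average.
Qed.

End averaging.

Section taylor_class.
Variable R : realType.

(** Uniform second-order expansions with bounded measurable coefficients, a class that averaging
    preserves by mere integration. The minimum of the cubic and the quadratic bound lets variables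
    with two moments in. *)
Definition taylor2 (M K : R) (psi : R -> R) : Prop :=
  [/\ measurable_fun setT psi, forall x, `|psi x| <= M &
   exists D1 D2 : R -> R, [/\ measurable_fun setT D1, measurable_fun setT D2,
     forall x, `|D1 x| <= K, forall x, `|D2 x| <= K &
     forall x h, `|psi (x + h) - psi x - h * D1 x - h ^+ 2 / 2 * D2 x| <=
       K * Num.min (`|h| ^+ 3) (h ^+ 2)]].

Lemma taylor2_K_ge0 M K psi : taylor2 M K psi -> 0 <= K.
Proof. by move=> [_ _ [D1 [_ [_ _ /(_ 0) H _ _]]]]; exact: le_trans H. Qed.

Lemma taylor2_modulus M K psi x h : taylor2 M K psi ->
  `|psi (x + h) - psi x| <= K * `|h| + 2 * K * h ^+ 2.
Proof.
move=> tp; have K0 := taylor2_K_ge0 tp; case: tp => _ _ [D1 [D2 [_ _ b1 b2 H]]].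
have := H x h; set rem := (_ - _ - _ - _) => Hr.
rewrite (_ : psi (x + h) - psi x = rem + h * D1 x + h ^+ 2 / 2 * D2 x); last by rewrite /rem; ring.
rewrite (le_trans (ler_normD _ _))// (le_trans (lerD (ler_normD _ _) (lexx _)))//.
have h1 : `|h * D1 x| <= K * `|h| by rewrite normrM mulrC ler_wpM2r.
have h2 : `|h ^+ 2 / 2 * D2 x| <= K * h ^+ 2.
  rewrite normrM ger0_norm ?divr_ge0 ?sqr_ge0// mulrC.
  apply: ler_pM => //; first by rewrite divr_ge0// sqr_ge0.
  by rewrite ler_pdivrMr// ler_peMr ?sqr_ge0// ler1n.
have h3 : `|rem| <= K * h ^+ 2.
  by apply: le_trans Hr _; apply: ler_wpM2l => //; rewrite ge_min lexx orbT.
by lra.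
Qed.

Lemma taylor2_continuous M K psi : taylor2 M K psi -> continuous psi.
Proof.
move=> tp x; have K0 := taylor2_K_ge0 tp.
apply/cvgrPdist_le => e e0.
have k0 : 0 < 3 * K + 1 by lra.
have d0 : 0 < Num.min 1 (e / (3 * K + 1)) by rewrite lt_min ltr01 divr_gt0.
have : \forall y \near x, ball x (Num.min 1 (e / (3 * K + 1))) y by exact: nbhsx_ballx.
apply: filterS => y; rewrite /ball /= lt_min => /andP[y1 y2].
rewrite distrC in y1 y2; rewrite distrC.
have -> : psi y = psi (x + (y - x)) by rewrite subrKC.
apply: le_trans (taylor2_modulus x (y - x) tp) _.
have hh : (y - x) ^+ 2 <= `|y - x|.
  by rewrite -[leLHS]real_normK ?num_real// expr2 ler_piMl// ltW.
rewrite ltr_pdivlMr// in y2.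
have := ler_wpM2l K0 hh; have := normr_ge0 (y - x); nra.
Qed.

(** The expansion is integrated with its coefficients. Neither constant grows, so the one-step error
    stays the same at every stage of the telescoping. *)
Lemma taylor2_average {d} {T : measurableType d} (P : probability T R)
    (g : T -> R) a M K psi : measurable_fun setT g ->
  taylor2 M K psi -> taylor2 M K (average P g a psi).
Proof.
move=> mg [mpsi psiM [D1 [D2 [m1 m2 b1 b2 H]]]]; split.
- exact: measurable_average psiM.
- by move=> x; exact: average_bound.
exists (average P g a D1), (average P g a D2); split.
- exact: measurable_average b1.
- exact: measurable_average b2.
- by move=> x; exact: average_bound.
- by move=> x; exact: average_bound.
move=> x h.
have i0 y := integrable_average P mg a y mpsi psiM.
have i1 y := integrable_average P mg a y m1 b1.
have i2 y := integrable_average P mg a y m2 b2.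
have i3 : integrableR P (fun y => psi (x + h + a * g y) - psi (x + a * g y)) by exact: integrableRB.
have i4 : integrableR P (fun y => psi (x + h + a * g y) - psi (x + a * g y) -
    h * D1 (x + a * g y)) by apply: integrableRB => //; exact: integrableRZ.
have i5 : integrableR P (fun y => psi (x + h + a * g y) - psi (x + a * g y) -
    h * D1 (x + a * g y) - h ^+ 2 / 2 * D2 (x + a * g y)).
  by apply: integrableRB => //; exact: integrableRZ.
have -> : average P g a psi (x + h) - average P g a psi x - h * average P g a D1 x -
    h ^+ 2 / 2 * average P g a D2 x =
  \int[P]_y (psi (x + h + a * g y) - psi (x + a * g y) -
    h * D1 (x + a * g y) - h ^+ 2 / 2 * D2 (x + a * g y)).
  by rewrite RintegralB ?RintegralB ?RintegralZl//; exact: integrableRZ.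
rewrite (le_trans (le_normr_Rintegral _ i5))//.
rewrite -[leRHS](Rintegral_prob_cst P).
apply: Rintegral_le; [exact: integrableR_abs i5|exact: (integrableR_cst P)|].
by move=> y; rewrite (addrAC x h); exact: H.
Qed.

Lemma taylor2_iter_average {d} {T : measurableType d} (P : probability T R)
    (g : T -> R) a M K psi n : measurable_fun setT g ->
  taylor2 M K psi -> taylor2 M K (iter n (average P g a) psi).
Proof. by move=> mg tp; elim: n => // n IH; exact: taylor2_average. Qed.

(** The Lindeberg quantity: a third moment truncated to a second one where the scaled variable
    exceeds 1. *)
Definition third_moment_trunc {d} {T : measurableType d} (P : probability T R)
  (g : T -> R) (a : R) : R := \int[P]_y Num.min (`|a * g y| ^+ 3) ((a * g y) ^+ 2).

Section one_step.
Context {d} {T : measurableType d}.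
Variables (P : probability T R) (g : T -> R) (s2 : R).
Hypothesis mg : measurable_fun setT g.
Hypothesis ig2 : integrableR P (fun y => g y ^+ 2).
Hypothesis g_mean : \int[P]_y g y = 0.
Hypothesis g_var : \int[P]_y g y ^+ 2 = s2.

Lemma integrable_of_sqr : integrableR P g.
Proof.
apply: (@integrableR_le _ _ _ P g (fun y => 1 + g y ^+ 2)) => //.
  by apply: integrableRD => //; exact: (integrableR_cst P).
by move=> y; rewrite ler_norml; apply/andP; split; nra.
Qed.

Let ig := integrable_of_sqr.

Lemma integrable_third_moment a :
  integrableR P (fun y => Num.min (`|a * g y| ^+ 3) ((a * g y) ^+ 2)).
Proof.
apply: (@integrableR_le _ _ _ P _ (fun y => a ^+ 2 * g y ^+ 2)).
- apply: measurable_minr; apply: measurable_funX.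
    by apply: measurableT_comp => //; exact: measurable_funM.
  exact: measurable_funM.
- exact: integrableRZ.
- move=> y; have h0 : 0 <= Num.min (`|a * g y| ^+ 3) ((a * g y) ^+ 2).
    by rewrite le_min exprn_ge0 ?normr_ge0// sqr_ge0.
  by rewrite (ger0_norm h0) ge_min exprMn lexx orbT.
Qed.

(** Integrating the expansion kills the first-order term, as [g] is centred, and turns the
    second-order one into the variance. *)
Lemma average_one_step (M K : R) (psi D1 D2 : R -> R) a x :
  measurable_fun setT psi -> (forall x, `|psi x| <= M) ->
  (forall h, `|psi (x + h) - psi x - h * D1 x - h ^+ 2 / 2 * D2 x| <=
       K * Num.min (`|h| ^+ 3) (h ^+ 2)) ->
  `|average P g a psi x - psi x - a ^+ 2 * s2 / 2 * D2 x| <=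
    K * third_moment_trunc P g a.
Proof.
move=> mpsi psiM H.
have i0 := integrable_average P mg a x mpsi psiM.
have c0 := integrableR_cst P (psi x).
have i1 : integrableR P (fun y => psi (x + a * g y) - psi x) by exact: integrableRB.
have i2 : integrableR P (fun y => a * D1 x * g y) by exact: integrableRZ.
have i3 : integrableR P (fun y => a ^+ 2 / 2 * D2 x * g y ^+ 2) by exact: integrableRZ.
have i4 : integrableR P (fun y => psi (x + a * g y) - psi x - a * D1 x * g y).
  exact: integrableRB.
have i5 : integrableR P (fun y => psi (x + a * g y) - psi x - a * D1 x * g y -
  a ^+ 2 / 2 * D2 x * g y ^+ 2) by exact: integrableRB.
have -> : average P g a psi x - psi x - a ^+ 2 * s2 / 2 * D2 x =
    \int[P]_y (psi (x + a * g y) - psi x - a * D1 x * g y -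
  a ^+ 2 / 2 * D2 x * g y ^+ 2).
  rewrite RintegralB// RintegralB// RintegralB// !RintegralZl//.
  by rewrite g_mean g_var Rintegral_prob_cst /average; field.
rewrite (le_trans (le_normr_Rintegral _ i5))//.
rewrite /third_moment_trunc -RintegralZl//; last exact: integrable_third_moment.
apply: Rintegral_le; [exact: integrableR_abs i5| |].
  by apply: integrableRZ; exact: integrable_third_moment.
move=> y; have := H (a * g y).
by rewrite (_ : _ - (a * g y) * D1 x - _ = psi (x + a * g y) - psi x - a * D1 x * g y -
  a ^+ 2 / 2 * D2 x * g y ^+ 2)//; field.
Qed.

End one_step.

Local Notation gamma := (std_normal R).
Local Notation mid := (@measurable_id _ (measurableTypeR R) setT).

Lemma gaussian_semigroup M psi (a b c x : R) : 0 <= a -> 0 <= b -> 0 <= c ->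
  c ^+ 2 = a ^+ 2 + b ^+ 2 -> continuous psi -> (forall t, `|psi t| <= M) ->
  average gamma id a (average gamma id b psi) x = average gamma id c psi x.
Proof.
move=> a0 b0 c0 cE cpsi psiM; have mpsi := continuous_measurable_fun cpsi.
pose f t := psi t + M.
have f0 t : 0 <= f t by have := psiM t; rewrite /f ler_norml => /andP[]; lra.
have mf : measurable_fun setT f by exact: measurable_funD.
have fM t : `|f t| <= M + M.
  by rewrite (le_trans (ler_normD _ _))// lerD// ger0_norm// (le_trans _ (psiM t)).
have cf : continuous f by move=> t; apply: cvgD; [exact: cpsi|exact: cvg_cst].
have avM k t : average gamma id k f t = average gamma id k psi t + M.
  rewrite /average RintegralD//; [by rewrite Rintegral_prob_cst| |exact: (integrableR_cst gamma)].
  exact: (integrable_average gamma mid k t mpsi psiM).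
have := std_normal_convolution x a0 b0 c0 cE cf f0.
have inner t : (\int[gamma]_v (f (t + b * v))%:E)%E = (average gamma id b f t)%:E.
  by rewrite /average Rintegral_EFin//; exact: (integrable_average gamma mid b t mf fM).
under eq_integral do rewrite inner.
have mbf := measurable_average gamma mid b mf fM.
have bfM t : `|average gamma id b f t| <= M + M by exact: average_bound.
rewrite -!Rintegral_EFin; last 2 first.
- exact: (integrable_average gamma mid c x mf fM).
- exact: (integrable_average gamma mid a x mbf bfM).
move=> [] H; have : average gamma id a (average gamma id b f) x = average gamma id c f x.
  exact: H.
rewrite avM.
have -> : average gamma id b f = fun t => average gamma id b psi t + M.
  by apply/funext => t; exact: avM.
rewrite {1}/average RintegralD//; last 2 first.
- have mbp := measurable_average gamma mid b mpsi psiM.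
  have bpM t : `|average gamma id b psi t| <= M by exact: average_bound.
  exact: (integrable_average gamma mid a x mbp bpM).
- exact: (integrableR_cst gamma).
by rewrite Rintegral_prob_cst => /addIr.
Qed.

(* Trotter's telescoping: [T^n - G^n] is controlled by [n] times the one-step error
   because [T] is a contraction and the Taylor class is stable under averaging. *)
Lemma lindeberg {d} {T : measurableType d} (P : probability T R) (g : T -> R)
    (s2 : R) M K psi (a s : R) n x :
  measurable_fun setT g -> integrableR P (fun y => g y ^+ 2) ->
  \int[P]_y g y = 0 -> \int[P]_y g y ^+ 2 = s2 ->
  0 <= a -> 0 <= s -> s ^+ 2 = s2 -> taylor2 M K psi ->
  `|iter n (average P g a) psi x - average gamma id (a * s * Num.sqrt n%:R) psi x| <=
  n%:R * (K * (third_moment_trunc P g a + third_moment_trunc gamma id (a * s))).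
Proof.
move=> mg ig2 g_mean g_var a0 s0 ss tp.
elim: n x => [|n IH] x.
  rewrite mul0r sqrtr0 mulr0 /= /average.
  under eq_Rintegral do rewrite mul0r addr0.
  by rewrite Rintegral_prob_cst subrr normr0.
set G := average (std_normal R) id.
set E := K * _ in IH *.
pose f := iter n (average P g a) psi.
pose gn := G (a * s * Num.sqrt n%:R) psi.
have tf : taylor2 M K f by exact: taylor2_iter_average.
have tg : taylor2 M K gn by exact: taylor2_average.
have semigroup : G (a * s * Num.sqrt n.+1%:R) psi x = G (a * s) gn x.
  apply/esym; have [_ psiM _] := tp.
  apply: (gaussian_semigroup _ _ _ _ _ (taylor2_continuous tp) psiM).
  - exact: mulr_ge0.
  - by rewrite !mulr_ge0// sqrtr_ge0.
  - by rewrite !mulr_ge0// sqrtr_ge0.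
  - have nS : n.+1%:R = n%:R + 1 :> R by rewrite natr1.
    by rewrite !exprMn !sqr_sqrtr// nS; ring.
rewrite iterS -/f semigroup.
have [mf fM _] := tf; have [mgn gM [D1 [D2 [m1 m2 b1 b2 H]]]] := tg.
(* A contraction applied to the previous error, plus two one-step errors whose second-order terms
   cancel because [s ^+ 2 = s2]. *)
have -> : average P g a f x - G (a * s) gn x =
  average P g a (fun t => f t - gn t) x + (average P g a gn x - gn x - a ^+ 2 * s2 / 2 * D2 x)
  - (G (a * s) gn x - gn x - (a * s) ^+ 2 * 1 / 2 * D2 x).
  by rewrite -(average_sub P mg a x mf fM mgn gM) exprMn ss; ring.
have -> : n.+1%:R * E = n%:R * E + E by rewrite -natr1 mulrDl mul1r.
rewrite (le_trans (ler_normB _ _))//.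
rewrite (le_trans (lerD (ler_normD _ _) (lexx _)))// -addrA; apply: lerD.
  apply: average_bound => //; exact: measurable_funB.
rewrite /E mulrDr; apply: lerD.
  exact: (average_one_step mg ig2 g_mean g_var a mgn gM (H x)).
apply: (@average_one_step _ _ gamma id 1 mid _ _ _ M K gn D1 D2 (a * s) x) => //.
- exact: integrable_std_normal_sqr.
- exact: std_normal_mean.
- by rewrite /Rintegral std_normal_second_moment.
Qed.

End taylor_class.

Section third_moment_small.
Context {d} {T : measurableType d} {R : realType}.
Variables (P : probability T R) (g : T -> R).
Hypothesis mg : measurable_fun setT g.
Hypothesis ig2 : integrableR P (fun y => g y ^+ 2).

(** Taking [a k ^+ 2] out leaves the convergent factor [n * a ^+ 2] and the integral of
    [g ^+ 2 * min (|a * g|, 1)], which vanishes by dominated convergence. *)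
Lemma third_moment_trunc_cvg (a : nat -> R) (n : nat -> nat) (l : R) :
  a @ \oo --> 0 -> (fun k => (n k)%:R * a k ^+ 2) @ \oo --> l ->
  (fun k => (n k)%:R * third_moment_trunc P g (a k)) @ \oo --> 0.
Proof.
move=> a0 na.
pose r k y := g y ^+ 2 * Num.min `|a k * g y| 1.
have mr k : measurable_fun setT (r k).
  apply: measurable_funM; first exact: measurable_funX.
  by apply: measurable_minr => //; apply: measurableT_comp => //; exact: measurable_funM.
have min0 (t : R) : 0 <= Num.min `|t| 1 by rewrite le_min normr_ge0 ler01.
have r0 k y : 0 <= r k y by apply: mulr_ge0 => //; exact: sqr_ge0.
have r1 k y : r k y <= g y ^+ 2 by rewrite /r ler_piMr ?sqr_ge0// ge_min lexx orbT.
have E k : (n k)%:R * third_moment_trunc P g (a k) =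
    ((n k)%:R * a k ^+ 2) * \int[P]_y r k y.
  have ir : integrableR P (r k).
    apply: (@integrableR_le _ _ _ P _ (fun y => g y ^+ 2)) => // y.
    by rewrite ger0_norm.
  rewrite -mulrA; congr (_ * _); rewrite -(RintegralZl _ measurableT ir).
  rewrite /third_moment_trunc; apply: eq_Rintegral => y _.
  have -> : a k ^+ 2 * r k y = (a k * g y) ^+ 2 * Num.min `|a k * g y| 1 by rewrite /r mulrA -exprMn.
  rewrite minr_pMr ?sqr_ge0// mulr1 exprSr.
  by rewrite real_normK ?num_real.
suff H : (fun k => \int[P]_y r k y) @ \oo --> (0 : R).
  by rewrite (funext E) -(mulr0 l); exact: cvgM.
have -> : (0 : R) = \int[P]_y (fun=> 0) y by rewrite Rintegral_prob_cst.
apply: (Rintegral_dominated_cvg mr ig2) => [y|k y].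
  have : (fun k => g y ^+ 2 * `|a k * g y|) @ \oo --> 0.
    rewrite -(mulr0 (g y ^+ 2)); apply: cvgM; first exact: cvg_cst.
    rewrite -(normr0 R) -(mul0r (g y)); apply: cvg_norm.
    by apply: cvgM => //; exact: cvg_cst.
  apply: (@squeeze_cvgr _ _ _ _ (fun=> 0)); last exact: cvg_cst.
  apply: nearW => k; rewrite r0 /=.
  by rewrite ler_wpM2l ?sqr_ge0// ge_min lexx.
by rewrite ger0_norm.
Qed.

End third_moment_small.

(** * Smoothing and approximation of test functions *)

Section gaussian_smoothing.
Variable R : realType.
Local Notation gamma := (std_normal R).
Local Notation mid := (@measurable_id _ (measurableTypeR R) setT).
Local Notation E := (@translation_density R).
Local Notation rem := (@translation_remainder R).

(** Moving [x] by [h = dl * t] amounts to inserting the density [E t], so its expansion in [t] is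
    that of the smoothed function. The coefficients are averages of [f] against the Hermite
    polynomials [u] and [u ^+ 2 - 1]. *)
Lemma gaussian_smoothing_taylor2 (f : R -> R) M dl : 0 < dl -> continuous f ->
  (forall t, `|f t| <= M) -> exists K, taylor2 M K (average gamma id dl f).
Proof.
move=> dl0 cf fM; have M0 : 0 <= M by exact: le_trans (fM 0).
have mf := continuous_measurable_fun cf.
have cfx x : continuous (fun u => f (x + dl * u)).
  move=> u; apply: (continuous_comp (f := fun u : R => x + dl * u)); last exact: cf.
  by apply: cvgD; [exact: cvg_cst|apply: cvgM; [exact: cvg_cst|exact: cvg_id]].
have mfx x : measurable_fun setT (fun u => f (x + dl * u)) by exact: continuous_measurable_fun.
pose D (g : R -> R) x := \int[gamma]_u (f (x + dl * u) * g u).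
have iD (g : measurableTypeR R -> R) x : integrableR gamma g ->
    integrableR gamma (fun u => f (x + dl * u) * g u).
  move=> ig; apply: (@integrableR_le _ (measurableTypeR R) R gamma _ (fun u => M * `|g u|)).
  - by apply: measurable_funM; [exact: mfx|exact: integrableR_meas ig].
  - by apply: integrableRZ; exact: integrableR_abs.
  - by move=> u; rewrite normrM ler_wpM2r.
have bD (g : measurableTypeR R -> R) x : integrableR gamma g ->
    `|D g x| <= M * \int[gamma]_u `|g u|.
  move=> ig; have ia := integrableR_abs ig.
  rewrite (le_trans (le_normr_Rintegral measurableT (iD g x ig)))// -RintegralZl//.
  apply: Rintegral_le; [exact: integrableR_abs (iD g x ig)|exact: integrableRZ|].
  by move=> u; rewrite normrM ler_wpM2r.
have mD (g : measurableTypeR R -> R) : integrableR gamma g ->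
    measurable_fun setT (D g : measurableTypeR R -> R).
  move=> ig; have mg := integrableR_meas ig.
  have mpos (k : measurableTypeR R -> R) : integrableR gamma k -> (forall u, 0 <= k u) ->
      measurable_fun setT (D k : measurableTypeR R -> R).
    move=> ik k0; have mk := integrableR_meas ik.
    pose F (u : measurableTypeR R * measurableTypeR R) : \bar R :=
      ((f (u.1 + dl * u.2) + M) * k u.2)%:E.
    have mF : measurable_fun setT F.
      apply/measurable_EFinP; apply: measurable_funM; last exact: (measurableT_comp mk).
      apply: measurable_funD => //; apply: (measurableT_comp mf).
      by apply: measurable_funD => //; exact: measurable_funM.
    have F0 u : (0 <= F u)%E.
      rewrite lee_fin mulr_ge0//; have := fM (u.1 + dl * u.2).
      by rewrite ler_norml => /andP[]; lra.
    have := @measurable_fun_fubini_tonelli_F _ _ _ _ R gamma F mF.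
    move=> mFF; apply/measurable_EFinP.
    have -> : EFin \o D k = fun x => (fubini_F gamma F x - (M * \int[gamma]_u k u)%:E)%E.
      apply/funext => x /=; rewrite -RintegralZl// /D.
      have iM := integrableRZ M ik; have ifk := iD k x ik.
      have -> : fubini_F gamma F x = (\int[gamma]_u (f (x + dl * u) * k u + M * k u))%:E.
        rewrite Rintegral_EFin; last exact: integrableRD.
        by apply: eq_integral => u _; rewrite /F mulrDl.
      by rewrite RintegralD// -EFinB addrK.
    by apply: emeasurable_funB => //; exact: mFF.
  have ip : integrableR gamma (fun u => Num.max (g u) 0).
    apply: (@integrableR_le _ (measurableTypeR R) R gamma _ (fun u => `|g u|)).
    - exact: measurable_maxr.
    - exact: integrableR_abs.
    - by move=> u; rewrite ger0_norm ?le_max ?lexx ?orbT// ge_max normr_ge0 ler_norm.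
  have im : integrableR gamma (fun u => Num.max (- g u) 0).
    apply: (@integrableR_le _ (measurableTypeR R) R gamma _ (fun u => `|g u|)).
    - by apply: measurable_maxr => //; exact: measurableT_comp.
    - exact: integrableR_abs.
    - by move=> u; rewrite ger0_norm ?le_max ?lexx ?orbT// ge_max normr_ge0 ler_normr lexx orbT.
  have -> : D g = fun x => D (fun u => Num.max (g u) 0) x - D (fun u => Num.max (- g u) 0) x.
    apply/funext => x; rewrite /D -RintegralB//; [|exact: iD|exact: iD].
    apply: eq_Rintegral => u _; rewrite -mulrBr; congr (_ * _).
    have [g0|g0] := leP 0 (g u).
      by rewrite (max_idPr _) ?subr0// lerNl oppr0.
    by rewrite (max_idPl _) ?sub0r ?opprK// lerNr oppr0 ltW.
  apply: measurable_funB; apply: mpos => //.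
    by move=> u; rewrite le_max lexx orbT.
  by move=> u; rewrite le_max lexx orbT.
have [kappa k0 rem_bound] := translation_remainder_bound R.
have i1 := integrable_std_normal_id R.
have i2 : integrableR gamma (fun u : measurableTypeR R => u ^+ 2 - 1).
  by apply: integrableRB; [exact: integrable_std_normal_sqr|exact: (integrableR_cst gamma 1)].
pose B1 := \int[gamma]_u `|u|; pose B2 := \int[gamma]_u `|u ^+ 2 - 1|.
have B10 : 0 <= B1 by apply: Rintegral_ge0.
have B20 : 0 <= B2 by apply: Rintegral_ge0.
pose e := dl^-1; have e0 : 0 < e by rewrite invr_gt0.
(* One constant for the remainder and both coefficients; the powers of [e] convert [t] back to
   [h]. *)
pose K := M * kappa * (e ^+ 3 + e ^+ 2) + e * (M * B1) + e ^+ 2 * (M * B2).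
have s1 : 0 <= M * kappa * (e ^+ 3 + e ^+ 2).
  by rewrite !mulr_ge0// addr_ge0 ?exprn_ge0// ltW.
have s2 : 0 <= e * (M * B1) by rewrite !mulr_ge0// ltW.
have s3 : 0 <= e ^+ 2 * (M * B2) by rewrite !mulr_ge0// ltW.
exists K; split; [exact: (measurable_average gamma mid dl mf fM)|by move=> x; exact: average_bound|].
exists (fun x => e * D id x), (fun x => e ^+ 2 * D (fun u => u ^+ 2 - 1) x); split.
- by apply: measurable_funM => //; exact: mD.
- by apply: measurable_funM => //; exact: mD.
- move=> x; rewrite normrM gtr0_norm//.
  by apply: le_trans (ler_wpM2l (ltW e0) (bD id x i1)) _; rewrite /K -/B1; lra.
- move=> x; rewrite normrM ger0_norm ?sqr_ge0//.
  by apply: le_trans (ler_wpM2l (sqr_ge0 e) (bD _ x i2)) _; rewrite /K -/B2; lra.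
move=> x h; pose t := h * e.
have ht : h = dl * t by rewrite /t /e mulrCA mulfV ?mulr1// gt_eqF.
have -> : average gamma id dl f (x + h) - average gamma id dl f x - h * (e * D id x) -
    h ^+ 2 / 2 * (e ^+ 2 * D (fun u => u ^+ 2 - 1) x) = \int[gamma]_u (f (x + dl * u) * rem t u).
  have -> : average gamma id dl f (x + h) = D (E t) x.
    rewrite /D -(std_normal_translation t (cfx x) (fun u => fM _)) /average.
    by apply: eq_Rintegral => u _; rewrite {1}ht mulrDr addrA addrAC.
  have -> : \int[gamma]_u (f (x + dl * u) * rem t u) =
    \int[gamma]_u (f (x + dl * u) * E t u - f (x + dl * u) - t * (f (x + dl * u) * u) -
      t ^+ 2 / 2 * (f (x + dl * u) * (u ^+ 2 - 1))).
    by apply: eq_Rintegral => u _; rewrite /translation_remainder; ring.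
  have j0 := iD (E t) x (integrable_translation_density t); have j1 := iD id x i1; have j2 := iD _ x i2.
  have j3 := integrable_average gamma mid dl x mf fM.
  have l1 := integrableRZ t j1; have l2 := integrableRZ (t ^+ 2 / 2) j2.
  have l3 := integrableRB j0 j3; have l4 := integrableRB l3 l1.
  rewrite RintegralB// RintegralB// RintegralB// !RintegralZl//.
  by rewrite /t /D /average; field.
apply: le_trans (rem_bound t _ M (mfx x) (fun u => fM _)) _.
have hn3 := exprn_ge0 3 (normr_ge0 h); have hn2 := sqr_ge0 h.
have te3 : `|t| ^+ 3 = e ^+ 3 * `|h| ^+ 3 by rewrite /t normrM (gtr0_norm e0) exprMn mulrC.
have te2 : t ^+ 2 = e ^+ 2 * h ^+ 2 by rewrite /t exprMn mulrC.
have min0 : 0 <= Num.min (`|h| ^+ 3) (h ^+ 2) by rewrite le_min hn3 hn2.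
have e2 := sqr_ge0 e; have e3 : 0 <= e ^+ 3 by rewrite exprn_ge0// ltW.
apply: le_trans (_ : _ <= M * kappa * ((e ^+ 3 + e ^+ 2) * Num.min (`|h| ^+ 3) (h ^+ 2))) _.
  rewrite ler_wpM2l ?mulr_ge0// te3 te2.
  have [hh|hh] := leP (`|h| ^+ 3) (h ^+ 2); rewrite ge_min; apply/orP; [left|right];
    by rewrite ler_wpM2r// ?lerDl ?lerDr.
rewrite mulrA ler_wpM2r// /K; lra.
Qed.

End gaussian_smoothing.

Section smooth_approximation.
Variable R : realType.
Local Notation gamma := (std_normal R).
Local Notation mid := (@measurable_id _ (measurableTypeR R) setT).

(** A bounded continuous function may fail to be uniformly continuous on the line. The weight in [x]
    takes care of large [x], the term [C * h ^+ 2] of large [h], and uniform continuity on a segment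
    of the rest; bounded second moments control both weights. *)
Lemma continuous_bounded_modulus (f : R -> R) M e : continuous f ->
  (forall t, `|f t| <= M) -> 0 < e ->
  exists C, forall x h, `|f (x + h) - f x| <= e * (1 + x ^+ 2) + C * h ^+ 2.
Proof.
move=> cf fM e0; have M0 : 0 <= M by exact: le_trans (fM 0).
(* For [|x| > L >= 1] one has [x ^+ 2 >= L], and [e * L] exceeds the trivial bound [2 * M]. *)
pose L := 1 + 2 * M / e.
have L1 : 1 <= L by rewrite lerDl divr_ge0 ?mulr_ge0// ltW.
have fM2 x h : `|f (x + h) - f x| <= 2 * M.
  by rewrite (le_trans (ler_normB _ _))// mulr2n mulrDl mul1r lerD.
have ncov : near_covering (`[- L, L] : set R).
  by apply/compact_near_coveringP; exact: segment_compact.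
have unif : \forall eta \near (0 : R)^'+, `[- L, L]%classic `<=`
    (fun x => forall h, `|h| < eta -> `|f (x + h) - f x| <= e).
  apply: ncov => x _.
  have e2 : 0 < e / 2 by rewrite divr_gt0.
  have /cvgrPdist_le/(_ _ e2) := cf x; rewrite -nbhs_ballE => -[r /= r0 Hr].
  have r2 : 0 < r / 2 by rewrite divr_gt0.
  exists (ball x (r / 2), `]0, r / 2[%classic); first split => /=.
  - exact: nbhsx_ballx.
  - by apply: filterS2 (nbhs_right_gt 0) (nbhs_right_lt r2) => t /= t0 tr; rewrite in_itv /= t0 tr.
  move=> [y eta] /= [xy]; rewrite in_itv /= => /andP[_ eta_r] h heta.
  have fy : `|f x - f y| <= e / 2.
    by apply: Hr => /=; rewrite /ball /= in xy *; apply: lt_le_trans xy _; lra.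
  have fyh : `|f x - f (y + h)| <= e / 2.
    apply: Hr => /=; rewrite /ball /= in xy *.
    rewrite opprD addrA (le_lt_trans (ler_normB _ _))//; lra.
  have -> : f (y + h) - f y = (f x - f y) - (f x - f (y + h)) by ring.
  by rewrite (le_trans (ler_normB _ _))//; lra.
have [eta [eta0 Heta]] : exists eta, 0 < eta /\
    forall x, - L <= x <= L -> forall h, `|h| < eta -> `|f (x + h) - f x| <= e.
  have [eta [eta0 Heta]] := filter_ex (filterI (nbhs_right_gt (0 : R)) unif).
  by exists eta; split=> // x xL; apply: Heta; rewrite /= in_itv.
exists (2 * M / eta ^+ 2) => x h.
have c0 : 0 <= 2 * M / eta ^+ 2 * h ^+ 2.
  by rewrite mulr_ge0 ?sqr_ge0// divr_ge0 ?sqr_ge0// mulr_ge0.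
have [heta|heta] := ltP `|h| eta.
  have [xL|Lx] := leP `|x| L.
    apply: (le_trans (Heta x _ h heta)); first by rewrite -ler_norml.
    by have := mulr_ge0 (ltW e0) (sqr_ge0 x); lra.
  apply: (le_trans (fM2 x h)).
  have xL2 : L <= x ^+ 2.
    rewrite -(real_normK (num_real x)) expr2.
    by apply: le_trans (ltW Lx) _; rewrite ler_peMl// (le_trans L1)// ltW.
  have := ler_wpM2l (ltW e0) xL2.
  by rewrite /L mulrDr mulr1 mulrCA mulfV ?gt_eqF// mulr1; lra.
apply: (le_trans (fM2 x h)).
have : 2 * M <= 2 * M / eta ^+ 2 * h ^+ 2.
  rewrite -mulrA ler_peMr ?mulr_ge0// mulrC ler_pdivlMr ?exprn_gt0// mul1r.
  by rewrite -(real_normK (num_real h)) lerXn2r ?nnegrE// ltW.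
by have := mulr_ge0 (ltW e0) (sqr_ge0 x); lra.
Qed.

Lemma smooth_approx (f : R -> R) M e : continuous f -> (forall t, `|f t| <= M) -> 0 < e ->
  exists K psi, taylor2 M K psi /\ forall x, `|f x - psi x| <= e * (1 + x ^+ 2).
Proof.
move=> cf fM e0; have e2 : 0 < e / 2 by rewrite divr_gt0.
have [C fC] := continuous_bounded_modulus cf fM e2.
(* Makes the Gaussian mean of [C * (dl * u) ^+ 2] at most [e / 2]; [C] carries no sign. *)
pose dl := Num.sqrt (e / 2 / (1 + `|C|)).
have C1 : 0 < 1 + `|C| by rewrite ltr_pwDl.
have dl0 : 0 < dl by rewrite sqrtr_gt0 divr_gt0.
have dlC : C * dl ^+ 2 <= e / 2.
  rewrite sqr_sqrtr; last by rewrite divr_ge0// ltW.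
  rewrite mulrCA ler_piMr ?(ltW e2)//.
  by rewrite ler_pdivrMr// mul1r (le_trans (ler_norm _))// lerDr.
have [K tK] := gaussian_smoothing_taylor2 dl0 cf fM.
exists K, (average gamma id dl f); split=> // x.
have mf := continuous_measurable_fun cf.
have i0 := integrable_average gamma mid dl x mf fM.
have ic := integrableR_cst gamma (f x).
have id0 := integrableRB i0 ic.
have -> : f x - average gamma id dl f x = - \int[gamma]_u (f (x + dl * u) - f x).
  by rewrite RintegralB// Rintegral_prob_cst opprB.
rewrite normrN (le_trans (le_normr_Rintegral measurableT id0))//.
have is2 := integrableRZ (C * dl ^+ 2) (integrable_std_normal_sqr R).
have ib := integrableRD (integrableR_cst gamma (e / 2 * (1 + x ^+ 2))) is2.
apply: (le_trans (Rintegral_le (integrableR_abs id0) ib _)).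
  by move=> u; have := fC x (dl * u); rewrite exprMn mulrA.
rewrite RintegralD//; last exact: (integrableR_cst gamma (e / 2 * (1 + x ^+ 2))).
rewrite Rintegral_prob_cst RintegralZl//; last exact: integrable_std_normal_sqr.
have -> : \int[gamma]_u u ^+ 2 = 1 by rewrite -[RHS]/(fine 1%E); congr fine; exact: std_normal_second_moment.
have := sqr_ge0 x; nra.
Qed.

End smooth_approximation.

Section second_moment.
Context {dT} {T : measurableType dT} {R : realType}.

(** The operator preserves the family [t ^+ 2 + c] and adds the variance to [c], the cross term
    vanishing; iteration computes second moments of sums. *)
Lemma shift_mean_sqr (P : probability T R) (g : T -> R) (v c x : R) :
  measurable_fun setT g -> integrableR P (fun y => g y ^+ 2) ->
  \int[P]_y g y = 0 -> \int[P]_y g y ^+ 2 = v ->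
  shift_mean P g (fun t => (t ^+ 2 + c)%:E) x = (x ^+ 2 + (c + v))%:E.
Proof.
move=> mg ig2 g0 gv; have ig := integrable_of_sqr mg ig2.
have ic := integrableR_cst P (x ^+ 2 + c); have i2 := integrableRZ (2 * x) ig.
have i3 := integrableRD ic i2; have i4 := integrableRD i3 ig2.
transitivity (\int[P]_y (x ^+ 2 + c + 2 * x * g y + g y ^+ 2))%:E.
  by rewrite Rintegral_EFin//; apply: eq_integral => y _; congr EFin; ring.
congr EFin; rewrite RintegralD// RintegralD// RintegralZl// g0 gv Rintegral_prob_cst.
by ring.
Qed.

Context {dO} {O : measurableType dO}.
Variables (I : eqType) (Pr : probability O R) (Z : I -> O -> T).
Hypothesis mZ : forall i, measurable_fun setT (Z i).
Hypothesis indep : mutually_independent Pr Z.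
Variables (Q : I -> probability T R) (phi : I -> T -> R) (v : I -> R).
Hypothesis mphi : forall i, measurable_fun setT (phi i).
Hypothesis ZQ : forall i A, measurable A -> Pr (Z i @^-1` A) = Q i A.
Hypothesis phi2 : forall i, integrableR (Q i) (fun y => phi i y ^+ 2).
Hypothesis phi_mean : forall i, \int[Q i]_y phi i y = 0.
Hypothesis phi_var : forall i, \int[Q i]_y phi i y ^+ 2 = v i.

Lemma independent_sum_sqr (s : seq I) : uniq s ->
  (\int[Pr]_w ((\sum_(i <- s) phi i (Z i w)) ^+ 2)%:E = (\sum_(i <- s) v i)%:E)%E.
Proof.
move=> us; have E c t : foldl (fun g i => shift_mean (Q i) (phi i) g)
    (fun t => (t ^+ 2 + c)%:E) s t = (t ^+ 2 + (c + \sum_(i <- s) v i))%:E.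
  elim: s c {us} => [|j s IH] c; first by rewrite big_nil addr0.
  rewrite /= big_cons (addrA c) -IH; congr (foldl _ _ s t).
  by apply/funext => x; exact: shift_mean_sqr.
have sq0 (t : R) : (0 <= (t ^+ 2 + 0)%:E)%E by rewrite lee_fin addr0 sqr_ge0.
have msq : measurable_fun setT (fun t : R => (t ^+ 2 + 0)%:E).
  by apply/measurable_EFinP; apply: measurable_funD => //; exact: exprn_measurable.
have := independent_sum_mean mZ indep mphi ZQ 0 us msq sq0.
rewrite E expr0n /= !add0r => <-.
by apply: eq_integral => w _; rewrite add0r addr0.
Qed.

End second_moment.

(** * Sums over two independent samples *)

Section two_sample_clt.
Context {dO dT} {O : measurableType dO} {T : measurableType dT} {R : realType}.
Variables (Pr : probability O R) (P Q : probability T R) (X Y : nat -> O -> T).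
Hypothesis mX : forall k, measurable_fun setT (X k).
Hypothesis mY : forall k, measurable_fun setT (Y k).
Hypothesis XP : forall k A, measurable A -> Pr (X k @^-1` A) = P A.
Hypothesis YQ : forall k A, measurable A -> Pr (Y k @^-1` A) = Q A.
Hypothesis XY_indep : mutually_independent Pr
  (fun s : nat + nat => match s with inl k => X k | inr k => Y k end).
Variables (g h : T -> R) (sg sh : R).
Hypothesis mg : measurable_fun setT g.
Hypothesis mh : measurable_fun setT h.
Hypothesis g2 : integrableR P (fun y => g y ^+ 2).
Hypothesis h2 : integrableR Q (fun y => h y ^+ 2).
Hypothesis g_mean : \int[P]_y g y = 0.
Hypothesis h_mean : \int[Q]_y h y = 0.
Hypothesis sg0 : 0 <= sg.
Hypothesis sh0 : 0 <= sh.
Hypothesis g_var : \int[P]_y g y ^+ 2 = sg ^+ 2.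
Hypothesis h_var : \int[Q]_y h y ^+ 2 = sh ^+ 2.
Local Notation gamma := (std_normal R).
Local Notation mid := (@measurable_id _ (measurableTypeR R) setT).

Definition two_sample_sum (a b : R) (n m : nat) (w : O) : R :=
  a * \sum_(i < n) g (X i w) + b * \sum_(j < m) h (Y j w).

Lemma measurable_two_sample_sum a b n m : measurable_fun setT (two_sample_sum a b n m).
Proof.
apply: measurable_funD; apply: measurable_funM => //; apply: measurable_sum => i.
  exact: (measurableT_comp mg (mX i)).
exact: (measurableT_comp mh (mY i)).
Qed.

Let Z (s : nat + nat) := match s with inl k => X k | inr k => Y k end.
Let law (s : nat + nat) := match s with inl _ => P | inr _ => Q end.
Let phi a b (s : nat + nat) y := match s with inl _ => a * g y | inr _ => b * h y end.
(** The observations of [Y] are listed ahead because the left fold applies their operators to the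
    test function before those of [X]. *)
Let idx n m : seq (nat + nat) :=
  [seq inr j | j <- index_iota 0 m] ++ [seq inl i | i <- index_iota 0 n].

Let mZ s : measurable_fun setT (Z s). Proof. by case: s. Qed.

Let ZL s A : measurable A -> Pr (Z s @^-1` A) = law s A.
Proof. by case: s => k mA; [exact: XP|exact: YQ]. Qed.

Let mphi a b s : measurable_fun setT (phi a b s).
Proof. by case: s => k; exact: measurable_funM. Qed.

Let uniq_idx n m : uniq (idx n m).
Proof.
have inl_inj : injective (@inl nat nat) by move=> i j [].
have inr_inj : injective (@inr nat nat) by move=> i j [].
rewrite cat_uniq !map_inj_uniq// !iota_uniq andbT /=.
by apply/hasPn => _ /mapP[i _ ->]; apply/negP => /mapP[].
Qed.

Let sum_idx a b n m w :
  \sum_(s <- idx n m) phi a b s (Z s w) = two_sample_sum a b n m w.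
Proof.
by rewrite big_cat !big_map /= -!big_distrr /= !big_mkord addrC.
Qed.

Lemma two_sample_sum_sqr a b n m :
  (\int[Pr]_w (two_sample_sum a b n m w ^+ 2)%:E =
   (n%:R * a ^+ 2 * sg ^+ 2 + m%:R * b ^+ 2 * sh ^+ 2)%:E)%E.
Proof.
pose v (s : nat + nat) := match s with inl _ => a ^+ 2 * sg ^+ 2 | inr _ => b ^+ 2 * sh ^+ 2 end.
have ig := integrable_of_sqr mg g2; have ih := integrable_of_sqr mh h2.
have c1 s : integrableR (law s) (fun y => phi a b s y ^+ 2).
  case: s => k.
    rewrite (_ : (fun y => _) = fun y => a ^+ 2 * g y ^+ 2); first exact: integrableRZ.
    by apply/funext => y; rewrite /phi exprMn.
  rewrite (_ : (fun y => _) = fun y => b ^+ 2 * h y ^+ 2); first exact: integrableRZ.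
  by apply/funext => y; rewrite /phi exprMn.
have c2 s : \int[law s]_y phi a b s y = 0.
  by case: s => k; rewrite /phi /law RintegralZl// ?g_mean ?h_mean mulr0.
have c3 s : \int[law s]_y phi a b s y ^+ 2 = v s.
  case: s => k; rewrite /phi /law /v.
    by rewrite -g_var -RintegralZl//; apply: eq_Rintegral => y _; rewrite exprMn.
  by rewrite -h_var -RintegralZl//; apply: eq_Rintegral => y _; rewrite exprMn.
have := independent_sum_sqr mZ XY_indep (mphi a b) ZL c1 c2 c3 (uniq_idx n m).
under eq_integral do rewrite sum_idx.
move=> ->; congr EFin.
rewrite big_cat !big_map /= !big_mkord !sumr_const !card_ord.
by rewrite -[_ *+ m]mulr_natl -[_ *+ n]mulr_natl !mulrA addrC.
Qed.

Lemma two_sample_mean a b n m M K psi : taylor2 M K psi ->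
  \int[Pr]_w psi (two_sample_sum a b n m w) =
  iter n (average P g a) (iter m (average Q h b) psi) 0.
Proof.
move=> tp; have [mpsi psiM _] := tp.
have fold_iter (e : nat -> nat + nat) (s : seq nat) (L : probability T R) c (k : T -> R)
    (f : R -> R) B :
    (forall i, law (e i) = L /\ phi a b (e i) = fun y => c * k y) ->
    measurable_fun setT k -> measurable_fun setT f -> (forall t, `|f t| <= B) ->
    [/\ measurable_fun setT (iter (size s) (average L k c) f),
       (forall t, `|iter (size s) (average L k c) f t| <= B) &
    foldl (fun g i => shift_mean (law i) (phi a b i) g) (EFin \o f) [seq e i | i <- s] =
      EFin \o iter (size s) (average L k c) f].
  move=> FE mk mf fB; elim: s f mf fB => [|j s IH] f mf fB //.
  have mav := measurable_average L mk c mf fB.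
  have avB t := average_bound L mk c t mf fB.
  have [m1 b1 E1] := IH _ mav avB; rewrite /= -iterS iterSr; split=> //.
  rewrite -E1; congr (foldl _ _ _); have [-> ->] := FE j; apply/funext => t.
  exact: shift_mean_average fB.
(* The fold formula takes nonnegative functions; the added constant passes through every average and
   cancels in the end. *)
pose f t := psi t + M.
have f0 t : 0 <= f t by have := psiM t; rewrite /f ler_norml => /andP[]; lra.
have mf : measurable_fun setT f by exact: measurable_funD.
have fM t : `|f t| <= M + M.
  by rewrite (le_trans (ler_normD _ _))// lerD// ger0_norm// (le_trans _ (psiM t)).
have shiftE (L : probability T R) c (k : T -> R) q (u : R -> R) : measurable_fun setT k ->
    taylor2 M K u ->
    iter q (average L k c) (fun t => u t + M) = fun t => iter q (average L k c) u t + M.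
  move=> mk tu; elim: q => // q IH; rewrite !iterS IH; apply/funext => x.
  have [mv vM _] := taylor2_iter_average L c q mk tu.
  rewrite {1}/average RintegralD//; last exact: (integrableR_cst L).
    by rewrite Rintegral_prob_cst.
  exact: (integrable_average L mk c x mv vM).
have mS := measurable_two_sample_sum a b n m.
have iS (u : R -> R) B : measurable_fun setT u -> (forall t, `|u t| <= B) ->
    integrableR Pr (fun w => u (two_sample_sum a b n m w)).
  by move=> mu uB; apply: (@integrableR_bound _ _ R Pr _ B) => //; exact: (measurableT_comp mu).
have mfE : measurable_fun setT (EFin \o f) by exact/measurable_EFinP.
have fE0 t : (0 <= (EFin \o f) t)%E by rewrite lee_fin.
have := independent_sum_mean mZ XY_indep (mphi a b) ZL 0 (uniq_idx n m) mfE fE0.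
rewrite foldl_cat.
have [m1 b1 ->] := fold_iter inr (index_iota 0 m) Q b h f _ (fun=> conj erefl erefl) mh mf fM.
have [_ _ ->] := fold_iter inl (index_iota 0 n) P a g _ _ (fun=> conj erefl erefl) mg m1 b1.
rewrite !size_iota !subn0 /=.
under eq_integral do rewrite sum_idx add0r /=.
rewrite -Rintegral_EFin; last exact: iS mf fM.
rewrite (shiftE Q b h m psi mh tp) (shiftE P a g n _ mg (taylor2_iter_average Q b m mh tp)).
move=> [] E; have : \int[Pr]_w f (two_sample_sum a b n m w) =
  iter n (average P g a) (iter m (average Q h b) psi) 0 + M by exact: E.
rewrite {1}/f RintegralD//; [|exact: iS mpsi psiM|exact: (integrableR_cst Pr)].
by rewrite Rintegral_prob_cst => /addIr.
Qed.

End two_sample_clt.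

Section two_sample_limit.
Context {dO dT} {O : measurableType dO} {T : measurableType dT} {R : realType}.
Variables (Pr : probability O R) (P Q : probability T R) (X Y : nat -> O -> T).
Hypothesis mX : forall k, measurable_fun setT (X k).
Hypothesis mY : forall k, measurable_fun setT (Y k).
Hypothesis XP : forall k A, measurable A -> Pr (X k @^-1` A) = P A.
Hypothesis YQ : forall k A, measurable A -> Pr (Y k @^-1` A) = Q A.
Hypothesis XY_indep : mutually_independent Pr
  (fun s : nat + nat => match s with inl k => X k | inr k => Y k end).
Variables (g h : T -> R) (sg sh : R).
Hypothesis mg : measurable_fun setT g.
Hypothesis mh : measurable_fun setT h.
Hypothesis g2 : integrableR P (fun y => g y ^+ 2).
Hypothesis h2 : integrableR Q (fun y => h y ^+ 2).
Hypothesis g_mean : \int[P]_y g y = 0.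
Hypothesis h_mean : \int[Q]_y h y = 0.
Hypothesis sg0 : 0 <= sg.
Hypothesis sh0 : 0 <= sh.
Hypothesis g_var : \int[P]_y g y ^+ 2 = sg ^+ 2.
Hypothesis h_var : \int[Q]_y h y ^+ 2 = sh ^+ 2.
Local Notation gamma := (std_normal R).
Local Notation mid := (@measurable_id _ (measurableTypeR R) setT).

Local Notation S := (two_sample_sum X Y g h).

Let two_sample_error (K a b : R) (n m : nat) : R :=
  n%:R * (K * (third_moment_trunc P g a + third_moment_trunc gamma id (a * sg))) +
  m%:R * (K * (third_moment_trunc Q h b + third_moment_trunc gamma id (b * sh))).

(** Lindeberg's bound is used for [X] with the test function already averaged over [Y], which stays
    in the Taylor class, and for [Y] under a contraction. The semigroup law merges the two
    Gaussians. *)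
Lemma two_sample_lindeberg a b n m M K psi : 0 <= a -> 0 <= b -> taylor2 M K psi ->
  `|\int[Pr]_w psi (S a b n m w) -
    average gamma id (Num.sqrt (n%:R * a ^+ 2 * sg ^+ 2 + m%:R * b ^+ 2 * sh ^+ 2)) psi 0|
  <= two_sample_error K a b n m.
Proof.
move=> a0 b0 tp.
rewrite (two_sample_mean mX mY XP YQ XY_indep mg mh a b n m tp).
pose F := iter m (average Q h b) psi.
pose G := average gamma id (b * sh * Num.sqrt m%:R) psi.
have tF : taylor2 M K F := taylor2_iter_average Q b m mh tp.
have tG : taylor2 M K G := taylor2_average gamma (b * sh * Num.sqrt m%:R) mid tp.
have [mF FM _] := tF; have [mG GM _] := tG.
have -> : average gamma id (Num.sqrt (n%:R * a ^+ 2 * sg ^+ 2 + m%:R * b ^+ 2 * sh ^+ 2)) psi 0 =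
    average gamma id (a * sg * Num.sqrt n%:R) G 0.
  apply/esym; have [_ psiM _] := tp.
  apply: (gaussian_semigroup _ _ _ _ _ (taylor2_continuous tp) psiM).
  - by rewrite !mulr_ge0// sqrtr_ge0.
  - by rewrite !mulr_ge0// sqrtr_ge0.
  - exact: sqrtr_ge0.
  - rewrite sqr_sqrtr; last by rewrite addr_ge0// !mulr_ge0// sqr_ge0.
    by rewrite !exprMn !sqr_sqrtr//; ring.
have -> : iter n (average P g a) F 0 - average gamma id (a * sg * Num.sqrt n%:R) G 0 =
   (iter n (average P g a) F 0 - average gamma id (a * sg * Num.sqrt n%:R) F 0) +
   average gamma id (a * sg * Num.sqrt n%:R) (fun t => F t - G t) 0.
  rewrite -(average_sub gamma mid _ 0 mF FM mG GM); ring.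
rewrite (le_trans (ler_normD _ _))// /two_sample_error; apply: lerD.
  exact: (lindeberg n 0 mg g2 g_mean g_var a0 sg0 erefl tF).
apply: average_bound => //; first exact: measurable_funB.
by move=> t; exact: (lindeberg m t mh h2 h_mean h_var b0 sh0 erefl tp).
Qed.

Lemma cvg_average_gaussian (c_ : nat -> R) c psi M : continuous psi ->
  (forall t, `|psi t| <= M) -> c_ @ \oo --> c ->
  (fun k => average gamma id (c_ k) psi 0) @ \oo --> average gamma id c psi 0.
Proof.
move=> cpsi psiM cc; have mpsi := continuous_measurable_fun cpsi.
apply: (@Rintegral_dominated_cvg _ _ _ gamma (fun k u => psi (0 + c_ k * u))
  (fun u => psi (0 + c * u)) (fun=> M)).
- by move=> k; apply: (measurableT_comp mpsi); apply: measurable_funD => //; exact: measurable_funM.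
- exact: (integrableR_cst gamma).
- move=> u; apply: continuous_cvg; first exact: cpsi.
  by apply: cvgD; [exact: cvg_cst|apply: cvgM => //; exact: cvg_cst].
- by move=> k u; exact: psiM.
Qed.

(** Four errors of [e / 4]: smoothing [f] under the sample law, Lindeberg's bound, the passage from
    the variance [v k] to its limit, and smoothing [f] under the Gaussian law. *)
Lemma two_sample_clt (f : R -> R) M (a b : nat -> R) (n m : nat -> nat) (A B c : R) :
  continuous f -> (forall t, `|f t| <= M) ->
  (forall k, 0 <= a k) -> (forall k, 0 <= b k) -> a @ \oo --> 0 -> b @ \oo --> 0 ->
  (fun k => (n k)%:R * a k ^+ 2) @ \oo --> A ->
  (fun k => (m k)%:R * b k ^+ 2) @ \oo --> B ->
  0 <= c -> c ^+ 2 = A * sg ^+ 2 + B * sh ^+ 2 ->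
  (fun k => \int[Pr]_w f (S (a k) (b k) (n k) (m k) w)) @ \oo --> average gamma id c f 0.
Proof.
move=> cf fM a0 b0 al bl na mb c0 cE; have mf := continuous_measurable_fun cf.
pose v k := (n k)%:R * a k ^+ 2 * sg ^+ 2 + (m k)%:R * b k ^+ 2 * sh ^+ 2.
have vc : v @ \oo --> c ^+ 2.
  by rewrite cE; apply: cvgD; apply: cvgM => //; exact: cvg_cst.
apply/cvgrPdist_le => e e0.
(* Eventually [v k <= c ^+ 2 + 1], so that [e1 * (1 + v k)] is at most [e / 4]. *)
pose e1 := e / (4 * (c ^+ 2 + 2)).
have c2 : 0 < c ^+ 2 + 2 by have := sqr_ge0 c; lra.
have e10 : 0 < e1 by rewrite divr_gt0// mulr_gt0.
have e1E : e1 * (c ^+ 2 + 2) = e / 4 by rewrite /e1; field; rewrite gt_eqF.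
have [K [psi [tp fpsi]]] := smooth_approx cf fM e10.
have cpsi := taylor2_continuous tp; have [mpsi psiM _] := tp.
have ce : (fun k => average gamma id (Num.sqrt (v k)) psi 0) @ \oo --> average gamma id c psi 0.
  apply: (cvg_average_gaussian cpsi psiM).
  rewrite -(ger0_norm c0) -(sqrtr_sqr c).
  by apply: continuous_cvg vc; exact: sqrt_continuous.
have scale (s : R) (l : R) (u : nat -> nat) (t : nat -> R) :
  (fun k => (u k)%:R * t k ^+ 2) @ \oo --> l ->
  (fun k => (u k)%:R * (t k * s) ^+ 2) @ \oo --> l * s ^+ 2.
  move=> ut; under eq_fun do rewrite exprMn mulrA.
  by apply: cvgM => //; exact: cvg_cst.
have to0 (s : R) (t : nat -> R) : t @ \oo --> 0 -> (fun k => t k * s) @ \oo --> 0.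
  by move=> t0; rewrite -(mul0r s); apply: cvgM => //; exact: cvg_cst.
have is2 := integrable_std_normal_sqr R.
have err0 : (fun k => two_sample_error K (a k) (b k) (n k) (m k)) @ \oo --> 0.
  have e_ := third_moment_trunc_cvg mg g2 al na.
  have e_h := third_moment_trunc_cvg mh h2 bl mb.
  have e_g1 := third_moment_trunc_cvg mid is2 (to0 sg _ al) (scale sg _ _ _ na).
  have e_g2 := third_moment_trunc_cvg mid is2 (to0 sh _ bl) (scale sh _ _ _ mb).
  have : (fun k => K * ((n k)%:R * third_moment_trunc P g (a k) +
      (n k)%:R * third_moment_trunc gamma id (a k * sg)) +
    K * ((m k)%:R * third_moment_trunc Q h (b k) +
      (m k)%:R * third_moment_trunc gamma id (b k * sh))) @ \oo --> K * (0 + 0) + K * (0 + 0).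
    by apply: cvgD; apply: cvgM; [exact: cvg_cst|exact: cvgD|exact: cvg_cst|exact: cvgD].
  rewrite !(addr0, mulr0); apply: cvg_trans; apply: near_eq_cvg; apply: nearW => k.
  by rewrite /two_sample_error; ring.
have limit_err : `|average gamma id c psi 0 - average gamma id c f 0| <= e / 4.
  rewrite (average_sub gamma mid c 0 mpsi psiM mf fM) /average.
  have iq := integrableRZ (e1 * c ^+ 2) is2; have i1 := integrableR_cst gamma e1.
  have ipf : integrableR gamma (fun u => psi (0 + c * u) - f (0 + c * u)).
    apply: integrableRB.
      exact: (integrable_average gamma mid c 0 mpsi psiM).
    exact: (integrable_average gamma mid c 0 mf fM).
  rewrite (le_trans (le_normr_Rintegral measurableT ipf))//.
  apply: (le_trans (Rintegral_le (integrableR_abs ipf) (integrableRD i1 iq) _)).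
    by move=> u; rewrite distrC (le_trans (fpsi _))// add0r exprMn mulrDr mulr1 mulrA.
  rewrite RintegralD// Rintegral_prob_cst RintegralZl//.
  have -> : \int[gamma]_u u ^+ 2 = 1 by rewrite -[RHS]/(fine 1%E); congr fine; exact: std_normal_second_moment.
  by rewrite mulr1 -e1E; lra.
have sample_err k : v k <= c ^+ 2 + 1 ->
    `|\int[Pr]_w f (S (a k) (b k) (n k) (m k) w) - \int[Pr]_w psi (S (a k) (b k) (n k) (m k) w)|
    <= e / 4.
  move=> vk; set Sk := S (a k) (b k) (n k) (m k).
  have mS : measurable_fun setT Sk by exact: measurable_two_sample_sum.
  have ES : (\int[Pr]_w (Sk w ^+ 2)%:E = (v k)%:E)%E.
    exact: (two_sample_sum_sqr mX mY XP YQ XY_indep mg mh g2 h2 g_mean h_mean g_var h_var).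
  have iS2 : integrableR Pr (fun w => Sk w ^+ 2).
    apply: integrableR_ge0; [exact: measurable_funX|by move=> w; exact: sqr_ge0|].
    by rewrite ES ltry.
  have i1 := integrableR_cst Pr e1; have iq := integrableRZ e1 iS2.
  have iu (u : R -> R) L : measurable_fun setT u -> (forall t, `|u t| <= L) ->
      integrableR Pr (fun w => u (Sk w)).
    by move=> mu uL; apply: (@integrableR_bound _ _ R Pr _ L) => //; exact: (measurableT_comp mu).
  have j1 := iu _ _ mf fM; have j2 := iu _ _ mpsi psiM; have j3 := integrableRB j1 j2.
  rewrite -RintegralB// (le_trans (le_normr_Rintegral measurableT j3))//.
  apply: (le_trans (Rintegral_le (integrableR_abs j3) (integrableRD i1 iq) _)).
    by move=> w; rewrite (le_trans (fpsi _))// mulrDr mulr1.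
  rewrite RintegralD// Rintegral_prob_cst RintegralZl//.
  have -> : \int[Pr]_w Sk w ^+ 2 = v k by rewrite -[RHS]/(fine (v k)%:E); congr fine.
  have := ler_wpM2l (ltW e10) vk; lra.
have e4 : 0 < e / 4 by rewrite divr_gt0.
near=> k.
have vk : v k <= c ^+ 2 + 1.
  near: k; move/cvgrPdist_le : vc => /(_ 1 ltr01); apply: filterS => k.
  by rewrite ler_norml => /andP[]; lra.
have k2 : `|0 - two_sample_error K (a k) (b k) (n k) (m k)| <= e / 4.
  by near: k; move/cvgrPdist_le : err0; exact.
have k3 : `|average gamma id c psi 0 - average gamma id (Num.sqrt (v k)) psi 0| <= e / 4.
  by near: k; move/cvgrPdist_le : ce; exact.
have k1 := sample_err k vk.
have k4 := two_sample_lindeberg (n k) (m k) (a0 k) (b0 k) tp.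
rewrite sub0r normrN in k2.
have {k2}k4 := le_trans k4 (le_trans (ler_norm _) k2).
rewrite -/(v k) in k4.
have l4 := limit_err; move: l4 k1 k3 k4; clear; rewrite !ler_norml => /andP[? ?] /andP[? ?] /andP[? ?] /andP[? ?].
by apply/andP; split; lra.
Unshelve. all: by end_near.
Qed.

End two_sample_limit.

Section gaussian_laws.
Variable R : realType.
Local Notation gamma := (std_normal R).
Local Notation mid := (@measurable_id _ (measurableTypeR R) setT).

Lemma gauss1_average (f : R -> R) (M s : R) : measurable_fun setT f -> (forall t, `|f t| <= M) ->
  gauss1 f s = (average gamma id s f 0)%:E.
Proof.
move=> mf fM; have i := integrable_average gamma mid s 0 mf fM.
rewrite /average Rintegral_EFin// (Rintegral_std_normal i).
by apply: eq_integral => u _; rewrite add0r.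
Qed.

Lemma gauss2_average (f : R -> R) (M a b c : R) : 0 <= a -> 0 <= b -> 0 <= c ->
  c ^+ 2 = a ^+ 2 + b ^+ 2 -> continuous f -> (forall t, `|f t| <= M) ->
  gauss2 f a b = (average gamma id c f 0)%:E.
Proof.
move=> a0 b0 c0 cE cf fM; have mf := continuous_measurable_fun cf.
rewrite -(gaussian_semigroup 0 a0 b0 c0 cE cf fM).
have mF := measurable_average gamma mid b mf fM.
have FM t : `|average gamma id b f t| <= M by exact: average_bound.
rewrite -(gauss1_average a mF FM) /gauss1 /gauss2.
apply: eq_integral => u _.
have i := integrable_average gamma mid b (a * u) mf fM.
have ij := integrableRZ (normal_pdf 0 1 u) i.
transitivity (\int[gamma]_v (normal_pdf 0 1 u * f (a * u + b * v))%:E)%E.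
  rewrite (Rintegral_std_normal ij); apply: eq_integral => v _.
  by rewrite (mulrC (normal_pdf 0 1 u)).
by rewrite -(Rintegral_EFin ij) RintegralZl// mulrC.
Qed.

End gaussian_laws.

(** * Convergence in law without measurability *)

Section sandwich.
Context {dO} {O : measurableType dO} {R : realType}.
Variable Pr : probability O R.

(** [u] lies between the integrable functions [max (v - r, 0)] and [v + r], and monotonicity of the
    integral holds for arbitrary nonnegative functions. *)
Let ge0_integral_near (u v r : O -> R) : (forall w, 0 <= u w) -> (forall w, 0 <= v w) ->
  integrableR Pr v -> integrableR Pr r -> (forall w, `|u w - v w| <= r w) ->
  exists I : R, (\int[Pr]_w (u w)%:E)%E = I%:E /\ `|I - \int[Pr]_w v w| <= \int[Pr]_w r w.
Proof.
move=> u0 v0 iv ir uvr; have r0 w : 0 <= r w by exact: le_trans (uvr w).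
have mv := integrableR_meas iv; have mr := integrableR_meas ir.
have ivr := integrableRD iv ir.
have id0 := integrableRB iv ir.
have im : integrableR Pr (fun w => Num.max (v w - r w) 0).
  apply: (@integrableR_le _ _ R Pr _ (fun w => v w + r w)) => //.
    by apply: measurable_maxr => //; exact: measurable_funB.
  move=> w; rewrite ger0_norm ?le_max ?lexx ?orbT// ge_max addr_ge0// andbT.
  by have := r0 w; lra.
have up : (\int[Pr]_w (u w)%:E <= (\int[Pr]_w (v w + r w))%:E)%E.
  rewrite Rintegral_EFin//; apply: ge0_le_integral_nomeas => w; rewrite lee_fin.
  - exact: u0.
  - by have := uvr w; rewrite ler_norml => /andP[]; lra.
have lo : ((\int[Pr]_w (Num.max (v w - r w) 0))%:E <= \int[Pr]_w (u w)%:E)%E.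
  rewrite Rintegral_EFin//; apply: ge0_le_integral_nomeas => w; rewrite lee_fin.
  - by rewrite le_max lexx orbT.
  - by rewrite ge_max u0 andbT; have := uvr w; rewrite ler_norml => /andP[]; lra.
have lo2 : \int[Pr]_w v w - \int[Pr]_w r w <= \int[Pr]_w (Num.max (v w - r w) 0).
  by rewrite -RintegralB//; apply: Rintegral_le => // w; rewrite le_max lexx.
rewrite RintegralD// in up.
case: (\int[Pr]_w (u w)%:E)%E up lo => [I| |]; rewrite ?lee_fin ?leye_eq ?leeNy_eq// => up lo.
by exists I; split=> //; rewrite ler_norml; apply/andP; split; lra.
Qed.

(* [u] need not be measurable: its integral is a difference of two lower integrals,
   and each of them is monotone. *)
Lemma integral_near (u v r : O -> R) : integrableR Pr v -> integrableR Pr r ->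
  (forall w, `|u w - v w| <= r w) ->
  exists I : R, (\int[Pr]_w (u w)%:E)%E = I%:E /\ `|I - \int[Pr]_w v w| <= 2 * \int[Pr]_w r w.
Proof.
move=> iv ir uvr; have mv := integrableR_meas iv.
have maxn0 (x y : R) : `|Num.max x 0 - Num.max y 0| <= `|x - y|.
  have h1 := ler_norm (x - y).
  have h2 : y - x <= `|x - y| by rewrite distrC ler_norm.
  have h3 := normr_ge0 (x - y).
  by rewrite /Num.max; do 2 case: ltP => ?; rewrite ler_norml; apply/andP; split; lra.
have imax (k : O -> R) : integrableR Pr k -> integrableR Pr (fun w => Num.max (k w) 0).
  move=> ik; apply: (@integrableR_le _ _ R Pr _ (fun w => `|k w|)).
  - by apply: measurable_maxr => //; exact: integrableR_meas ik.
  - exact: integrableR_abs.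
  - by move=> w; rewrite ger0_norm ?le_max ?lexx ?orbT// ge_max normr_ge0 ler_norm.
have ivN : integrableR Pr (fun w => - v w).
  by under eq_fun do rewrite -mulN1r; exact: integrableRZ.
have max0 (x : R) : 0 <= Num.max x 0 by rewrite le_max lexx orbT.
have [Ip [Ep bp]] := ge0_integral_near (fun w => max0 (u w)) (fun w => max0 (v w))
  (imax _ iv) ir (fun w => le_trans (maxn0 _ _) (uvr w)).
have uvrN w : `|- u w - - v w| <= r w by rewrite -opprD normrN.
have [Im [Em bm]] := ge0_integral_near (fun w => max0 (- u w)) (fun w => max0 (- v w))
  (imax _ ivN) ir (fun w => le_trans (maxn0 _ _) (uvrN w)).
exists (Ip - Im); split.
  rewrite integralE EFinB -Ep -Em; congr (_ - _)%E; apply: eq_integral => w _.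
    by rewrite funeposE -EFin_max.
  by rewrite funenegE -EFinN -EFin_max.
have -> : \int[Pr]_w v w = \int[Pr]_w Num.max (v w) 0 - \int[Pr]_w Num.max (- v w) 0.
  rewrite -RintegralB//; [|exact: imax|exact: imax].
  apply: eq_Rintegral => w _.
  by rewrite /Num.max; do 2 case: ltP => ?; lra.
move: bp bm; rewrite !ler_norml => /andP[? ?] /andP[? ?]; apply/andP; split; lra.
Qed.

(** A Slutsky argument: [f (T k)] differs from [f (S k)] by the weighted modulus off [B] and by at
    most [2 * M] on [B]. This majorant is measurable even where [T k] is not known to be. *)
Lemma cvg_in_law_near (T S : nat -> O -> R) (f : R -> R) (M V L : R) :
  continuous f -> (forall t, `|f t| <= M) ->
  (forall k, measurable_fun setT (S k)) ->
  (\forall k \near \oo, (\int[Pr]_w (S k w ^+ 2)%:E <= V%:E)%E) ->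
  (fun k => \int[Pr]_w f (S k w)) @ \oo --> L ->
  (forall ka eta : R, 0 < ka -> 0 < eta -> \forall k \near \oo,
     exists B, [/\ measurable B, (Pr B <= eta%:E)%E &
       forall w, ~ B w -> `|T k w - S k w| <= ka]) ->
  (fun k => \int[Pr]_w (f (T k w))%:E)%E @ \oo --> L%:E.
Proof.
move=> cf fM mS SV SL TS; have M0 : 0 <= M by exact: le_trans (fM 0).
have mf := continuous_measurable_fun cf.
have close e : 0 < e -> \forall k \near \oo, exists I : R,
    (\int[Pr]_w (f (T k w))%:E)%E = I%:E /\ `|I - L| <= e.
  move=> e0; have V1 : 0 < 1 + `|V| by rewrite ltr_pwDl.
  (* The three parts of the majorant get [e / 12] each; [integral_near] doubles their total to
     [e / 2], and the convergence of the means of [f (S k)] supplies the other half. *)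
  pose e1 := e / (12 * (1 + `|V|)).
  have e10 : 0 < e1 by rewrite divr_gt0// mulr_gt0.
  have e1E : e1 * (1 + `|V|) = e / 12 by rewrite /e1; field; rewrite gt_eqF.
  have [C fC] := continuous_bounded_modulus cf fM e10.
  have C1 : 0 < 1 + `|C| by rewrite ltr_pwDl.
  pose ka := Num.sqrt (e / 12 / (1 + `|C|)).
  have ka0 : 0 < ka by rewrite sqrtr_gt0 !divr_gt0.
  have kaC : `|C| * ka ^+ 2 <= e / 12.
    rewrite sqr_sqrtr; last by rewrite !divr_ge0// ltW.
    rewrite mulrCA ler_piMr ?divr_ge0 ?(ltW e0)//.
    by rewrite ler_pdivrMr// mul1r lerDr.
  pose eta := e / (24 * (M + 1)).
  have M1 : 0 < M + 1 by lra.
  have eta0 : 0 < eta by rewrite divr_gt0// mulr_gt0.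
  have etaE : 2 * (M + 1) * eta = e / 12 by rewrite /eta; field; rewrite gt_eqF.
  have e4 : 0 < e / 2 by rewrite divr_gt0.
  move/cvgrPdist_le : SL => /(_ _ e4) SL'.
  move: SV SL' (TS ka eta ka0 eta0); apply: filterS3 => k SVk SLk [B [mB PB TB]].
  have iS2 : integrableR Pr (fun w => S k w ^+ 2).
    apply: integrableR_ge0; [exact: measurable_funX|by move=> w; exact: sqr_ge0|].
    by apply: le_lt_trans SVk _; exact: ltry.
  have S2V : \int[Pr]_w S k w ^+ 2 <= V by rewrite -lee_fin Rintegral_EFin.
  have iB := integrable_indic Pr mB.
  have ifS : integrableR Pr (fun w => f (S k w)).
    by apply: (@integrableR_bound _ _ R Pr _ M) => //; exact: (measurableT_comp mf).
  pose r w := e1 * (1 + S k w ^+ 2) + e / 12 + 2 * M * \1_B w.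
  have i1 := integrableR_cst Pr 1; have i2 := integrableR_cst Pr (e / 12).
  have i3 := integrableRD i1 iS2; have i4 := integrableRZ e1 i3.
  have i5 := integrableRD i4 i2; have i6 := integrableRZ (2 * M) iB.
  have ir : integrableR Pr r by exact: integrableRD.
  have fr w : `|f (T k w) - f (S k w)| <= r w.
    have p1 : 0 <= e1 * (1 + S k w ^+ 2) by rewrite mulr_ge0 ?(ltW e10)// addr_ge0// sqr_ge0.
    rewrite /r; have [Bw|nBw] := pselect (B w).
      rewrite indicE mem_set// mulr1 (le_trans (ler_normB _ _))//.
      by have := fM (T k w); have := fM (S k w); lra.
    rewrite indicE memNset// mulr0 addr0.
    have -> : T k w = S k w + (T k w - S k w) by ring.
    apply: (le_trans (fC _ _)); rewrite lerD2l (le_trans _ kaC)//.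
    apply: (le_trans (ler_wpM2r (sqr_ge0 _) (ler_norm C))).
    apply: ler_wpM2l => //.
    by rewrite -(real_normK (num_real _)) lerXn2r ?nnegrE ?TB// ltW.
  have [I [IE Ib]] := integral_near ifS ir fr.
  exists I; split=> //.
  have rb : \int[Pr]_w r w <= e / 4.
    have -> : \int[Pr]_w r w = e1 * (1 + \int[Pr]_w S k w ^+ 2) + e / 12 + 2 * M * \int[Pr]_w \1_B w.
      rewrite (RintegralD measurableT i5 i6) (RintegralD measurableT i4 i2).
      rewrite (RintegralZl _ measurableT i3) (RintegralD measurableT i1 iS2).
      by rewrite (RintegralZl _ measurableT iB) !Rintegral_prob_cst.
    have PBe : \int[Pr]_w \1_B w <= eta by rewrite -lee_fin Rintegral_EFin// integral_indic// setIT.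
    have := ler_wpM2l (ltW e10) (le_trans S2V (ler_norm V)).
    have := ler_wpM2l M0 PBe; have := mulr_ge0 M0 (ltW eta0); lra.
  move: SLk Ib rb; clear; rewrite !ler_norml => /andP[? ?] /andP[? ?] ?; apply/andP; split; lra.
apply/fine_cvgP; split.
  by have := close 1 ltr01; apply: filterS => k [I [-> _]].
apply/cvgrPdist_le => e e0; have := close e e0; apply: filterS => k [I [/= IE Ib]].
by rewrite /= IE distrC.
Qed.

End sandwich.

(** * Empirical laws *)

Lemma mutually_independent_comp {dO dT} {O : measurableType dO} {T : measurableType dT}
    {R : realType} {I J : eqType} (Pr : probability O R) (Z : I -> O -> T) (e : J -> I) :
  injective e -> mutually_independent Pr Z -> mutually_independent Pr (fun j => Z (e j)).
Proof.
move=> einj indep [|j0 s] B us mB.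
  have := indep [::] (fun=> setT) isT (fun=> measurableT).
  rewrite !big_nil => <-; congr (Pr _).
  by apply/seteqP; split=> y _ i.
(* Carries the sets along [e] by position in the list; only indices in the image of the list are
   ever consulted. *)
pose B' i := B (nth j0 (j0 :: s) (index i [seq e j | j <- j0 :: s])).
have B'E j : j \in j0 :: s -> B' (e j) = B j by move=> js; rewrite /B' index_map// nth_index.
have := indep [seq e j | j <- j0 :: s] B' _ (fun i => mB _).
rewrite map_inj_uniq// => /(_ us); rewrite big_map => H.
transitivity (Pr (\bigcap_(i in [set` [seq e j | j <- j0 :: s]]) (Z i @^-1` B' i))).
  congr (Pr _); apply/seteqP; split => [y H' i /mapP[j js ->]|y H' j /= js].
    by rewrite /= B'E//; exact: H'.
  have := H' (e j); rewrite /= B'E//; apply; exact: (map_f e js).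
rewrite H big_seq [RHS]big_seq; apply: eq_bigr => j js.
by rewrite B'E.
Qed.

Section empirical_mean.
Context {dO dT} {O : measurableType dO} {T : measurableType dT} {R : realType}.
Variables (Pr : probability O R) (L : probability T R) (Z : nat -> O -> T).
Hypothesis mZ : forall k, measurable_fun setT (Z k).
Hypothesis ZL : forall k A, measurable A -> Pr (Z k @^-1` A) = L A.
Hypothesis indep : mutually_independent Pr Z.

(* With no observation the empirical law is replaced by the true one. *)
Definition emean n (phi : T -> R) (w : O) : R :=
  if n is 0 then \int[L]_y phi y else n%:R^-1 * \sum_(i < n) phi (Z i w).

Lemma Rintegral_law k phi : integrableR L phi -> (forall y, 0 <= phi y) ->
  integrableR Pr (fun w => phi (Z k w)) /\ \int[Pr]_w phi (Z k w) = \int[L]_y phi y.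
Proof.
move=> iphi phi0; have mphi := integrableR_meas iphi.
have mabs : measurable_fun setT (fun t : R => `|t|%:E).
  by apply/measurable_EFinP; exact: normr_measurable.
have abs0 (t : R) : (0 <= `|t|%:E)%E by rewrite lee_fin.
have E : (\int[Pr]_w (phi (Z k w))%:E = \int[L]_y (phi y)%:E)%E.
  (* The sum formula for a single term, with the absolute value as a nonnegative test function. *)
  have := @independent_sum_mean _ _ _ _ _ _ _ _ mZ indep (fun=> phi) (fun=> L)
    (fun=> mphi) ZL [:: k] (fun t => `|t|%:E) 0 isT mabs abs0.
  under eq_integral do rewrite big_seq1 add0r ger0_norm//.
  by move=> ->; rewrite /= /shift_mean; apply: eq_integral => y _; rewrite add0r ger0_norm.
split; last by rewrite /Rintegral E.
apply: integrableR_ge0 => //; first exact: (measurableT_comp mphi (mZ _)).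
by rewrite E -Rintegral_EFin// ltry.
Qed.

Lemma emean_ge0 n phi w : (forall y, 0 <= phi y) -> 0 <= emean n phi w.
Proof.
move=> phi0; case: n => [|n] /=; first exact: Rintegral_ge0.
by rewrite mulr_ge0// sumr_ge0.
Qed.

Lemma Rintegral_emean n phi : integrableR L phi -> (forall y, 0 <= phi y) ->
  integrableR Pr (emean n phi) /\ \int[Pr]_w emean n phi w = \int[L]_y phi y.
Proof.
move=> iphi phi0; case: n => [|n] /=.
  by split; [exact: (integrableR_cst Pr)|rewrite Rintegral_prob_cst].
have i k := (Rintegral_law k iphi phi0).1.
have is_ : integrableR Pr (fun w => \sum_(k < n.+1) phi (Z k w)).
  by apply: integrableRsum => k; exact: i.
split; first exact: integrableRZ.
rewrite RintegralZl// Rintegral_sum; last by move=> k; exact: i.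
under eq_bigr do rewrite (Rintegral_law _ iphi phi0).2.
by rewrite sumr_const card_ord -(mulr_natl (\int[L]_y phi y)) mulrA mulVf ?mul1r// pnatr_eq0.
Qed.

Let markov_set (f : O -> R) (K : R) : integrableR Pr f -> (forall w, 0 <= f w) -> 0 < K ->
  exists B, [/\ measurable B, (Pr B <= (\int[Pr]_w f w / K)%:E)%E &
    forall w, ~ B w -> f w <= K].
Proof.
move=> fi f0 K0; have mf := integrableR_meas fi; pose B := [set w | K <= f w].
have mB : measurable B.
  rewrite (_ : B = f @^-1` `[K, +oo[%classic); last first.
    by apply/seteqP; split => w; rewrite /B /= in_itv /= andbT.
  by rewrite -[X in measurable X]setTI; exact: mf.
exists B; split=> //; last by move=> w /negP; rewrite -ltNge => /ltW.
have iB := integrable_indic Pr mB.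
have PBE : Pr B = (\int[Pr]_w \1_B w)%:E by rewrite Rintegral_EFin// integral_indic// setIT.
rewrite PBE lee_fin ler_pdivlMr// mulrC -RintegralZl//.
apply: Rintegral_le => //; first exact: integrableRZ.
move=> w; rewrite indicE; have [Bw|nBw] := pselect (B w).
  by rewrite mem_set// mulr1.
by rewrite memNset// mulr0.
Qed.

Lemma emean_markov n (phi : T -> R) (K : R) : integrableR L phi -> (forall y, 0 <= phi y) -> 0 < K ->
  exists B, [/\ measurable B, (Pr B <= (\int[L]_y phi y / K)%:E)%E &
    forall w, ~ B w -> emean n phi w <= K].
Proof.
move=> iphi phi0 K0; have [ie <-] := Rintegral_emean n iphi phi0.
by apply: markov_set => // w; exact: emean_ge0.
Qed.

Lemma emean_chebyshev n (phi : T -> R) (b K : R) : measurable_fun setT phi -> (forall y, `|phi y| <= b) ->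
  0 < K -> exists B, [/\ measurable B, (Pr B <= (n%:R^-1 * b ^+ 2 / K ^+ 2)%:E)%E &
    forall w, ~ B w -> `|emean n phi w - \int[L]_y phi y| <= K].
Proof.
move=> mphi phib K0; have iphi : integrableR L phi by exact: integrableR_bound phib.
(* Without observations the deviation is zero and, as [0^-1 = 0], the bound asks for a null set. *)
case: n => [|n].
  exists set0; split=> // [|w _]; first by rewrite measure0 invr0 !mul0r.
  by rewrite /emean subrr normr0 ltW.
pose m := \int[L]_y phi y; pose f y := phi y - m.
have mf : measurable_fun setT f by exact: measurable_funB.
have i1 := integrableR_cst L m.
have phi2 : integrableR L (fun y => phi y ^+ 2).
  apply: (@integrableR_bound _ _ R L _ (b ^+ 2)); first exact: measurable_funX.
  by move=> y; rewrite normrX lerXn2r ?nnegrE// (le_trans _ (phib y)).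
have i3 := integrableRZ (2 * m) iphi; have i2 := integrableR_cst L (m ^+ 2).
have i4 := integrableRB phi2 i3.
have fE : (fun y => f y ^+ 2) = fun y => phi y ^+ 2 - 2 * m * phi y + m ^+ 2.
  by apply/funext => y; rewrite /f; ring.
have f2 : integrableR L (fun y => f y ^+ 2) by rewrite fE; exact: integrableRD.
have f_mean : \int[L]_y f y = 0 by rewrite /f RintegralB// Rintegral_prob_cst subrr.
have f_var : \int[L]_y f y ^+ 2 <= b ^+ 2.
  rewrite fE RintegralD// RintegralB// RintegralZl// Rintegral_prob_cst -/m.
  have : \int[L]_y phi y ^+ 2 <= b ^+ 2.
    rewrite -[leRHS](Rintegral_prob_cst L); apply: Rintegral_le => //.
      exact: (integrableR_cst L).
    by move=> y; rewrite -(real_normK (num_real (phi y))) lerXn2r ?nnegrE// (le_trans _ (phib y)).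
  have := sqr_ge0 m; lra.
have := independent_sum_sqr mZ indep (fun=> mf) ZL (fun=> f2) (fun=> f_mean)
  (fun=> erefl) (iota_uniq 0 n.+1).
set v := \int[L]_y f y ^+ 2 in f_var * => SV.
pose S w := \sum_(i < n.+1) f (Z i w).
have mS : measurable_fun setT S by apply: measurable_sum => i; exact: (measurableT_comp mf (mZ _)).
have SE w : n.+1%:R * (emean n.+1 phi w - m) = S w.
  rewrite /S sumrB sumr_const card_ord /emean mulrBr mulrA mulfV ?pnatr_eq0// mul1r.
  by rewrite -(mulr_natl m).
have S2 : (\int[Pr]_w (S w ^+ 2)%:E = (n.+1%:R * v)%:E)%E.
  have -> : n.+1%:R * v = \sum_(i <- iota 0 n.+1) v.
    by rewrite -[iota 0 n.+1]/(index_iota 0 n.+1) big_mkord sumr_const card_ord mulr_natl.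
  rewrite -SV; apply: eq_integral => w _; congr (_ ^+ 2)%:E.
  by rewrite /S -[iota 0 n.+1]/(index_iota 0 n.+1) big_mkord.
have iS2 : integrableR Pr (fun w => S w ^+ 2).
  apply: integrableR_ge0; [exact: measurable_funX|by move=> w; exact: sqr_ge0|].
  by rewrite S2 ltry.
have n0 : 0 < n.+1%:R :> R by rewrite ltr0n.
have nK : 0 < (n.+1%:R * K) ^+ 2 by rewrite exprn_gt0// mulr_gt0.
have [B [mB PB SB]] := markov_set iS2 (fun w => sqr_ge0 (S w)) nK.
exists B; split=> //.
  apply: (le_trans PB); rewrite lee_fin.
  have -> : \int[Pr]_w S w ^+ 2 = n.+1%:R * v by rewrite /Rintegral S2.
  rewrite exprMn ler_pdivrMr ?mulr_gt0 ?exprn_gt0//.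
  have -> : n.+1%:R^-1 * b ^+ 2 / K ^+ 2 * (n.+1%:R ^+ 2 * K ^+ 2) = n.+1%:R * b ^+ 2.
    by field; rewrite !gt_eqF.
  by rewrite ler_wpM2l// ltW.
have nK0 : 0 <= n.+1%:R * K by rewrite mulr_ge0// ltW.
move=> w /SB; rewrite -SE -(real_normK (num_real (_ * (_ - _)))).
rewrite ler_sqr ?nnegrE// normrM gtr0_norm// ler_pM2l//.
Qed.

End empirical_mean.

Section empirical_probability.
Context {d} {T : measurableType d} {R : realType}.

Let unif_ge0 n (i : 'I_n.+1) : (0 : R) <= n.+1%:R^-1.
Proof. by rewrite invr_ge0. Qed.

Let unif_sum n : \sum_(i < n.+1) n.+1%:R^-1 = 1 :> R.
Proof. by rewrite sumr_const card_ord -(mulr_natl n.+1%:R^-1) mulfV// pnatr_eq0. Qed.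

Definition empirical_prob (L : probability T R) (s : nat -> T) (n : nat) : probability T R :=
  if n is n'.+1 then discrete_prob (fun i : 'I_n'.+1 => s i) (@unif_ge0 n') (unif_sum n')
  else L.

Lemma integrable_empirical_prob (L : probability T R) s n (phi : T -> R) : integrableR L phi ->
  integrableR (empirical_prob L s n) phi.
Proof.
by case: n => // n iphi; apply: integrable_discrete; exact: integrableR_meas iphi.
Qed.

Lemma Rintegral_empirical_prob {dO} {O : measurableType dO} (L : probability T R) (Z : nat -> O -> T) w n
    (phi : T -> R) : measurable_fun setT phi ->
  \int[empirical_prob L (Z ^~ w) n]_y phi y = emean L Z n phi w.
Proof. by case: n => // n mphi; rewrite Rintegral_discrete//= mulr_sumr. Qed.

End empirical_probability.

Section empirical_measure.
Variables (R : realType) (d N : nat).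

Lemma empirical_probE (L : probability (Rd R d) R) s n :
  (empirical_prob L s n.+1 : set (Rd R d) -> \bar R) = empirical s n.+1.
Proof.
rewrite discrete_probE; apply/funext => A; rewrite /weighted_diracs /empirical.
by rewrite ge0_sume_distrr// => i _; exact: measure_ge0.
Qed.

(** With every observation at a site, the Dirac masses regroup by site. The premise will hold
    outside a null set. *)
Lemma empirical_discrete {dO} {O : measurableType dO} (L : probability (Rd R d) R)
    (X : nat -> O -> Rd R d) (x : 'I_N -> Rd R d) w n : injective x ->
  (forall k, exists i, X k w = x i) ->
  empirical (X ^~ w) n.+1 = discrete_measure x (fun i => emean L X n.+1 \1_[set x i] w).
Proof.
move=> x_inj Xx; apply/funext => A; rewrite /empirical /discrete_measure /=.
have E k : \d_(X k w) A = (\sum_i (\1_[set x i] (X k w) * \1_A (x i)))%:E :> \bar R.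
  have [i ->] := Xx k; rewrite diracE (bigD1 i)//= big1 => [|j ji].
    have -> : \1_[set x i] (x i) = 1 :> R by rewrite indicE mem_set.
    by rewrite mul1r addr0 indicE.
  have -> : \1_[set x j] (x i) = 0 :> R.
    by rewrite indicE memNset// => /= /x_inj ij; rewrite ij eqxx in ji.
  by rewrite mul0r.
under eq_bigr do rewrite E.
rewrite sumEFin -EFinM exchange_big /= mulr_sumr -sumEFin.
apply: eq_bigr => i _; rewrite diracE -EFinM; congr EFin.
by rewrite -mulrA mulr_suml indicE.
Qed.

End empirical_measure.

Section transport_dual_bound.
Variables (R : realType) (d N : nat) (i0 : 'I_N).
Variables (x : 'I_N -> 'rV[R]_d) (h : 'rV[R]_d -> R).
Hypothesis x_inj : injective x.
Hypothesis h_ge0 : forall u, 0 <= h u.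
Hypothesis h_cont : continuous h.
Local Notation c := (sitecost x h).

(** Two families of weights meet here: [w'], nearly optimal for the present marginals, supplies a
    [z'] whose dual value nearly reaches the cost; the given [w] limits how far that value can
    exceed the one at [z]. *)
Lemma Tc_dual_bound (p : 'I_N -> R) (Q : probability (Rd R d) R) (z : 'I_N -> R)
    (w : 'I_N -> Rd R d -> R) (dl : R) :
  (forall i, 0 < p i) -> \sum_i p i = 1 -> (forall i, integrableR Q (c i)) ->
  (forall i, measurable_fun setT (w i)) -> (forall i y, 0 <= w i y) ->
  (forall y, \sum_i w i y = 1) -> z i0 = 0 -> 0 < dl ->
  (forall z', z' i0 = z i0 -> (forall i, `|z' i - z i| <= dl) ->
    (exists i, `|z' i - z i| = dl) -> dual i0 c p Q z' <= dual i0 c p Q z) ->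
  `|fine (Tc (cost_of h) (discrete_measure x p) Q) - dual i0 c p Q z| <=
    \int[Q]_y slack i0 c z w y + dl * \sum_i `|p i - \int[Q]_y w i y|.
Proof.
move=> p0 p1 ic mw w0 w1 z0 dl0 sphere.
have c0 i y : 0 <= c i y by exact: sitecost_ge0.
have lo := dual_le_Tc i0 x_inj h_ge0 h_cont p1 ic z.
set rhs := _ + _ * _; have up e : 0 < e ->
    (Tc (cost_of h) (discrete_measure x p) Q <= (dual i0 c p Q z + rhs + e)%:E)%E.
  move=> e0; have [w' [z' [mw' w0' w1' pw' [z0' Hz']]]] := dual_weights i0 ic c0 p0 p1 e0.
  have T1 := Tc_le_weights x_inj h_ge0 h_cont ic mw' w0' w1' pw'.
  apply: (le_trans T1).
  rewrite lee_fin (le_trans Hz')// lerD2r /rhs addrA.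
  apply: (dual_local_bound ic c0 mw w0 w1 dl0 sphere).
  by rewrite z0'.
case E : (Tc _ _ _) lo up => [t| |] lo up /=.
- have ub : t <= dual i0 c p Q z + rhs by apply/ler_addgt0Pr => e e0; rewrite -lee_fin up.
  by rewrite lee_fin in lo; rewrite ger0_norm ?subr_ge0//; lra.
- by have := up 1 ltr01.
- by [].
Qed.

End transport_dual_bound.

(** * Properties that hold outside a set of small probability *)

Section exceptional_sets.
Context {dO} {O : measurableType dO} {R : realType}.
Variable Pr : probability O R.
Implicit Types (e : R) (A : O -> Prop).

(** The exceptional set is measurable while [A] may not be, as happens for statements on the
    empirical cost. *)
Definition outside e A := exists B, [/\ measurable B, (Pr B <= e%:E)%E &
  forall w, ~ B w -> A w].

Lemma outside_mono e e' A A' : e <= e' -> (forall w, A w -> A' w) ->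
  outside e A -> outside e' A'.
Proof.
move=> ee AA [B [mB PB BA]]; exists B; split=> //; last by move=> w /BA /AA.
by apply: (le_trans PB); rewrite lee_fin.
Qed.

Lemma outside_and e1 e2 A1 A2 : outside e1 A1 -> outside e2 A2 ->
  outside (e1 + e2) (fun w => A1 w /\ A2 w).
Proof.
move=> [B1 [mB1 PB1 H1]] [B2 [mB2 PB2 H2]]; exists (B1 `|` B2); split.
- exact: measurableU.
- by rewrite EFinD (le_trans (measureU2 Pr mB1 mB2))// leeD.
- by move=> w BB; split; [apply: H1|apply: H2] => Bw; apply: BB; [left|right].
Qed.

Lemma outside_list (I : Type) (s : seq I) e (A : I -> O -> Prop) :
  (forall i, List.In i s -> outside e (A i)) ->
  outside ((size s)%:R * e) (fun w => forall i, List.In i s -> A i w).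
Proof.
elim: s => [|j s IH] H.
  exists set0; split=> //; by rewrite measure0 mul0r.
apply: outside_mono (outside_and (H j (or_introl erefl)) (IH (fun i si => H i (or_intror si)))).
  by rewrite /= -[(size s).+1%:R]natr1 mulrDl mul1r addrC.
by move=> w [Hj Hs] i /= [<-//|]; exact: Hs.
Qed.

Lemma outside_ord N e (A : 'I_N -> O -> Prop) : (forall i, outside e (A i)) ->
  outside (N%:R * e) (fun w => forall i, A i w).
Proof.
move=> H; apply: outside_mono (outside_list (s := enum 'I_N) (fun i _ => H i)).
  by rewrite size_enum_ord.
by move=> w Hw i; apply: Hw; apply/mem_ListIn; rewrite mem_enum.
Qed.

End exceptional_sets.

Section empirical_mean_algebra.
Context {dO dT} {O : measurableType dO} {T : measurableType dT} {R : realType}.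
Variables (L : probability T R) (Z : nat -> O -> T).

Lemma emeanB n (f g : T -> R) w : integrableR L f -> integrableR L g ->
  emean L Z n (fun y => f y - g y) w = emean L Z n f w - emean L Z n g w.
Proof.
case: n => [|n] fi gi /=; first by rewrite RintegralB.
by rewrite -mulrBr -sumrB.
Qed.

Lemma emean_centered n (f g : T -> R) (r : R) w :
  (forall y, g y = f y - \int[L]_y f y) ->
  r * (emean L Z n f w - \int[L]_y f y) = r / n%:R * \sum_(i < n) g (Z i w).
Proof.
move=> gE; case: n => [|n]; first by rewrite /= subrr mulr0 big_ord0 mulr0.
under eq_bigr do rewrite gE.
rewrite sumrB sumr_const card_ord -(mulr_natl (\int[L]_y f y)) /emean.
have : n.+1%:R != 0 :> R by rewrite pnatr_eq0.
by move: (n.+1%:R : R) => q q0; field.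
Qed.

Lemma emean_sum n N (z : 'I_N -> R) (f : 'I_N -> T -> R) w :
  (forall i, integrableR L (f i)) ->
  emean L Z n (fun y => \sum_i z i * f i y) w = \sum_i z i * emean L Z n (f i) w.
Proof.
move=> fi; case: n => [|n] /=.
  rewrite Rintegral_sum; last by move=> i; exact: integrableRZ.
  by apply: eq_bigr => i _; rewrite RintegralZl.
rewrite exchange_big mulr_sumr; apply: eq_bigr => i _.
by rewrite mulrCA -mulr_sumr.
Qed.

End empirical_mean_algebra.

(** * The limit of the empirical transport cost *)

Section transport_deviation.
Variables (R : realType) (d N : nat) (i0 : 'I_N).
Variables (x : 'I_N -> Rd R d) (h : 'rV[R]_d -> R).
Hypothesis x_inj : injective x.
Hypothesis h_ge0 : forall u, 0 <= h u.
Hypothesis h_cont : continuous h.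
Local Notation c := (sitecost x h).
Variable p : 'I_N -> R.
Hypothesis p_gt0 : forall i, 0 < p i.
Hypothesis p_sum : \sum_i p i = 1.
Variable Q : probability (Rd R d) R.
Hypothesis ic : forall i, integrableR Q (c i).
Variable z : 'I_N -> R.
Hypothesis z0 : z i0 = 0.
Hypothesis zmax : forall v, dual i0 c p Q v <= dual i0 c p Q z.
Hypothesis z_unique : forall v, v i0 = z i0 -> dual i0 c p Q z <= dual i0 c p Q v -> v = z.
Context {dO} {O : measurableType dO}.
Variables (Pr : probability O R) (X Y : nat -> O -> Rd R d).
Variable P : probability (Rd R d) R.
Hypothesis PE : (P : set (Rd R d) -> \bar R) = discrete_measure x p.
Hypothesis mX : forall k, measurable_fun setT (X k).
Hypothesis mY : forall k, measurable_fun setT (Y k).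
Hypothesis XP : forall k A, measurable A -> Pr (X k @^-1` A) = P A.
Hypothesis YQ : forall k A, measurable A -> Pr (Y k @^-1` A) = Q A.
Hypothesis X_indep : mutually_independent Pr X.
Hypothesis Y_indep : mutually_independent Pr Y.

Definition freq n w (i : 'I_N) : R := emean P X n \1_[set x i] w.
Definition observed_law m w : probability (Rd R d) R := empirical_prob Q (Y ^~ w) m.
Definition sample_cost n m w : R :=
  fine (Tc (cost_of h) (discrete_measure x (freq n w)) (observed_law m w)).
Definition sample_dual n m w v : R := dual i0 c (freq n w) (observed_law m w) v.

Let msite i : measurable ([set x i] : set (Rd R d)). Proof. exact: measurable_Rd_set1. Qed.

Let isite i : integrableR P \1_[set x i].
Proof. exact: (integrable_indic P (msite i)). Qed.

Lemma Rintegral_site i : \int[P]_y \1_[set x i] y = p i.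
Proof.
rewrite /Rintegral integral_indic// setIT PE /discrete_measure.
rewrite (bigD1 i)//= big1 => [|j ji]; first by rewrite diracE mem_set// mule1 adde0.
by rewrite diracE memNset ?mule0// => /= /x_inj ij; rewrite ij eqxx in ji.
Qed.

Let on_sites : outside Pr 0 (fun w => forall k, exists i, X k w = x i).
Proof.
pose E : set (Rd R d) := ~` (\bigcup_(i in [set: 'I_N]) [set x i]).
have mE : measurable E.
  apply: measurableC; apply: fin_bigcup_measurable => [|i _]; last exact: msite.
  exact: finite_finset.
have PE0 : P E = 0%E.
  rewrite PE /discrete_measure big1// => i _.
  rewrite diracE memNset ?mule0// => -[]; by exists i.
have mXE k : measurable (X k @^-1` E) by rewrite -[X in measurable X]setTI; exact: mX.
have [B [mB PB EB]] : Pr.-negligible (\bigcup_k (X k @^-1` E)).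
  by apply: negligible_bigcup => k; exists (X k @^-1` E); split=> //; rewrite XP// PE0.
exists B; split=> //; first by rewrite PB.
move=> w Bw k; apply: contrapT => H; apply: Bw; apply: EB; exists k => // -[i _] /= Xi.
by apply: H; exists i.
Qed.

Let freq_sum n w : (forall k, exists i, X k w = x i) -> \sum_i freq n w i = 1.
Proof.
move=> Xx; rewrite /freq; case: n => [|n] /=.
  by rewrite -p_sum; apply: eq_bigr => i _; exact: Rintegral_site.
rewrite -mulr_sumr exchange_big /=.
have E k : \sum_i \1_[set x i] (X k w) = 1 :> R.
  have [i ->] := Xx k; rewrite (bigD1 i)//= big1 => [|j ji].
    by rewrite indicE mem_set// addr0.
  by rewrite indicE memNset// => /= /x_inj ij; rewrite ij eqxx in ji.
under eq_bigr do rewrite E.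
by rewrite sumr_const card_ord mulVf// pnatr_eq0.
Qed.

Lemma sample_dualE n m w v :
  sample_dual n m w v = \sum_i v i * freq n w i + emean Q Y m (cmin i0 c v) w.
Proof.
rewrite /sample_dual /dual /observed_law; congr (_ + _).
apply: (Rintegral_empirical_prob Q Y w m); apply: measurable_cmin => i.
exact: measurable_sitecost.
Qed.

(** The excess of the cost over the dual at [z] is at most a mean slack plus [dl] times the marginal
    error of the weights. The rescaled marginal error stays bounded in probability, so a small [dl]
    disposes of it; the slack is beaten by weights whose accuracy improves with [r k]. *)
Lemma transport_deviation (n m : nat -> nat) (r : nat -> R) (C ka eta : R) :
  (forall k, 0 <= r k) ->
  (fun k => (n k)%:R^-1 : R) @ \oo --> 0 -> (fun k => (m k)%:R^-1 : R) @ \oo --> 0 ->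
  (\forall k \near \oo, r k ^+ 2 / (n k)%:R <= C) ->
  (\forall k \near \oo, r k ^+ 2 / (m k)%:R <= C) -> 0 < ka -> 0 < eta ->
  \forall k \near \oo, outside Pr eta (fun w =>
    (forall j, exists i, X j w = x i) /\
    r k * `|sample_cost (n k) (m k) w - sample_dual (n k) (m k) w z| <= ka).
Proof.
move=> r0 n0 m0 rn rm ka0 eta0.
have N0 : 0 < N%:R :> R by rewrite ltr0n; case: (N) i0 => [[]|].
(* Bounds [(r k + 1) ^+ 2] divided by either sample size, since inverse sizes are at most 1. *)
pose C2 := 2 * `|C| + 2.
have C20 : 0 < C2 by rewrite ltr_wpDl// mulr_ge0.
(* With deviations [Kb / rho], the [N] Chebyshev bounds add up to [eta / 8]. *)
pose Kb := Num.sqrt (8 * N%:R * C2 / eta).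
have Kb0 : 0 < Kb by rewrite sqrtr_gt0 divr_gt0// !mulr_gt0.
have KbE : N%:R * (C2 / Kb ^+ 2) = eta / 8.
  rewrite sqr_sqrtr; last by rewrite divr_ge0 ?mulr_ge0// ltW.
  by field; rewrite !gt_eqF.
(* Reserves half of [ka] for the marginal error of the weights. *)
pose dl := ka / (4 * N%:R * Kb).
have dl0 : 0 < dl by rewrite divr_gt0// !mulr_gt0.
have dlE : dl * (N%:R * (2 * Kb)) = ka / 2 by rewrite /dl; field; rewrite !gt_eqF.
have [e1 [e10 [V HV]]] := dual_sphere_gap (i0 := i0) ic (fun i => ltW (p_gt0 i)) p_sum z_unique dl0.
pose nv v : R := \sum_i `|v i - z i|.
have nv0 v : 0 <= nv v by apply: sumr_ge0.
(* Bounds the difference of the minima at [z] and at any net point, so that Chebyshev's inequality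
   applies to it even for a cost with one moment. *)
pose bV : R := 1 + \sum_(v <- V) nv v.
have bV_le v : List.In v V -> nv v <= bV.
  suff H : List.In v V -> nv v <= \sum_(v <- V) nv v.
    by move=> /H vV; apply: le_trans vV _; rewrite lerDr.
  elim: (V) => // u s IH /=; rewrite big_cons => -[->|/IH vs].
    by rewrite lerDl sumr_ge0.
  by rewrite (le_trans vs)// lerDr.
have bV0 : 0 < bV by rewrite ltr_pwDl// sumr_ge0.
(* Small enough for the linear part of the tested dual differences, and below every [p i], so that
   all sites are observed. *)
have [dp [dp0 [dp_e dp_p]]] : exists dp : R, 0 < dp /\ bV * dp <= e1 / 2 /\ forall i, dp < p i.
  have [j pj] := minf_ex i0 p.
  have dp0 : 0 < Num.min (e1 / 2 / bV) (p j / 2) by rewrite lt_min !divr_gt0.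
  exists (Num.min (e1 / 2 / bV) (p j / 2)); split=> //; split.
    by rewrite mulrC -ler_pdivlMr// ge_min lexx.
  move=> i; apply: (@le_lt_trans _ _ (p j / 2)); first by rewrite ge_min lexx orbT.
  by have := minf_le i0 p i; rewrite pj; have := p_gt0 j; lra.
have lim_small (s : nat -> nat) (K : R) : (fun k => (s k)%:R^-1 : R) @ \oo --> 0 ->
    \forall k \near \oo, (s k)%:R^-1 * K <= eta / 8.
  move=> s0; have e8 : 0 < eta / 8 by rewrite divr_gt0.
  have : (fun k => (s k)%:R^-1 * K) @ \oo --> 0 by rewrite -(mul0r K); apply: cvgM => //; exact: cvg_cst.
  move/cvgrPdist_le => /(_ _ e8); apply: filterS => k.
  by rewrite sub0r normrN => /(le_trans (ler_norm _)).
have nsmall := lim_small n (N%:R / dp ^+ 2) n0.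
have msmall := lim_small m ((size V)%:R * (bV ^+ 2 / (e1 / 2) ^+ 2)) m0.
move: nsmall msmall; near_simpl => nsmall msmall.
near=> k.
have rnk : r k ^+ 2 / (n k)%:R <= C by near: k.
have rmk : r k ^+ 2 / (m k)%:R <= C by near: k.
have nk : (n k)%:R^-1 * (N%:R / dp ^+ 2) <= eta / 8 by near: k.
have mk : (m k)%:R^-1 * ((size V)%:R * (bV ^+ 2 / (e1 / 2) ^+ 2)) <= eta / 8 by near: k.
(* Stands in for [r k], which may vanish, in denominators. *)
pose rho := r k + 1.
have rho0 : 0 < rho by rewrite ltr_wpDl.
have rate s : r k ^+ 2 / s%:R <= C -> s%:R^-1 * 1 ^+ 2 / (Kb / rho) ^+ 2 <= C2 / Kb ^+ 2.
  move=> rs; have s1 : (s%:R^-1 : R) <= 1.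
    by case: s {rs} => [|s]; rewrite ?invr0// invf_le1 ?ler1n ?ltr0n.
  have s0 : 0 <= (s%:R^-1 : R) by rewrite invr_ge0.
  rewrite expr1n mulr1 expr_div_n invf_div mulrA ler_wpM2r ?invr_ge0 ?sqr_ge0//.
  have := ler_norm C; have := r0 k; have := sqr_ge0 (r k - 1); rewrite /rho /C2 => h1 h2 h3.
  have : (r k - 1) ^+ 2 * s%:R^-1 >= 0 by rewrite mulr_ge0 ?sqr_ge0.
  nra.
have Kr0 : 0 < Kb / rho by rewrite divr_gt0.
have c0 i y : 0 <= c i y by exact: sitecost_ge0.
have eps0 : 0 < ka * eta / (8 * rho) by rewrite divr_gt0// mulr_gt0.
have [wt [v [mwt wt0 wt1 wtp [v0 Hwt]]]] := dual_weights i0 ic c0 p_gt0 p_sum eps0.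
have islack := integrable_slack i0 ic c0 mwt wt0 wt1 z.
have slack0 y : 0 <= slack i0 c z wt y by exact: slack_ge0.
(* The weights are nearly optimal at some [v]; since [z] maximizes the dual, they are as nearly
   optimal at [z]. *)
have slack_small : \int[Q]_y slack i0 c z wt y <= ka * eta / (8 * rho).
  rewrite Rintegral_slack//; have := zmax v; move: Hwt.
  rewrite {2}/dual; under [X in _ - X - _]eq_bigr do rewrite wtp.
  rewrite /dual; lra.
have wt_b i y : `|wt i y| <= 1 by rewrite ger0_norm//; exact: (weight_le1 wt0 wt1).
have ind_b i y : `|\1_[set x i] y| <= 1 :> R by rewrite indicE; case: (_ \in _); rewrite ?normr1 ?normr0.
have o1 := on_sites.
have o2 : outside Pr (N%:R * (C2 / Kb ^+ 2)) (fun w => forall i, `|freq (n k) w i - p i| <= Kb / rho).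
  apply: outside_ord => i; rewrite -Rintegral_site.
  apply: outside_mono (rate _ rnk) (fun _ H => H) _.
  exact: (emean_chebyshev mX XP X_indep (n k) (integrableR_meas (isite i)) (ind_b i) Kr0).
have o3 : outside Pr (N%:R * (C2 / Kb ^+ 2))
    (fun w => forall i, `|emean Q Y (m k) (wt i) w - p i| <= Kb / rho).
  apply: outside_ord => i; rewrite -wtp.
  apply: outside_mono (rate _ rmk) (fun _ H => H) _.
  exact: (emean_chebyshev mY YQ Y_indep (m k) (mwt i) (wt_b i) Kr0).
have o4 : outside Pr (eta / 8) (fun w => forall i, `|freq (n k) w i - p i| <= dp).
  apply: outside_mono nk (fun _ H => H) _; rewrite mulrCA; apply: outside_ord => i.
  rewrite -Rintegral_site (_ : (n k)%:R^-1 * (dp ^+ 2)^-1 = (n k)%:R^-1 * 1 ^+ 2 / dp ^+ 2); last by rewrite expr1n mulr1.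
  exact: (emean_chebyshev mX XP X_indep (n k) (integrableR_meas (isite i)) (ind_b i) dp0).
have icm u : integrableR Q (cmin i0 c u) by exact: integrable_cmin.
have o5 : outside Pr (eta / 8) (fun w => forall v, List.In v V ->
    `|emean Q Y (m k) (cmin i0 c v) w - emean Q Y (m k) (cmin i0 c z) w -
      (\int[Q]_y cmin i0 c v y - \int[Q]_y cmin i0 c z y)| <= e1 / 2).
  apply: outside_mono mk (fun _ H => H) _; rewrite mulrCA; apply: outside_list => u uV.
  have ub y : `|cmin i0 c u y - cmin i0 c z y| <= bV.
    apply: minf_lip => i; apply: le_trans (bV_le u uV).
    have -> : c i y - u i - (c i y - z i) = - (u i - z i) by ring.
    rewrite normrN; by rewrite /nv (bigD1 i)//= lerDl sumr_ge0.
  have iuz := integrableRB (icm u) (icm z).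
  have e12 : 0 < e1 / 2 by rewrite divr_gt0.
  have H : outside Pr ((m k)%:R^-1 * bV ^+ 2 / (e1 / 2) ^+ 2) _ :=
    emean_chebyshev mY YQ Y_indep (m k) (integrableR_meas iuz) ub e12.
  apply: outside_mono H => [|w]; first by rewrite -[leLHS]mulrA lexx.
  by rewrite emeanB// RintegralB.
have o6 : outside Pr (eta / 4) (fun w => emean Q Y (m k) (slack i0 c z wt) w <= ka / (2 * rho)).
  have kr : 0 < ka / (2 * rho) by rewrite divr_gt0// mulr_gt0.
  have H : outside Pr (\int[Q]_y slack i0 c z wt y / (ka / (2 * rho))) _ :=
    emean_markov mY YQ Y_indep (m k) islack slack0 kr.
  apply: outside_mono H => //; rewrite ler_pdivrMr// (le_trans slack_small)// le_eqVlt.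
  by apply/orP; left; apply/eqP; field; rewrite gt_eqF.
(* The failure probabilities are zero, four times [eta / 8], and [eta / 4]. *)
have o := outside_and o1 (outside_and o2 (outside_and o3 (outside_and o4 (outside_and o5 o6)))).
apply: outside_mono o; first by rewrite KbE; lra.
move=> w [Xx [Hp [Hw [Hp' [HVw Hs]]]]]; split=> //.
have fp i : 0 < freq (n k) w i.
  by have := le_lt_trans (Hp' i) (dp_p i); rewrite ltr_distl subrr => /andP[].
have f1 := freq_sum (n k) Xx.
have ic' i : integrableR (observed_law (m k) w) (c i) by exact: integrable_empirical_prob.
have near_dual u : List.In u V ->
    `|sample_dual (n k) (m k) w u - sample_dual (n k) (m k) w z -
      (dual i0 c p Q u - dual i0 c p Q z)| <= e1.
  move=> uV; rewrite !sample_dualE /dual.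
  have -> : \sum_i u i * freq (n k) w i + emean Q Y (m k) (cmin i0 c u) w -
    (\sum_i z i * freq (n k) w i + emean Q Y (m k) (cmin i0 c z) w) -
    (\sum_i u i * p i + \int[Q]_y cmin i0 c u y - (\sum_i z i * p i + \int[Q]_y cmin i0 c z y)) =
    \sum_i (u i - z i) * (freq (n k) w i - p i) +
    (emean Q Y (m k) (cmin i0 c u) w - emean Q Y (m k) (cmin i0 c z) w -
      (\int[Q]_y cmin i0 c u y - \int[Q]_y cmin i0 c z y)).
    have -> : \sum_i (u i - z i) * (freq (n k) w i - p i) = \sum_i u i * freq (n k) w i -
      \sum_i u i * p i - (\sum_i z i * freq (n k) w i - \sum_i z i * p i).
      by rewrite -!sumrB; apply: eq_bigr => i _; ring.
    by ring.
  rewrite (le_trans (ler_normD _ _))// [e1]splitr lerD//; last exact: HVw.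
  apply: le_trans dp_e; rewrite (le_trans (ler_norm_sum _ _ _))//.
  apply: (@le_trans _ _ (\sum_i `|u i - z i| * dp)).
    by apply: ler_sum => i _; rewrite normrM ler_wpM2l.
  by rewrite -mulr_suml ler_wpM2r ?(ltW dp0)//; exact: bV_le.
have sphere := HV _ _ (fun i => ltW (fp i)) f1 ic' near_dual.
have := Tc_dual_bound x_inj h_ge0 h_cont fp f1 ic' mwt wt0 wt1 z0 dl0 sphere.
rewrite (Rintegral_empirical_prob Q Y w (m k) (integrableR_meas islack)).
under eq_bigr do rewrite (Rintegral_empirical_prob Q Y w (m k) (mwt _)).
move=> bound; apply: (le_trans (ler_wpM2l (r0 k) bound)).
have rr : r k / rho <= 1 by rewrite ler_pdivrMr// mul1r lerDl.
have rr0 : 0 <= r k / rho by rewrite divr_ge0// ltW.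
have b1 : r k * emean Q Y (m k) (slack i0 c z wt) w <= ka / 2.
  apply: (le_trans (ler_wpM2l (r0 k) Hs)).
  have -> : r k * (ka / (2 * rho)) = r k / rho * (ka / 2) by field; rewrite gt_eqF.
  by rewrite ler_piMl// divr_ge0// ltW.
have b2 : r k * (dl * \sum_i `|freq (n k) w i - emean Q Y (m k) (wt i) w|) <= ka / 2.
  apply: (@le_trans _ _ (r k * (dl * (N%:R * (2 * (Kb / rho)))))).
    apply: ler_wpM2l => //; apply: ler_wpM2l; first exact: ltW.
    have -> : N%:R * (2 * (Kb / rho)) = \sum_(i < N) 2 * (Kb / rho).
      by rewrite sumr_const card_ord mulr_natl.
    apply: ler_sum => i _.
    rewrite (le_trans (ler_distD (p i) _ _))// [X in _ + X]distrC mulr_natl mulr2n.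
    by apply: lerD; [exact: Hp|exact: Hw].
  have -> : r k * (dl * (N%:R * (2 * (Kb / rho)))) = r k / rho * (ka / 2).
    by rewrite -dlE; field; rewrite gt_eqF.
  by rewrite ler_piMl// divr_ge0// ltW.
by rewrite mulrDr [ka]splitr lerD.
Unshelve. all: by end_near.
Qed.

End transport_deviation.

(** * Limit laws common to all sampling schemes *)

Section transport_limit.
Variables (R : realType) (d N : nat) (i0 : 'I_N).
Variables (x : 'I_N -> Rd R d) (h : 'rV[R]_d -> R).
Hypothesis x_inj : injective x.
Hypothesis h_ge0 : forall u, 0 <= h u.
Hypothesis h_cont : continuous h.
Local Notation c := (sitecost x h).
Variable p : 'I_N -> R.
Hypothesis p_gt0 : forall i, 0 < p i.
Hypothesis p_sum : \sum_i p i = 1.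
Variable Q : probability (Rd R d) R.
Hypothesis ic : forall i, integrableR Q (c i).
Variable z : 'I_N -> R.
Hypothesis z0 : z i0 = 0.
Hypothesis zmax : forall v, dual i0 c p Q v <= dual i0 c p Q z.
Hypothesis z_unique : forall v, v i0 = z i0 -> dual i0 c p Q z <= dual i0 c p Q v -> v = z.
Context {dO} {O : measurableType dO}.
Variables (Pr : probability O R) (X Y : nat -> O -> Rd R d).
Variable P : probability (Rd R d) R.
Hypothesis PE : (P : set (Rd R d) -> \bar R) = discrete_measure x p.
Hypothesis mX : forall k, measurable_fun setT (X k).
Hypothesis mY : forall k, measurable_fun setT (Y k).
Hypothesis XP : forall k A, measurable A -> Pr (X k @^-1` A) = P A.
Hypothesis YQ : forall k A, measurable A -> Pr (Y k @^-1` A) = Q A.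
Hypothesis XY_indep : mutually_independent Pr
  (fun s : nat + nat => match s with inl k => X k | inr k => Y k end).

Local Notation gamma := (std_normal R).
Local Notation sample_cost := (sample_cost x h Q X Y P).
Local Notation sample_dual := (sample_dual i0 x h Q X Y P).
Local Notation freq := (freq x X P).

(** The linear part of the dual as a function of one observation: it takes the value [z i] at [x i],
    so its variance under [P] is [sigma2 p z]. *)
Let u (y : Rd R d) : R := \sum_i z i * \1_[set x i] y.
Let g y : R := u y - \int[P]_y u y.

Let isite i : integrableR P \1_[set x i].
Proof. exact: (integrable_indic P (measurable_Rd_set1 (x i))). Qed.

Let iu : integrableR P u.
Proof. by apply: integrableRsum => i; exact: integrableRZ. Qed.

Let u_mean : \int[P]_y u y = \sum_i z i * p i.
Proof.
rewrite Rintegral_sum; last by move=> i; exact: integrableRZ.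
by apply: eq_bigr => i _; rewrite RintegralZl// (Rintegral_site x_inj PE).
Qed.

Let u_sqr y : u y ^+ 2 = \sum_i z i ^+ 2 * \1_[set x i] y.
Proof.
have [[i ->]|H] := pselect (exists i, y = x i).
  have E (v : 'I_N -> R) : \sum_j v j * \1_[set x j] (x i) = v i.
    rewrite (bigD1 i)//= big1 => [|j ji].
      by rewrite indicE mem_set// mulr1 addr0.
    by rewrite indicE memNset ?mulr0// => /= /x_inj ij; rewrite ij eqxx in ji.
  by rewrite /u !E.
have E (v : 'I_N -> R) : \sum_j v j * \1_[set x j] y = 0.
  by apply: big1 => j _; rewrite indicE memNset ?mulr0// => /= yx; apply: H; exists j.
by rewrite /u !E expr0n.
Qed.

Let iu2 : integrableR P (fun y => u y ^+ 2).
Proof. by rewrite (funext u_sqr); apply: integrableRsum => i; exact: integrableRZ. Qed.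

Let g_sqr y : g y ^+ 2 = u y ^+ 2 - 2 * (\int[P]_y u y) * u y + (\int[P]_y u y) ^+ 2.
Proof. by rewrite /g; ring. Qed.

Let g2 : integrableR P (fun y => g y ^+ 2).
Proof.
rewrite (funext g_sqr); apply: integrableRD; last exact: (integrableR_cst P).
by apply: integrableRB => //; exact: integrableRZ.
Qed.

Let g_var : \int[P]_y g y ^+ 2 = sigma2 p z.
Proof.
have i1 := integrableRZ (2 * \int[P]_y u y) iu; have i2 := integrableRB iu2 i1.
rewrite (funext g_sqr) RintegralD//; last exact: (integrableR_cst P).
rewrite RintegralB// RintegralZl// Rintegral_prob_cst /sigma2 -u_mean.
rewrite (funext u_sqr) Rintegral_sum; last by move=> i; exact: integrableRZ.
under eq_bigr do rewrite RintegralZl// (Rintegral_site x_inj PE).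
ring.
Qed.

Let g_mean : \int[P]_y g y = 0.
Proof.
by rewrite /g RintegralB ?Rintegral_prob_cst ?subrr//; exact: (integrableR_cst P).
Qed.

Let mg : measurable_fun setT g.
Proof. by apply: measurable_funB => //; exact: integrableR_meas iu. Qed.

Lemma sigma2_ge0 : 0 <= sigma2 p z.
Proof. by rewrite -g_var; apply: Rintegral_ge0 => y _; exact: sqr_ge0. Qed.

(** The summand [hh] is a parameter because, with no observation of [Y], it is taken to be zero: the
    centred minimum might then lack a second moment. [T] is prescribed only for large [k] and for
    observations at the sites. *)
Let transport_clt_core (n m : nat -> nat) (r : nat -> R) (A B c0 : R) (hh : Rd R d -> R)
    (sh : R) (T : nat -> O -> R) (f : R -> R) (M : R) :
  (forall k, 0 <= r k) ->
  (fun k => (n k)%:R^-1 : R) @ \oo --> 0 -> (fun k => (m k)%:R^-1 : R) @ \oo --> 0 ->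
  (fun k => r k ^+ 2 / (n k)%:R) @ \oo --> A ->
  (fun k => r k ^+ 2 / (m k)%:R) @ \oo --> B ->
  measurable_fun setT hh -> integrableR Q (fun y => hh y ^+ 2) ->
  \int[Q]_y hh y = 0 -> 0 <= sh -> \int[Q]_y hh y ^+ 2 = sh ^+ 2 ->
  (forall k w, r k * (emean Q Y (m k) (cmin i0 c z) w - \int[Q]_y cmin i0 c z y) =
     r k / (m k)%:R * \sum_(j < m k) hh (Y j w)) ->
  (\forall k \near \oo, forall w, (forall j, exists i, X j w = x i) ->
     T k w = r k * (sample_cost (n k) (m k) w - dual i0 c p Q z)) ->
  0 <= c0 -> c0 ^+ 2 = A * sigma2 p z + B * sh ^+ 2 ->
  continuous f -> (forall t, `|f t| <= M) ->
  (fun k => \int[Pr]_w (f (T k w))%:E)%E @ \oo --> (average gamma id c0 f 0)%:E.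
Proof.
move=> r0 n0 m0 rn rm mhh hh2 hh_mean sh0 hh_var HY HT c00 c0E cf fM.
have X_indep : mutually_independent Pr X.
  by apply: (mutually_independent_comp (e := inl) _ XY_indep) => i j [].
have Y_indep : mutually_independent Pr Y.
  by apply: (mutually_independent_comp (e := inr) _ XY_indep) => i j [].
pose a k := r k / (n k)%:R; pose b k := r k / (m k)%:R.
have ratio (s : nat) (t : R) : s%:R * (t / s%:R) ^+ 2 = t ^+ 2 / s%:R.
  case: s => [|s]; first by rewrite mul0r invr0 mulr0.
  have : s.+1%:R != 0 :> R by rewrite pnatr_eq0.
  by move: (s.+1%:R : R) => q q0; field.
(* The square of [r k / s k] is [r k ^+ 2 / s k] times [1 / s k], a convergent factor times one
   tending to zero. *)
have to0 (s : nat -> nat) (l : R) : (fun k => (s k)%:R^-1 : R) @ \oo --> 0 ->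
    (fun k => r k ^+ 2 / (s k)%:R) @ \oo --> l -> (fun k => r k / (s k)%:R) @ \oo --> 0.
  move=> s0 rs; have : (fun k => r k ^+ 2 / (s k)%:R * (s k)%:R^-1) @ \oo --> 0.
    by rewrite -(mulr0 l); exact: cvgM.
  move=> /(continuous_cvg (h := @Num.sqrt R) _ (@sqrt_continuous R 0)).
  rewrite sqrtr0; apply: cvg_trans; apply: near_eq_cvg; apply: nearW => k.
  have E : Num.sqrt (r k ^+ 2 / (s k)%:R * (s k)%:R^-1) = r k / (s k)%:R.
    have -> : r k ^+ 2 / (s k)%:R * (s k)%:R^-1 = (r k / (s k)%:R) ^+ 2.
      by rewrite expr_div_n expr2 invfM mulrA.
    by rewrite sqrtr_sqr ger0_norm// divr_ge0.
  exact: E.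
have a0 k : 0 <= a k by rewrite divr_ge0. have b0 k : 0 <= b k by rewrite divr_ge0.
have al := to0 n A n0 rn; have bl := to0 m B m0 rm.
have na : (fun k => (n k)%:R * a k ^+ 2) @ \oo --> A by under eq_fun do rewrite ratio.
have mb : (fun k => (m k)%:R * b k ^+ 2) @ \oo --> B by under eq_fun do rewrite ratio.
pose sg := Num.sqrt (sigma2 p z).
have sg0 : 0 <= sg by exact: sqrtr_ge0.
have sgE : sg ^+ 2 = sigma2 p z by rewrite sqr_sqrtr// sigma2_ge0.
have g_var' : \int[P]_y g y ^+ 2 = sg ^+ 2 by rewrite sgE.
have c0E' : c0 ^+ 2 = A * sg ^+ 2 + B * sh ^+ 2 by rewrite sgE.
pose S k := two_sample_sum X Y g hh (a k) (b k) (n k) (m k).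
have mS k : measurable_fun setT (S k) by exact: measurable_two_sample_sum.
have SL := two_sample_clt mX mY XP YQ XY_indep mg mhh g2 hh2 g_mean hh_mean sg0 sh0
  g_var' hh_var cf fM a0 b0 al bl na mb c00 c0E'.
apply: (cvg_in_law_near (V := c0 ^+ 2 + 1) cf fM mS _ SL).
  have vc : (fun k => (n k)%:R * a k ^+ 2 * sg ^+ 2 + (m k)%:R * b k ^+ 2 * sh ^+ 2) @ \oo --> c0 ^+ 2.
    by rewrite c0E'; apply: cvgD; apply: cvgM => //; exact: cvg_cst.
  move/cvgrPdist_le : vc => /(_ 1 ltr01); apply: filterS => k.
  rewrite ler_norml => /andP[vk _].
  rewrite (two_sample_sum_sqr mX mY XP YQ XY_indep mg mhh g2 hh2 g_mean hh_mean g_var' hh_var).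
  by rewrite lee_fin; lra.
move=> ka eta ka0 eta0.
have bnd (s : nat -> R) l : s @ \oo --> l -> l <= `|A| + `|B| ->
    \forall k \near \oo, s k <= `|A| + `|B| + 1.
  move=> sl lA; move/cvgrPdist_le : sl => /(_ 1 ltr01); apply: filterS => k.
  by rewrite ler_norml => /andP[]; lra.
have C1 := bnd _ _ rn; have C2 := bnd _ _ rm.
have Ab : A <= `|A| + `|B| by rewrite (le_trans (ler_norm _))// lerDl.
have Bb : B <= `|A| + `|B| by rewrite (le_trans (ler_norm _))// lerDr.
have := transport_deviation x_inj h_ge0 h_cont p_gt0 p_sum ic z0 zmax z_unique PE mX mY XP YQ
  X_indep Y_indep r0 n0 m0 (C1 Ab) (C2 Bb) ka0 eta0.
apply: filterS2 HT => k HT; apply: outside_mono => // w [Xx].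
rewrite (HT w Xx).
have -> : S k w = r k * (sample_dual (n k) (m k) w z - dual i0 c p Q z).
  rewrite sample_dualE /dual /S /two_sample_sum /a /b //; have <- := HY k w.
  have -> : \sum_i z i * freq (n k) w i = emean P X (n k) u w by rewrite emean_sum.
  by rewrite -(@emean_centered _ _ _ _ R P X (n k) u g (r k) w (fun=> erefl)) u_mean; ring.
have -> (s t q : R) : r k * (s - q) - r k * (t - q) = r k * (s - t) by ring.
by rewrite normrM (ger0_norm (r0 k)).
Qed.

Definition cmin_variance : R :=
  \int[Q]_y cmin i0 c z y ^+ 2 - (\int[Q]_y cmin i0 c z y) ^+ 2.

Lemma integrable_cmin_sqr : (forall i, integrableR Q (fun y => c i y ^+ 2)) ->
  integrableR Q (fun y => cmin i0 c z y ^+ 2).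
Proof.
move=> c2; apply: (@integrableR_le _ _ R Q _ (fun y => \sum_i 2 * (c i y ^+ 2 + z i ^+ 2))).
- apply: measurable_funX; exact: integrableR_meas (integrable_cmin i0 z ic).
- apply: integrableRsum => i; apply: integrableRZ; apply: integrableRD => //.
  exact: (integrableR_cst Q).
move=> y; rewrite ger0_norm ?sqr_ge0//.
have s0 i : 0 <= 2 * (c i y ^+ 2 + z i ^+ 2) by rewrite mulr_ge0// addr_ge0 ?sqr_ge0.
have [j E] := minf_ex i0 (fun i => c i y - z i).
rewrite /cmin E (bigD1 j)//=; apply: (@le_trans _ _ (2 * (c j y ^+ 2 + z j ^+ 2))).
  by have := sqr_ge0 (c j y + z j); nra.
by rewrite lerDl sumr_ge0.
Qed.

Let icmin : integrableR Q (cmin i0 c z). Proof. exact: integrable_cmin. Qed.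

Let Rintegral_centered_sqr : (forall i, integrableR Q (fun y => c i y ^+ 2)) ->
  integrableR Q (fun y => (cmin i0 c z y - \int[Q]_y cmin i0 c z y) ^+ 2) /\
  \int[Q]_y (cmin i0 c z y - \int[Q]_y cmin i0 c z y) ^+ 2 = cmin_variance.
Proof.
move=> /integrable_cmin_sqr i2; set q := \int[Q]_y cmin i0 c z y.
have E : (fun y => (cmin i0 c z y - q) ^+ 2) =
    fun y => cmin i0 c z y ^+ 2 - 2 * q * cmin i0 c z y + q ^+ 2.
  by apply/funext => y; ring.
have i1 := integrableRZ (2 * q) icmin; have i3 := integrableRB i2 i1.
have i4 := integrableR_cst Q (q ^+ 2).
rewrite E; split; first exact: integrableRD.
rewrite RintegralD// RintegralB// RintegralZl// Rintegral_prob_cst /cmin_variance -/q.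
by ring.
Qed.

Lemma cmin_variance_ge0 : (forall i, integrableR Q (fun y => c i y ^+ 2)) -> 0 <= cmin_variance.
Proof.
by move=> /Rintegral_centered_sqr[_ <-]; apply: Rintegral_ge0 => y _; exact: sqr_ge0.
Qed.

(** The disjunction covers both regimes: square integrable costs, or a second marginal that is not
    sampled at all. *)
Lemma transport_clt (n m : nat -> nat) (r : nat -> R) (A B c0 : R)
    (T : nat -> O -> R) (f : R -> R) (M : R) :
  (forall k, 0 <= r k) ->
  (fun k => (n k)%:R^-1 : R) @ \oo --> 0 -> (fun k => (m k)%:R^-1 : R) @ \oo --> 0 ->
  (fun k => r k ^+ 2 / (n k)%:R) @ \oo --> A ->
  (fun k => r k ^+ 2 / (m k)%:R) @ \oo --> B ->
  (forall i, integrableR Q (fun y => c i y ^+ 2)) \/ (B = 0 /\ forall k, m k = 0%N) ->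
  (\forall k \near \oo, forall w, (forall j, exists i, X j w = x i) ->
     T k w = r k * (sample_cost (n k) (m k) w - dual i0 c p Q z)) ->
  0 <= c0 -> c0 ^+ 2 = A * sigma2 p z + B * cmin_variance ->
  continuous f -> (forall t, `|f t| <= M) ->
  (fun k => \int[Pr]_w (f (T k w))%:E)%E @ \oo --> (average gamma id c0 f 0)%:E.
Proof.
move=> r0 n0 m0 rn rm [c2|[B0 mk0]] HT c00 c0E cf fM.
  have [hh2 hh_var] := Rintegral_centered_sqr c2.
  apply: (transport_clt_core (hh := fun y => cmin i0 c z y - \int[Q]_y cmin i0 c z y)
    (sh := Num.sqrt cmin_variance) r0 n0 m0 rn rm _ hh2 _ _ _ _ HT c00 _ cf fM).
  - by apply: measurable_funB => //; exact: integrableR_meas icmin.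
  - by rewrite RintegralB ?Rintegral_prob_cst ?subrr//; exact: (integrableR_cst Q).
  - exact: sqrtr_ge0.
  - by rewrite sqr_sqrtr// cmin_variance_ge0.
  - move=> k w.
    exact: (@emean_centered _ _ _ _ R Q Y (m k) (cmin i0 c z) _ (r k) w (fun=> erefl)).
  - by rewrite sqr_sqrtr// cmin_variance_ge0.
apply: (transport_clt_core (hh := fun=> 0) (sh := 0) r0 n0 m0 rn rm _ _ _ _ _ _ HT c00 _ cf fM).
- by [].
- exact: (integrableR_cst Q).
- exact: Rintegral_prob_cst.
- by [].
- by rewrite Rintegral_prob_cst.
- by move=> k w; rewrite mk0 /= subrr mulr0 big_ord0 mulr0.
- by rewrite c0E B0 !mul0r.
Qed.

End transport_limit.

Lemma cvg_natV {R : realType} (s : nat -> nat) : s @ \oo --> \oo ->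
  (fun k => (s k)%:R^-1 : R) @ \oo --> 0.
Proof.
move=> soo; apply/cvgrPdist_le => e e0.
have : \forall k \near \oo, (Num.bound e^-1 <= s k)%N.
  by move/cvgnyPge : soo => /(_ (Num.bound e^-1)).
apply: filterS => k ks; rewrite sub0r normrN ger0_norm ?invr_ge0//.
have e1 : 0 < e^-1 by rewrite invr_gt0.
have sk : e^-1 < (s k)%:R by rewrite (lt_le_trans (archi_boundP (ltW e1)))// ler_nat.
by rewrite -[e]invrK lef_pV2 ?posrE ?(lt_trans e1 sk)// ltW.
Qed.

Theorem theorem3 (R : realType) (d N : nat) (hN : (0 < N)%N)
  (x : 'I_N -> 'rV[R]_d) (x_inj : injective x)
  (p : 'I_N -> R) (p_pos : forall k, 0 < p k) (p_sum : \sum_(k < N) p k = 1)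
  (Q : probability (Rd R d) R)
  (Q_ac : abs_cont_leb Q)
  (Q_conn : connected (msupport Q))
  (Q_bd : lebesgue_null (boundary (msupport Q)))
  (h : 'rV[R]_d -> R) (h_ge0 : forall u, 0 <= h u)
  (h_diff : forall u, differentiable h u)
  (A1 : strictly_convex h) (A2 : assumption_A2 h) (A3 : superlinear h)
  (Q_int : forall i, (\int[Q]_y (h (x i - y))%:E < +oo)%E)
  (z : 'I_N -> R)
  (z_opt : Tc (cost_of h) (discrete_measure x p) Q
             = gc (cost_of h) x p Q z (Ordinal hN)
           /\ z (Ordinal hN) = 0)
  (dO : measure_display) (O : measurableType dO) (Pr : probability O R)
  (X Y : nat -> O -> Rd R d)
  (X_meas : forall k, measurable_fun setT (X k))
  (Y_meas : forall k, measurable_fun setT (Y k))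
  (X_law : forall k (A : set (Rd R d)), measurable A ->
             Pr (X k @^-1` A) = discrete_measure x p A)
  (Y_law : forall k (A : set (Rd R d)), measurable A -> Pr (Y k @^-1` A) = Q A)
  (XY_indep : mutually_independent Pr
     (fun s : nat + nat => match s with inl k => X k | inr k => Y k end)) :
  cvg_in_law Pr
    (fun n w => Num.sqrt n%:R *
       (fine (Tc (cost_of h) (empirical (fun k => X k w) n) Q)
        - fine (Tc (cost_of h) (discrete_measure x p) Q)))
    (fun f => gauss1 f (Num.sqrt (sigma2 p z)))
  /\
  ((forall i, (\int[Q]_y ((h (x i - y)) ^+ 2)%:E < +oo)%E) ->
   cvg_in_law Pr
     (fun m w => Num.sqrt m%:R *
        (fine (Tc (cost_of h) (discrete_measure x p) (empirical (fun k => Y k w) m))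
         - fine (Tc (cost_of h) (discrete_measure x p) Q)))
     (fun f => gauss1 f (Num.sqrt (sigma2c (cost_of h) x Q z (Ordinal hN))))
   /\
   forall lam : R, 0 < lam < 1 ->
   forall nn mm : nat -> nat,
     nn @ \oo --> \oo -> mm @ \oo --> \oo ->
     (fun k => (mm k)%:R / ((nn k)%:R + (mm k)%:R) : R) @ \oo --> lam ->
     cvg_in_law Pr
       (fun k w => Num.sqrt ((nn k)%:R * (mm k)%:R / ((nn k)%:R + (mm k)%:R)) *
          (fine (Tc (cost_of h) (empirical (fun j => X j w) (nn k))
                                (empirical (fun j => Y j w) (mm k)))
           - fine (Tc (cost_of h) (discrete_measure x p) Q)))
       (fun f => gauss2 f (Num.sqrt lam * Num.sqrt (sigma2 p z))
                          (Num.sqrt (1 - lam) *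
                           Num.sqrt (sigma2c (cost_of h) x Q z (Ordinal hN))))).
Proof.
have [z_val z0] := z_opt; set i0 := Ordinal hN in z_val z0 *.
have h_cont : continuous h by move=> u; exact: differentiable_continuous.
pose c := sitecost x h.
have mc i : measurable_fun setT (c i) by exact: measurable_sitecost.
have ic i : integrableR Q (c i).
  apply: integrableR_ge0 => //; first by move=> y; exact: h_ge0.
  exact: (Q_int i).
pose P := discrete_prob (x : 'I_N -> Rd R d) (fun i => ltW (p_pos i)) p_sum.
have PE : (P : set (Rd R d) -> \bar R) = discrete_measure x p by exact: discrete_probE.
have XP k A : measurable A -> Pr (X k @^-1` A) = P A by move=> mA; rewrite PE X_law.
have icm v : integrableR Q (cmin i0 c v) by exact: integrable_cmin.
have TcE : Tc (cost_of h) (discrete_measure x p) Q = (dual i0 c p Q z)%:E.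
  by rewrite z_val /gc /dual EFinD Rintegral_EFin.
have zmax v : dual i0 c p Q v <= dual i0 c p Q z.
  by rewrite -lee_fin -TcE; exact: dual_le_Tc.
have z_unique v : v i0 = z i0 -> dual i0 c p Q z <= dual i0 c p Q v -> v = z.
  move=> vz zv; apply: (@dual_maximizer_unique R d N i0 c p Q) => // i.
  exact: (@continuous_sitecost R d N x h h_cont i).
have s2 : 0 <= sigma2 p z by exact: (sigma2_ge0 x_inj z PE).
have s2cE : sigma2c (cost_of h) x Q z i0 = cmin_variance i0 x h Q z by [].
(* Zero observations of [X] restore the true first marginal. *)
have freq0 w : freq x X P 0 w = p by apply/funext => i; exact: (Rintegral_site x_inj PE).
have clt := transport_clt x_inj h_ge0 h_cont p_pos p_sum ic z0 zmax z_unique PE X_meas Y_meas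
  XP Y_law XY_indep.
have XE n w : (forall j, exists i, X j w = x i) ->
    empirical (fun k => X k w) n.+1 = discrete_measure x (freq x X P n.+1 w).
  by move=> Xx; exact: (empirical_discrete P n x_inj Xx).
have YE n w : empirical (fun k => Y k w) n.+1 = observed_law Q Y n.+1 w :> (set (Rd R d) -> \bar R).
  by rewrite /observed_law empirical_probE.
(* By the convention [0^-1 = 0], a sample kept at size zero satisfies the limit conditions on
   inverse sizes. *)
have cst0 : (fun=> 0%N%:R^-1 : R) @ \oo --> (0 : R) by rewrite invr0; exact: cvg_cst.
have pos_near (s : nat -> nat) : s @ \oo --> \oo -> \forall k \near \oo, (0 < s k)%N.
  by move/cvgnyPge => /(_ 1%N).
have idoo : (fun k : nat => k) @ \oo --> \oo by exact: cvg_id.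
have sqrt_ratio : (fun k : nat => Num.sqrt k%:R ^+ 2 / k%:R : R) @ \oo --> (1 : R).
  apply: cvg_near_cst; apply: filterS (pos_near _ idoo) => k k0.
  by rewrite sqr_sqrtr// mulfV// pnatr_eq0 -lt0n.
have zero_ratio (r : nat -> R) : (fun k => r k ^+ 2 / 0%:R) @ \oo --> (0 : R).
  by under eq_fun do rewrite invr0 mulr0; exact: cvg_cst.
split=> [f cf [M fM]|Q2].
  rewrite (gauss1_average _ (continuous_measurable_fun cf) fM).
  (* Only [X] is sampled: at rate [Num.sqrt n] the two variances enter with coefficients 1 and 0. *)
  apply: (clt (fun k => k) (fun=> 0%N) (fun k => Num.sqrt k%:R) 1 0) => //.
  - exact: cvg_natV.
  - by right.
  - apply: filterS (pos_near _ idoo) => -[//|k] _ w Xx.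
    by rewrite XE// TcE.
  - by rewrite sqr_sqrtr// mul0r mul1r addr0.
have c2 i : integrableR Q (fun y => c i y ^+ 2).
  apply: integrableR_ge0; [exact: measurable_funX|by move=> y; exact: sqr_ge0|].
  exact: (Q2 i).
have s2c : 0 <= sigma2c (cost_of h) x Q z i0 by rewrite s2cE; exact: cmin_variance_ge0.
split=> [f cf [M fM]|lam /andP[lam0 lam1] nn mm noo moo ratio f cf [M fM]].
  rewrite (gauss1_average _ (continuous_measurable_fun cf) fM).
  apply: (clt (fun=> 0%N) (fun k => k) (fun k => Num.sqrt k%:R) 0 1) => //.
  - exact: cvg_natV.
  - by left.
  - apply: filterS (pos_near _ idoo) => -[//|k] _ w Xx.
    by rewrite YE TcE /sample_cost freq0.
  - by rewrite sqr_sqrtr// mul0r mul1r add0r s2cE.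
(* The standard deviation of the combination of the two independent Gaussians, which is again
   centred Gaussian. *)
pose c0 := Num.sqrt (lam * sigma2 p z + (1 - lam) * sigma2c (cost_of h) x Q z i0).
have lam1' : 0 <= 1 - lam by rewrite subr_ge0 ltW.
have c0E : c0 ^+ 2 = lam * sigma2 p z + (1 - lam) * sigma2c (cost_of h) x Q z i0.
  by rewrite sqr_sqrtr// addr_ge0// mulr_ge0// ltW.
have c00 : 0 <= c0 by exact: sqrtr_ge0.
rewrite (gauss2_average (c := c0) _ _ _ _ cf fM) ?mulr_ge0 ?sqrtr_ge0//; last first.
  by rewrite c0E !exprMn !sqr_sqrtr// ltW.
have nm_near : \forall k \near \oo, (0 < nn k)%N /\ (0 < mm k)%N.
  by apply: filterS2 (pos_near _ noo) (pos_near _ moo).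
have denom k : (0 < nn k)%N -> (0 < mm k)%N ->
    [/\ (nn k)%:R != 0 :> R, (mm k)%:R != 0 :> R & (nn k)%:R + (mm k)%:R != 0 :> R].
  by move=> n0 m0; rewrite -natrD !pnatr_eq0 -!lt0n addn_gt0 n0 m0.
have r2 k : Num.sqrt ((nn k)%:R * (mm k)%:R / ((nn k)%:R + (mm k)%:R)) ^+ 2 =
    (nn k)%:R * (mm k)%:R / ((nn k)%:R + (mm k)%:R) :> R.
  by rewrite sqr_sqrtr// divr_ge0// ?mulr_ge0// addr_ge0.
apply: (clt nn mm (fun k => Num.sqrt ((nn k)%:R * (mm k)%:R / ((nn k)%:R + (mm k)%:R)))
  lam (1 - lam)) => //.
- exact: cvg_natV.
- exact: cvg_natV.
(* Once both sizes are positive, [r ^+ 2 / n] is [m / (n + m)]; the next goal concerns [r ^+ 2 / m],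
   its complement to 1. *)
- apply: cvg_trans ratio; apply: near_eq_cvg; apply: filterS nm_near => k [n0 m0].
  rewrite r2; have [] := denom k n0 m0.
  by move: (nn k)%:R (mm k)%:R => a b a0 b0 ab0; field; rewrite ?a0 ?b0 ?ab0.
- have : (fun k => 1 - (mm k)%:R / ((nn k)%:R + (mm k)%:R) : R) @ \oo --> 1 - lam.
    by apply: cvgB => //; exact: cvg_cst.
  apply: cvg_trans; apply: near_eq_cvg; apply: filterS nm_near => k [n0 m0].
  rewrite r2; have [] := denom k n0 m0.
  by move: (nn k)%:R (mm k)%:R => a b a0 b0 ab0; field; rewrite ?a0 ?b0 ?ab0.
- by left.
- apply: filterS nm_near => k [n0 m0] w Xx; rewrite /sample_cost TcE.
  by case: (nn k) (mm k) n0 m0 => [//|n] [//|m] _ _; rewrite XE// YE.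
Qed.
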